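(* Let $E$ be a function satisfying (K1)–(K5) (with data $c,\mathcal Z,K,\Lambda,\tau$), and define $$A(z):=\tfrac12\bigl(E(z)+E^\sharp(z)\bigr),\qquad B(z):=\tfrac{i}{2}\bigl(E(z)-E^\sharp(z)\bigr).$$ Let $I_\tau=(-\infty,\tau)$, let $H$ be the Hamiltonian on $I_\tau$ given by $$H(t)=\begin{bmatrix}1/\gamma(t)&0\\0&\gamma(t)\end{bmatrix},\quad \gamma(t)=m(t)^2,\quad m(t)=\frac{\det(1+\mathsf K[t])}{\det(1-\mathsf K[t])},$$ and let $\Phi(t,x)$, $\Psi(t,x)$ ($x\in\mathbb R$, $t<\tau$) be the unique solutions of $$\Phi(t,x)+\int_{-\infty}^tK(x+y)\Phi(t,y)\,dy=1,\qquad \Psi(t,x)-\int_{-\infty}^tK(x+y)\Psi(t,y)\,dy=1.$$ Define $A(t,z)$ and $B(t,z)$ by $$A(t,z)=-\frac{iz}{2}E(z)\int_t^\infty\Psi(t,x)e^{izx}\,dx,\qquad -iB(t,z)=-\frac{iz}{2}E(z)\int_t^\infty\Phi(t,x)e^{izx}\,dx.$$ Then: (1) for each $t\in I_\tau$, $A(t,z)$ and $B(t,z)$ are well-defined for $\Im(z)>c$ and extend to analytic functions on $\mathbb C\setminus\mathcal Z$ satisfying $A(t,-z)=A(t,z)$, $B(t,-z)=-B(t,z)$, $A(t,z)=\overline{A(t,\bar z)}$ and $B(t,z)=\overline{B(t,\bar z)}$; (2) for each $z\in\mathbb C\setminus\mathcal Z$, $A(t,z)$ and $B(t,z)$ are continuously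 differentiable with respect to $t$; (3) for every $z\in\mathbb C\setminus\mathcal Z$, $A(t,z)$ and $B(t,z)$ solve on $I_\tau$ the first-order system $$-\frac{d}{dt}\begin{bmatrix}A(t,z) \\ B(t,z)\end{bmatrix}=z\begin{bmatrix}0&-1\\1&0\end{bmatrix}H(t)\begin{bmatrix}A(t,z) \\ B(t,z)\end{bmatrix};$$ (4) $A(z)=A(0,z)$, $B(z)=B(0,z)$ and $E(z)=A(0,z)-iB(0,z)$.
   Context: Notation: $F^\sharp(z)=\overline{F(\bar z)}$; $(\mathsf Ff)(z)=\int_{-\infty}^\infty f(x)e^{izx}\,dx$; $\mathbf 1_A$ is the characteristic function of $A\subset\mathbb R$; $\ll$ is the Vinogradov symbol; $\det$ is the Fredholm determinant. Conditions on $E$: (K1) There exist $c>0$ and a discrete subset $\mathcal Z\subset\mathbb C$ (possibly empty or infinite) with $0\notin\mathcal Z$, contained in the horizontal strip $-c\le\Im z\le c$ and closed under $z\mapsto\bar z$ and $z\mapsto-z$, such that $E$ is analytic in $\mathbb C\setminus\mathcal Z$ and $E^\sharp(z)=E(-z)$ for $z\in\mathbb C\setminus\mathcal Z$. (K2) There exists a real-valued continuous function $K$ on $\mathbb R$ such that $|K(x)|\ll\exp(c|x|)$ as $|x|\to\infty$ and $E^\sharp(z)/E(z)=(\mathsf FK)(z)$ for $\Im(z)>c$, where $c$ is the constant in (K1). (K3) $K$ vanishes on $(-\infty,0)$. (K4) $K$ is continuously differentiable outside a discrete subset $\Lambda\subset\mathbb R$, and $K'\in L^1_{\rm loc}(\mathbb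 R)$. (K5) There exists $0<\tau\le\infty$ such that neither $+1$ nor $-1$ is an eigenvalue of the operator $\mathsf K[t]:f(x)\mapsto\mathbf 1_{(-\infty,t)}(x)\int_{-\infty}^tK(x+y)f(y)\,dy$ on $L^2(-\infty,t)$ for every $0\le t<\tau$. Under (K2) and (K3) the operators $\mathsf K[t]$ are well-defined, Hilbert–Schmidt and self-adjoint, and $\mathsf K[t]=0$ for $t\le0$. A Hamiltonian on an interval is a $2\times2$ real symmetric matrix-valued function that is positive semidefinite almost everywhere, not identically zero on any subset of positive Lebesgue measure, and locally integrable; under (K2)–(K5), $\gamma$ is a continuous positive function on $I_\tau$, so that $H$ is a Hamiltonian. *)

(* Defs.v *)
From HB Require Import structures.
From mathcomp Require Import all_boot all_order all_algebra.
From mathcomp Require Import complex.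
From mathcomp Require Import all_classical all_reals all_analysis.

Set Implicit Arguments.
Unset Strict Implicit.
Unset Printing Implicit Defensive.

Import Order.TTheory GRing.Theory Num.Theory.
Import numFieldNormedType.Exports.

Local Open Scope classical_set_scope.
Local Open Scope ring_scope.
Local Open Scope complex_scope.

Notation leb R := (@lebesgue_measure R).

Definition cexp (R : realType) (z : R[i]) : R[i] :=
  (expR (complex.Re z))%:C * (cos (complex.Im z) +i* sin (complex.Im z)).

Definition cintegrable (R : realType) (D : set R) (f : R -> R[i]) : Prop :=
  (leb R).-integrable D (fun x => (complex.Re (f x))%:E) /\
  (leb R).-integrable D (fun x => (complex.Im (f x))%:E).

Definition cintegral (R : realType) (D : set R) (f : R -> R[i]) : R[i] :=
  (\int[leb R]_(x in D) complex.Re (f x)) +i*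
  (\int[leb R]_(x in D) complex.Im (f x)).

Definition expi (R : realType) (z : R[i]) (x : R) : R[i] :=
  cexp ('i * z * x%:C).

Definition fourier (R : realType) (f : R -> R[i]) (z : R[i]) : R[i] :=
  cintegral setT (fun x => f x * expi z x).

Definition sharp (R : realType) (F : R[i] -> R[i]) (z : R[i]) : R[i] :=
  (F (z^*))^*.

(* The complement of Z is open whenever this is used ([locally_finite] below),
   so complex differentiability at each of its points is analyticity. *)
Definition analytic_off (R : realType) (Z : set R[i]) (F : R[i] -> R[i]) :
    Prop :=
  forall z : R[i], ~ Z z -> derivable (F : R[i]^o -> R[i]^o) z 1.

(* Discrete subset in the sense of complex analysis: no accumulation point in
   the ambient space, so that the set is closed. *)
Definition locally_finite (T : topologicalType) (S : set T) : Prop :=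
  limit_point S = set0.

(* The quotient F / G of analytic functions, as a meromorphic function, takes
   the value v at z. Where G z != 0 this says F z / G z = v; a zero of G is
   allowed if the singularity of F / G there is removable. *)
Definition mero_quotient (R : realType) (F G : R[i] -> R[i]) (z v : R[i]) :
    Prop :=
  (\forall w \near (z : R[i]^o)^', G w != 0) /\
  ((fun w : R[i]^o => (F w / G w : R[i]^o)) @ (z : R[i]^o)^' --> (v : R[i]^o)).

Definition condK1 (R : realType) (E : R[i] -> R[i]) (c : R) (Z : set R[i]) :
    Prop :=
  0 < c /\
  locally_finite (Z : set R[i]^o) /\
  ~ Z 0 /\
  (forall z, Z z -> - c <= complex.Im z <= c) /\
  (forall z, Z z -> Z (z^*)) /\
  (forall z, Z z -> Z (- z)) /\
  analytic_off Z E /\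
  (forall z, ~ Z z -> sharp E z = E (- z)).

Definition condK2 (R : realType) (E : R[i] -> R[i]) (c : R) (K : R -> R) :
    Prop :=
  continuous K /\
  (exists C X : R, forall x, X <= `|x| -> `|K x| <= C * expR (c * `|x|)) /\
  (forall z, c < complex.Im z ->
     mero_quotient (sharp E) E z (fourier (fun x => (K x)%:C) z)).

Definition condK3 (R : realType) (K : R -> R) : Prop :=
  forall x, x < 0 -> K x = 0.

(* On the (null) set Lam the values of derive1 K are irrelevant to its local
   integrability. *)
Definition condK4 (R : realType) (K : R -> R) (Lam : set R) : Prop :=
  locally_finite Lam /\
  (forall x, ~ Lam x -> derivable K x 1 /\ {for x, continuous (derive1 K)}) /\
  locally_integrable setT (derive1 K).

Definition in_L2 (R : realType) (D : set R) (f : R -> R[i]) : Prop :=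
  measurable_fun D (fun x => complex.Re (f x)) /\
  measurable_fun D (fun x => complex.Im (f x)) /\
  (leb R).-integrable D
    (fun x => (complex.Re (f x) ^+ 2 + complex.Im (f x) ^+ 2)%:E).

Definition opK (R : realType) (K : R -> R) (t : R) (f : R -> R[i]) :
    R -> R[i] :=
  fun x => (\1_`]-oo, t[%classic x)%:C *
           cintegral `]-oo, t[ (fun y => (K (x + y))%:C * f y).

Definition eigenvalue_opK (R : realType) (K : R -> R) (t : R) (a : R[i]) :
    Prop :=
  exists f : R -> R[i],
    in_L2 `]-oo, t[ f /\
    ~ {ae leb R, forall x, `]-oo, t[%classic x -> f x = 0} /\
    {ae leb R, forall x, `]-oo, t[%classic x -> opK K t f x = a * f x}.

Definition condK5 (R : realType) (K : R -> R) (tau : \bar R) : Prop :=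
  (0 < tau)%E /\
  (forall t : R, 0 <= t -> (t%:E < tau)%E ->
     ~ eigenvalue_opK K t 1 /\ ~ eigenvalue_opK K t (- 1)).

(* Integral of F over D ^ n, as an iterated integral; a point of D ^ n is
   presented as the sequence of its coordinates. *)
Fixpoint iter_integral (R : realType) (D : set R) (n : nat) (F : seq R -> R) :
    R :=
  if n is n'.+1 then
    \int[leb R]_(x in D) iter_integral D n' (fun s => F (x :: s))
  else F [::].

(* Fredholm's series for det (1 + a k), where k is the integral operator on
   L^2(D) with the continuous kernel k. *)
Definition fredholm_det (R : realType) (D : set R) (k : R -> R -> R) (a : R) :
    R :=
  limn (series (fun n : nat => a ^+ n / (n`!)%:R *
    iter_integral D n
      (fun s => \det (\matrix_(i < n, j < n) k (s`_i) (s`_j))))).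

Definition det1D (R : realType) (K : R -> R) (t a : R) : R :=
  fredholm_det `]-oo, t[ (fun x y => K (x + y)) a.

Definition m_fun (R : realType) (K : R -> R) (t : R) : R :=
  det1D K t 1 / det1D K t (- 1).

Definition gamma_fun (R : realType) (K : R -> R) (t : R) : R := m_fun K t ^+ 2.

Definition mx2 (T : pzRingType) (a b c d : T) : 'M[T]_2 :=
  \matrix_(i < 2, j < 2)
    if i == 0 then (if j == 0 then a else b) else (if j == 0 then c else d).

Definition cv2 (T : pzRingType) (a b : T) : 'cV[T]_2 :=
  \col_(i < 2) (if i == 0 then a else b).

Definition hamiltonian (R : realType) (K : R -> R) (t : R) : 'M[R]_2 :=
  mx2 (gamma_fun K t)^-1 0 0 (gamma_fun K t).

(* The integral is only required to converge absolutely for every x. This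
   already determines f when K is continuous and vanishes on the negative
   half-line and - a is not an eigenvalue of opK K t, for a = 1 or - 1: then f
   is continuous, and f = 1 on ]-oo, - t[. *)
Definition solves_one (R : realType) (K : R -> R) (a t : R) (f : R -> R[i]) :
    Prop :=
  forall x : R,
    cintegrable `]-oo, t[ (fun y => (K (x + y))%:C * f y) /\
    f x + a%:C * cintegral `]-oo, t[ (fun y => (K (x + y))%:C * f y) = 1.

Definition A_of (R : realType) (E : R[i] -> R[i]) (z : R[i]) : R[i] :=
  (E z + sharp E z) / 2.

Definition B_of (R : realType) (E : R[i] -> R[i]) (z : R[i]) : R[i] :=
  'i / 2 * (E z - sharp E z).

Definition AB_integral (R : realType) (E : R[i] -> R[i]) (f : R -> R[i])
    (t : R) (z : R[i]) : R[i] :=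
  - ('i * z / 2) * E z * cintegral `]t, +oo[ (fun x => f x * expi z x).

Definition cderive (R : realType) (g : R -> R[i]) (t : R) : R[i] :=
  derive1 (fun s => complex.Re (g s)) t +i*
  derive1 (fun s => complex.Im (g s)) t.

(* For use at all points of an open interval. *)
Definition cont_diff_at (R : realType) (g : R -> R[i]) (t : R) : Prop :=
  derivable (fun s => complex.Re (g s)) t 1 /\
  derivable (fun s => complex.Im (g s)) t 1 /\
  {for t, continuous (derive1 (fun s => complex.Re (g s)))} /\
  {for t, continuous (derive1 (fun s => complex.Im (g s)))}.

(* Main.v *)
Require Import Defs.
From HB Require Import structures.
From mathcomp Require Import all_boot all_order all_algebra all_fingroup.
From mathcomp Require Import complex spectral sesquilinear.
From mathcomp Require Import all_classical all_reals all_analysis.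
From mathcomp Require Import ring lra zify.

Set Implicit Arguments.
Unset Strict Implicit.
Unset Printing Implicit Defensive.

Import Order.TTheory GRing.Theory Num.Theory.
Import numFieldNormedType.Exports.

Local Open Scope classical_set_scope.
Local Open Scope ring_scope.

(** The kernel [K (x + y)] vanishes for [x + y < 0], so for [|t| <= T] all the
    integrals over the half-line before [t] are integrals over [[- T, t]], and
    the theory of the operators is Fredholm's theory of a continuous kernel on
    a compact interval, with a parameter [g = 1] or [- 1] in front of the kernel.

    Real variable. Fredholm's series [fdet] and [fminor] are sums of iterated
    integrals of determinants; Hadamard's inequality makes them converge, and
    expanding the determinants gives the resolvent equation
    ([fminorw_eq], [resolvent_eq]). If [1 + g K] is injective then [fdet] does
    not vanish ([fdet_neq0]). Hence [phi g t x], the solution of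
    [phi + g K phi = 1] (so [Phi] for [g = 1] and [Psi] for [g = - 1]), is
    [1 - g] times the integral of the resolvent [r g t]. Differentiating the
    equation in [t], and integrating by parts in [x], yields with
    [p g t = phi g t t]
    - [d/dt phi g t x = - g * p g t * r g t x t] ([sol_t_unif]),
    - [d/dx phi g t x = - g * p g t * r (- g) t x t] ([sol_x]),
    so the [t]-derivative of [phi g] is, up to the factor [- p g / p (- g)], the
    [x]-derivative of [phi (- g)]; this is where it matters that the kernel is a
    function of [x + y]. The logarithmic derivative of [fdet g] is
    [g * r g t t t], and that of [p g] is [- g * (r g t t t + r (- g) t t t)], so
    the quantity [p g * fdet g / fdet (- g)] is constant, equal to [1];
    thus [p (- 1) = m], [p 1 = 1 / m] and [p (- 1) ^+ 2] is the function [gamma]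
    ([diag_sol_fdet], [phi_diag_gamma]).

    Complex variable. Put
    [J g t z = exp (- i z T) / 2 + (i z / 2) \int_(- T)^t phi g t x exp (i z x) dx],
    which does not depend on [T >= |t|] since [phi g t = 1] before [- t]. It is
    entire in [z]. The two derivatives above and one integration by parts give
    [d/dt J g t z = i z (p g t) ^+ 2 J (- g) t z] ([J_cder]). Therefore
    [A t z = E z J (- 1) t z + E (- z) J (- 1) t (- z)] and
    [B t z = i (E z J 1 t z - E (- z) J 1 t (- z))] solve the system, have the
    stated symmetries because [phi] is real, and reduce to the halves of [E] at
    [t = 0], where [J = 1 / 2].

    It remains to identify them with the half-line integrals when [Im z > c].
    Transforming the integral equation of [phi] over [[- T, X]], exchanging the
    integrals and letting [X] tend to infinity expresses the transform of
    [phi g t] over the half-line after [t] by [J g t z - g F(z) J g t (- z)],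
    where [F] is the Fourier transform of [K] ([half_line_transform],
    [J_half_line]); and [E z F(z) = E (- z)] ([quotient_mul]).

    The given solutions [Phi] and [Psi] are only assumed to have convergent
    integrals. Unless [K] is [0] everywhere, its translates show that such a
    solution is locally integrable ([locint_of_shift]), hence continuous, and by
    injectivity it is real and the unique one ([solves_one_real]). *)

(** * Calculus of integrals of continuous functions *)

Section Integral.
Variable R : realType.
Implicit Types (f g : R -> R) (a b c x y e L M B d r t : R).

(** Most derivatives below are of integrals with varying ends and integrands,
    for which an explicit first-order estimate is what the proofs produce and use. *)
Lemma is_deriveE f x d : is_derive x (1:R) f d <->
  forall e, 0 < e -> exists2 r, 0 < r & forall y, `|y - x| < r ->
    `|f y - f x - d * (y - x)| <= e * `|y - x|.
Proof.
split=> [[fx <-] e e0|H].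
  move: (fx) => /cvgrPdist_le/(_ _ e0)/nbhs_ballP[r/= r0 rh].
  exists r => // y yx; have [->|yNx] := eqVneq y x.
    by rewrite !subrr mulr0 subrr normr0 mulr0.
  have yx0 : y - x != 0 by rewrite subr_eq0.
  have := rh (y - x); rewrite /ball/= sub0r normrN => /(_ yx yx0).
  rewrite -[_ *: 1]/((y - x) * 1) mulr1 subrK -[_ *: _]/((y - x)^-1 * _).
  rewrite -/(derive f x 1) => H.
  rewrite -[X in X <= _]normrN opprB.
  rewrite (_ : _ - _ = ('D_1 f x - (y - x)^-1 * (f y - f x)) * (y - x)); last first.
    by field.
  by rewrite normrM ler_wpM2r.
suff C : h^-1 *: ((f \o shift x) (h *: 1) - f x) @[h --> 0^'] --> d.
  split; first by apply/cvg_ex; exists d.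
  exact: cvg_lim.
apply/cvgrPdist_le => e e0; have [r r0 rh] := H _ e0.
apply/nbhs_ballP; exists r => //= h; rewrite /ball/= sub0r normrN => hr h0.
have := rh (h + x); rewrite addrK => /(_ hr) H1.
rewrite -[_ *: 1]/(h * 1) mulr1 -[_ *: _]/(h^-1 * _).
rewrite -(ler_pM2r (_ : 0 < `|h|)) ?normr_gt0// -normrM mulrBl.
rewrite mulrAC mulVf// mul1r -normrN opprB//.
Qed.

Definition itg a b f : R := \int[@lebesgue_measure R]_(x in `[a, b]) f x.

Lemma cont_integrable a b f : continuous f ->
  (@lebesgue_measure R).-integrable `[a, b] (EFin \o f).
Proof.
move=> cf; apply: continuous_compact_integrable; first exact: segment_compact.
exact: continuous_subspaceT.
Qed.

Lemma itgD a b f g : continuous f -> continuous g ->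
  itg a b (fun x => f x + g x) = itg a b f + itg a b g.
Proof. by move=> cf cg; rewrite /itg RintegralD//; exact: cont_integrable. Qed.

Lemma itgB a b f g : continuous f -> continuous g ->
  itg a b (fun x => f x - g x) = itg a b f - itg a b g.
Proof. by move=> cf cg; rewrite /itg RintegralB//; exact: cont_integrable. Qed.

Lemma itgZ a b c f : continuous f -> itg a b (fun x => c * f x) = c * itg a b f.
Proof. by move=> cf; rewrite /itg RintegralZl//; exact: cont_integrable. Qed.

Lemma itgN a b f : continuous f -> itg a b (fun x => - f x) = - itg a b f.
Proof.
move=> cf; rewrite -mulN1r -itgZ//; apply: eq_Rintegral => x _.
by rewrite mulN1r.
Qed.

Lemma itg_lt a b f : b < a -> itg a b f = 0.
Proof.
move=> ba; rewrite /itg set_itv_ge ?Rintegral_set0//.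
by rewrite bnd_simp -ltNge.
Qed.

Lemma itg_aa a f : itg a a f = 0.
Proof. by rewrite /itg set_itv1 Rintegral_set1. Qed.

Lemma itg_cst a b c : a <= b -> itg a b (fun=> c) = c * (b - a).
Proof.
move=> ab; rewrite /itg Rintegral_cst//= lebesgue_measure_itv/= lte_fin.
case: (ltgtP a b) ab => [ab _|//|-> _]; first by rewrite -EFinD.
by rewrite subrr.
Qed.

Lemma eq_itg a b f g : (forall x, a <= x <= b -> f x = g x) -> itg a b f = itg a b g.
Proof.
move=> fg; apply: eq_Rintegral => x; rewrite inE/= in_itv/= => xab.
exact: fg.
Qed.

Lemma le_itg a b f g : continuous f -> continuous g ->
  (forall x, a <= x <= b -> f x <= g x) -> itg a b f <= itg a b g.
Proof.
move=> cf cg fg; apply: le_Rintegral; [by []|exact: cont_integrable..|].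
by move=> x/=; rewrite in_itv/=; exact: fg.
Qed.

Lemma itg_norm a b f : continuous f -> `|itg a b f| <= itg a b (fun x => `|f x|).
Proof. by move=> cf; apply: le_normr_Rintegral => //; exact: cont_integrable. Qed.

Lemma cont_norm f : continuous f -> continuous (fun x => `|f x|).
Proof. by move=> cf x; apply: cvg_norm; exact: cf. Qed.

Lemma cont_cst c : continuous (fun _ : R => c).
Proof. by move=> x; exact: cvg_cst. Qed.

Lemma itg_bound a b f M : continuous f -> a <= b ->
  (forall x, a <= x <= b -> `|f x| <= M) -> `|itg a b f| <= M * (b - a).
Proof.
move=> cf ab fM; apply: le_trans (itg_norm _ _ cf) _.
rewrite -itg_cst//; apply: le_itg => //; [exact: cont_norm|exact: cont_cst].
Qed.

Lemma itg_chasles a b c f : continuous f -> a <= b -> b <= c ->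
  itg a c f = itg a b f + itg b c f.
Proof.
move=> cf ab bc.
have := @Rintegral_itvB R f (BLeft a) (BRight c) b.
move=> /(_ (cont_integrable _ _ cf)); rewrite !bnd_simp => /(_ ab bc) H.
rewrite -[LHS](subrK (itg a b f)) addrC; congr (_ + _).
rewrite {1 2}/itg H Rintegral_itv_obnd_cbnd//.
by apply: integrableS (cont_integrable b c cf) => //; apply: subset_itv_oc_cc.
Qed.

Lemma contP f : continuous f <-> forall x e, 0 < e ->
  exists2 d, 0 < d & forall y, `|x - y| < d -> `|f x - f y| < e.
Proof.
split=> [cf x e e0|H x].
  by have /cvgrPdist_lt/(_ _ e0)/nbhs_ballP[d /= d0 df] := cf x; exists d.
apply/cvgrPdist_lt => e e0; have [d d0 df] := H x _ e0.
by apply/nbhs_ballP; exists d.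
Qed.

Lemma heine f L e : continuous f -> 0 < e ->
  exists2 d, 0 < d & forall x y, `|x| <= L -> `|x - y| < d -> `|f x - f y| < e.
Proof.
move=> cf e0.
have := @segment_compact R (- L) L.
move/compact_near_coveringP => /(_ _ (0 : R)^'+
  (fun d x => forall y, `|x - y| < d -> `|f x - f y| < e)) H.
have : \forall d \near (0:R)^'+, `[- L, L] `<=`
    (fun x => forall y, `|x - y| < d -> `|f x - f y| < e).
  apply: H => x _.
  have e20 : 0 < e / 2 by rewrite divr_gt0.
  have [r r0 rf] := (contP f).1 cf x _ e20.
  near=> x' d => y /= xy.
  have x'r : `|x - x'| < r / 2.
    by near: x'; apply: nbhsx_ballx; rewrite divr_gt0.
  have dr : d < r / 2 by near: d; apply: nbhs_right_lt; rewrite divr_gt0.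
  have h1 : `|f x - f x'| < e / 2.
    by apply: rf; lra.
  have h2 : `|f x - f y| < e / 2.
    apply: rf.
    rewrite (_ : x - y = (x - x') + (x' - y)); last by ring.
    by apply: (le_lt_trans (ler_normD _ _)); lra.
  rewrite (_ : f x' - f y = - (f x - f x') + (f x - f y)); last by ring.
  by apply: (le_lt_trans (ler_normD _ _)); rewrite normrN; lra.
move=> /nbhs_ballP[r/= r0 rh]; exists (r / 2); first by rewrite divr_gt0.
move=> x y xL xy; apply: (rh (r / 2) _ _ x) => //.
- rewrite /ball/= sub0r normrN gtr0_norm ?divr_gt0//; lra.
- by rewrite divr_gt0.
- by rewrite /= in_itv/= -ler_norml.
Unshelve. all: end_near. Qed.

Lemma cont_bounded f L : continuous f ->
  exists2 M, 0 < M & forall x, `|x| <= L -> `|f x| <= M.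
Proof.
move=> cf; have [L0|L0] := leP 0 L; last first.
  by exists 1 => // x xL; have := le_trans (normr_ge0 x) xL; lra.
have nf := cont_norm cf.
have LL : - L <= L by lra.
have [c _ cM] := EVT_max LL (continuous_subspaceT nf).
exists (`|f c| + 1); first by rewrite ltr_pwDr.
move=> x xL; apply: (le_trans (cM x _)); last by rewrite lerDl.
by rewrite in_itv/= -ler_norml.
Qed.

Lemma itg_derive a b f : continuous f -> a < b ->
  is_derive b (1:R) (fun t => itg a t f) (f b).
Proof.
move=> cf ab.
have bb : b < b + 1 by lra.
have [d e] := @continuous_FTC1_closed R f a b (b+1) bb (cont_integrable _ _ cf) ab (cf b).
by split; [exact: d|rewrite -derive1E; exact: e].
Qed.

Lemma itg_FTC a b f F : a <= b -> continuous f -> continuous F ->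
  (forall x, a < x < b -> is_derive x (1:R) F (f x)) ->
  itg a b f = F b - F a.
Proof.
rewrite le_eqVlt => /predU1P[->|ab] cf cF dF; first by rewrite itg_aa subrr.
rewrite /itg /Rintegral (@continuous_FTC2 R f F a b)//.
- exact: continuous_subspaceT.
- split.
  + by move=> x; rewrite in_itv/= => xab; have [] := dF _ xab.
  + by apply: cvg_at_right_filter; exact: cF.
  + by apply: cvg_at_left_filter; exact: cF.
- by move=> x; rewrite in_itv/= => xab; rewrite derive1E; have [] := dF _ xab.
Qed.

Lemma itg_end a b b' f B : continuous f -> 0 <= B ->
  (forall x, a <= x <= Num.max b b' -> `|f x| <= B) ->
  `|itg a b f - itg a b' f| <= B * `|b - b'|.
Proof.
move=> cf B0; wlog bb : b b' / b' <= b.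
  move=> W H; have [h|h] := leP b' b; first exact: W.
  by rewrite distrC (distrC b); apply: W; [lra|rewrite maxC].
move=> H; rewrite (max_idPl bb) in H.
rewrite (ger0_norm (_ : 0 <= b - b')) ?subr_ge0//.
have [ab'|b'a] := leP a b'.
  rewrite (itg_chasles cf ab' bb) addrAC subrr add0r.
  by apply: itg_bound => // x /andP[x1 x2]; apply: H; rewrite x2 andbT; lra.
rewrite (itg_lt _ b'a) subr0.
have [ab|ba] := leP a b; last first.
  by rewrite itg_lt// normr0 mulr_ge0// subr_ge0.
apply: (@le_trans _ _ (B * (b - a))); first exact: itg_bound.
by rewrite ler_wpM2l//; lra.
Qed.

Lemma itg_cont a f : continuous f -> continuous (fun t => itg a t f).
Proof.
move=> cf; apply/contP => t e e0.
have [B B0 fB] := cont_bounded (`|a| + `|t| + 1) cf.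
exists (Num.min 1 (e / B)) => [|t']; first by rewrite lt_min ltr01 divr_gt0.
rewrite lt_min => /andP[t1 t2].
apply: le_lt_trans (_ : B * `|t - t'| < _); last first.
  by rewrite mulrC -ltr_pdivlMr.
apply: itg_end => //; first exact: ltW.
move=> x xt; apply: fB; move: xt; rewrite le_max => /andP[ax xt].
have h1 := ler_norm a; have h2 := ler_norm (- a); have h3 := ler_norm t.
have h4 := ler_norm (t' - t); rewrite distrC in h4; rewrite normrN in h2.
have := normr_ge0 a; have := normr_ge0 t => h5 h6.
by rewrite ler_norml; move/orP : xt => [xt|xt]; lra.
Qed.

Implicit Types (F G : seq R -> R) (s : seq R) (h : seq R -> R).

(** The integrands are functions of points of [R ^ n], presented as sequences.
    This is continuity in all coordinates jointly, uniform on boxes; entries are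
    read with default [0], so that no size has to be prescribed and the notion is
    stable under consing, reindexing and integration of the first coordinate. *)
Definition scont F := forall L e, 0 < e -> exists2 d, 0 < d &
  forall s s', (forall i, `|s`_i| <= L) -> (forall i, `|s'`_i| <= L) ->
    (forall i, `|s`_i - s'`_i| < d) -> `|F s - F s'| < e.

Lemma scont_bounded F L : scont F ->
  exists2 M, 0 < M & forall s, (forall i, `|s`_i| <= L) -> `|F s| <= M.
Proof.
move=> cF; have [L0|L0] := ltP L 0.
  exists 1 => // s /(_ 0%N) h; have := normr_ge0 s`_0; lra.
have [d d0 dF] := cF L 1 ltr01.
pose N := (Num.truncn (L / d)).+1.
have N0 : 0 < N%:R :> R by rewrite ltr0n.
have LN : L / N%:R < d.
  by rewrite ltr_pdivrMr// mulrC -ltr_pdivrMr// truncnS_gt.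
exists (`|F [::]| + N%:R + 1) => [|s sL].
  by rewrite ltr_wpDl// addr_ge0// ltW.
pose c k s := map (fun x => x * (k%:R / N%:R)) s.
have cE k i : (c k s)`_i = s`_i * (k%:R / N%:R).
  have [h|h] := ltP i (size s); first by rewrite (nth_map 0).
  by rewrite !nth_default ?size_map// mul0r.
have cL k : (k <= N)%N -> forall i, `|(c k s)`_i| <= L.
  move=> kN i; rewrite cE normrM (ger0_norm (_ : 0 <= k%:R / N%:R)); last first.
    by rewrite divr_ge0.
  apply: le_trans (sL i); rewrite ler_piMr// ler_pdivrMr// mul1r ler_nat//.
have H k : (k <= N)%N -> `|F (c k s)| <= `|F [::]| + 1 + k%:R.
  elim: k => [_|k IH kN].
    rewrite addr0 -[X in `|X|](subrK (F [::])); apply: (le_trans (ler_normD _ _)).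
    rewrite addrC lerD2l ltW//; apply: dF => [|i|i].
    - exact: cL.
    - by rewrite nth_nil normr0.
    - by rewrite cE nth_nil mul0r mulr0 subr0 normr0.
  rewrite -[X in `|X|](subrK (F (c k s))); apply: (le_trans (ler_normD _ _)).
  rewrite -natr1 addrA [X in X <= _]addrC; apply: lerD; first by apply/IH/ltnW.
  rewrite ltW//; apply: dF => [||i]; [exact: cL|exact/cL/ltnW|].
  rewrite !cE -mulrBr -mulrBl -natr1 addrAC subrr add0r mul1r normrM.
  rewrite (ger0_norm (_ : 0 <= N%:R^-1)) ?invr_ge0//.
  by apply: le_lt_trans LN; rewrite ler_wpM2r// invr_ge0 ltW.
have -> : s = c N s.
  have : all (fun _ => true) s by apply/allP.
  rewrite /c divff ?gt_eqF//; elim: s {sL c cE cL H} => //= x s IH _.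
  by rewrite mulr1; congr (_ :: _); apply: IH; apply/allP.
by apply: le_trans (H _ (leqnn _)) _; lra.
Qed.

Lemma scont_cst c : scont (fun=> c).
Proof. by move=> L e e0; exists 1 => // *; rewrite subrr normr0. Qed.

Lemma scont_nth i : scont (fun s => s`_i).
Proof. by move=> L e e0; exists e. Qed.

Lemma scontD F G : scont F -> scont G -> scont (fun s => F s + G s).
Proof.
move=> cF cG L e e0; have e2 : 0 < e / 2 by rewrite divr_gt0.
have [d d0 dF] := cF L _ e2; have [d' d'0 dG] := cG L _ e2.
exists (Num.min d d') => [|s s' sL s'L ss]; first by rewrite lt_min d0.
have h1 : `|F s - F s'| < e / 2.
  by apply: dF => // i; have := ss i; rewrite lt_min => /andP[].
have h2 : `|G s - G s'| < e / 2.
  by apply: dG => // i; have := ss i; rewrite lt_min => /andP[].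
rewrite opprD addrACA; apply: le_lt_trans (ler_normD _ _) _; lra.
Qed.

Lemma scontM F G : scont F -> scont G -> scont (fun s => F s * G s).
Proof.
move=> cF cG L e e0.
have [M M0 FM] := scont_bounded L cF; have [N N0 GN] := scont_bounded L cG.
have e1 : 0 < e / 2 / N by rewrite !divr_gt0.
have e2 : 0 < e / 2 / M by rewrite !divr_gt0.
have [d d0 dF] := cF L _ e1; have [d' d'0 dG] := cG L _ e2.
exists (Num.min d d') => [|s s' sL s'L ss]; first by rewrite lt_min d0.
have h1 : `|F s - F s'| < e / 2 / N.
  by apply: dF => // i; have := ss i; rewrite lt_min => /andP[].
have h2 : `|G s - G s'| < e / 2 / M.
  by apply: dG => // i; have := ss i; rewrite lt_min => /andP[].
rewrite (_ : _ - _ = (F s - F s') * G s' + F s * (G s - G s')); last by ring.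
apply: le_lt_trans (ler_normD _ _) _; rewrite !normrM.
have h3 : `|F s - F s'| * `|G s'| <= e / 2.
  rewrite -[X in _ <= X](divfK (_ : N != 0)) ?gt_eqF//.
  by apply: ler_pM => //; [exact: ltW|exact: GN].
have h4 : `|F s| * `|G s - G s'| < e / 2.
  rewrite -[X in _ < X](divfK (_ : M != 0)) ?gt_eqF// mulrC.
  apply: le_lt_trans (_ : `|G s - G s'| * M < _); first by rewrite ler_wpM2l// FM.
  by rewrite ltr_pM2r.
lra.
Qed.

Lemma eq_scont F G : F =1 G -> scont F -> scont G.
Proof. by move=> /funext ->. Qed.

Lemma scontZ c F : scont F -> scont (fun s => c * F s).
Proof. by move=> cF; apply: scontM => //; exact: scont_cst. Qed.

Lemma scontN F : scont F -> scont (fun s => - F s).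
Proof.
by move=> cF; apply: eq_scont (scontZ (-1) cF) => s; rewrite mulN1r.
Qed.

Lemma scontB F G : scont F -> scont G -> scont (fun s => F s - G s).
Proof. by move=> cF cG; apply: scontD => //; exact: scontN. Qed.

Lemma scont_sum (I : Type) (r : seq I) (P : pred I) (F : I -> seq R -> R) :
  (forall i, scont (F i)) -> scont (fun s => \sum_(i <- r | P i) F i s).
Proof.
move=> cF; elim: r => [|i r IH].
  by apply: eq_scont (scont_cst 0) => s; rewrite big_nil.
have [Pi|Pi] := boolP (P i).
  by apply: eq_scont (scontD (cF i) IH) => s; rewrite big_cons Pi.
by apply: eq_scont IH => s; rewrite big_cons (negbTE Pi).
Qed.

Lemma scont_prod (I : Type) (r : seq I) (P : pred I) (F : I -> seq R -> R) :
  (forall i, scont (F i)) -> scont (fun s => \prod_(i <- r | P i) F i s).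
Proof.
move=> cF; elim: r => [|i r IH].
  by apply: eq_scont (scont_cst 1) => s; rewrite big_nil.
have [Pi|Pi] := boolP (P i).
  by apply: eq_scont (scontM (cF i) IH) => s; rewrite big_cons Pi.
by apply: eq_scont IH => s; rewrite big_cons (negbTE Pi).
Qed.

Lemma scont_comp f F : continuous f -> scont F -> scont (fun s => f (F s)).
Proof.
move=> cf cF L e e0; have [M M0 FM] := scont_bounded L cF.
have [d d0 df] := heine M cf e0; have [r r0 rF] := cF L _ d0.
exists r => // s s' sL s'L ss; apply: df; first exact: FM.
exact: rF.
Qed.

Lemma scont_cons h F : scont h -> scont F -> scont (fun s => F (h s :: s)).
Proof.
move=> ch cF L e e0; have [M M0 hM] := scont_bounded L ch.
have [d d0 dF] := cF (Num.max L M) _ e0; have [r r0 rh] := ch L _ d0.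
exists (Num.min d r) => [|s s' sL s'L ss]; first by rewrite lt_min d0.
apply: dF => -[|i]/=.
- by rewrite le_max hM// orbT.
- by rewrite le_max sL.
- by rewrite le_max hM// orbT.
- by rewrite le_max s'L.
- by apply: rh => // i; have := ss i; rewrite lt_min => /andP[].
- by have := ss i; rewrite lt_min => /andP[].
Qed.

(** Reindexing: [p i] says which entry of [s] is the [i]-th entry of [q s], and
    [None] stands for the default value [0]. *)
Lemma scont_map (p : nat -> option nat) F (q : seq R -> seq R) :
  (forall s i, (q s)`_i = oapp (fun j => s`_j) 0 (p i)) ->
  scont F -> scont (fun s => F (q s)).
Proof.
move=> qE cF L e e0; have [d d0 dF] := cF L _ e0; exists d => // s s' sL s'L ss.
by apply: dF => i; rewrite !qE; case: (p i) => [j|]//=;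
  rewrite ?subrr normr0//; exact: le_trans (sL 0%N).
Qed.

Lemma scont_cont1 F s : scont F -> continuous (fun x => F (x :: s)).
Proof.
move=> cF; apply/contP => x e e0.
pose L := `|x| + 1 + \sum_(y <- s) `|y|.
have S0 (u : seq R) : 0 <= \sum_(y <- u) `|y| by apply: sumr_ge0.
have [d d0 dF] := cF L _ e0.
have sL i : `|s`_i| <= \sum_(y <- s) `|y|.
  elim: s {L d dF d0} i => [|y s IH] i; first by rewrite nth_nil normr0 big_nil.
  case: i => [|i]/=; rewrite big_cons ?lerDl//.
  by apply: le_trans (IH i) _; rewrite lerDr.
exists (Num.min 1 d) => [|y]; first by rewrite lt_min ltr01.
rewrite lt_min => /andP[xy1 xyd]; apply: dF => -[|i]//=; rewrite ?subrr ?normr0//.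
- by have := S0 s; have := normr_ge0 x; rewrite /L; lra.
- by rewrite (le_trans (sL i))// /L lerDr addr_ge0.
- have := S0 s; have := ler_normD x (y - x); rewrite addrC subrK distrC /L; lra.
- by rewrite (le_trans (sL i))// /L lerDr addr_ge0.
Qed.

Arguments scont_cont1 [F] s _.

(** The upper end may itself depend on the remaining coordinates, which is what
    integrals over ordered tuples require. *)
Lemma scont_itg a h F : scont h -> scont F ->
  scont (fun s => itg a (h s) (fun x => F (x :: s))).
Proof.
move=> ch cF L e e0; have [M M0 hM] := scont_bounded L ch.
pose L' := Num.max L (Num.max M `|a|).
have [B B0 FB] := scont_bounded L' cF.
pose C := M + `|a| + 1.
have C0 : 0 < C by rewrite /C; have := normr_ge0 a; lra.
have e1 : 0 < e / 2 / C by rewrite !divr_gt0.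
have e2 : 0 < e / 2 / B by rewrite !divr_gt0.
have [d d0 dF] := cF L' _ e1; have [r r0 rh] := ch L _ e2.
exists (Num.min d r) => [|s s' sL s'L ss]; first by rewrite lt_min d0.
have h1 : `|h s - h s'| < e / 2 / B.
  by apply: rh => // i; have := ss i; rewrite lt_min => /andP[].
have cFs u : continuous (fun x => F (x :: u)) by exact: scont_cont1.
have L'x x t : a <= x -> x <= t -> `|t| <= M -> `|x| <= L'.
  rewrite /L' !le_max => ax xt tM; apply/orP; right.
  move: tM; rewrite ler_norml => /andP[_ tM].
  have [x0|x0] := leP 0 x; first by rewrite ger0_norm//; apply/orP; left; lra.
  apply/orP; right; rewrite ltr0_norm// -normrN; apply: le_trans (ler_norm _); lra.
have inL u x : (forall i, `|u`_i| <= L) -> `|x| <= L' ->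
    forall i, `|(x :: u)`_i| <= L'.
  by move=> uL xL [|i]//=; rewrite (le_trans (uL i))// /L' le_max lexx.
rewrite (_ : _ - _ = (itg a (h s) (fun x => F (x :: s)) - itg a (h s) (fun x => F (x :: s')))
  + (itg a (h s) (fun x => F (x :: s')) - itg a (h s') (fun x => F (x :: s'))));
  last by ring.
apply: le_lt_trans (ler_normD _ _) _.
have h2 : `|itg a (h s) (fun x => F (x :: s')) - itg a (h s') (fun x => F (x :: s'))|
    < e / 2.
  apply: le_lt_trans (_ : B * `|h s - h s'| < _).
    apply: itg_end => //; first exact: ltW.
    move=> x /andP[ax]; rewrite le_max => /orP[] xt; apply: FB; apply: inL => //;
      by apply: L'x xt _ => //; exact: hM.
  by rewrite mulrC -ltr_pdivlMr.
suff h3 : `|itg a (h s) (fun x => F (x :: s)) - itg a (h s) (fun x => F (x :: s'))|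
    <= e / 2 by lra.
have [ah|ha] := leP a (h s); last first.
  by rewrite !itg_lt// subrr normr0; lra.
rewrite -itgB//; apply: le_trans (_ : e / 2 / C * (h s - a) <= _).
  apply: itg_bound => //.
    by move=> x; apply: cvgB; exact: cFs.
  move=> x /andP[ax xt]; rewrite ltW//; have xL : `|x| <= L' by apply: L'x ax xt _; exact: hM.
  apply: dF; try exact: inL.
  move=> [|i]/=; first by rewrite subrr normr0.
  by have := ss i; rewrite lt_min => /andP[].
rewrite mulrAC ler_pdivrMr// ler_pM2l; last by lra.
have := hM _ sL; have := ler_norm (h s); have := ler_norm (- a).
by rewrite normrN /C; lra.
Qed.

Lemma scont_lim (Fn : nat -> seq R -> R) F : (forall n, scont (Fn n)) ->
  (forall L e, 0 < e -> exists n, forall s, (forall i, `|s`_i| <= L) ->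
     `|Fn n s - F s| <= e) -> scont F.
Proof.
move=> cFn H L e e0; have e4 : 0 < e / 4 by lra.
have [n nF] := H L _ e4; have [d d0 dF] := cFn n L _ e4; exists d => // s s' sL s'L ss.
have := nF _ sL; have := nF _ s'L; have := dF _ _ sL s'L ss => h1 h2 h3.
rewrite (_ : F s - F s' = (Fn n s - Fn n s') + (Fn n s' - F s') - (Fn n s - F s));
  last by ring.
apply: le_lt_trans (ler_normB _ _) _.
have := ler_normD (Fn n s - Fn n s') (Fn n s' - F s'); lra.
Qed.

Lemma nth_iter_behead k s i : (iter k behead s)`_i = s`_(k + i).
Proof. by elim: k i => //= k IH i; rewrite nth_behead IH addSnnS. Qed.

Lemma scont_pick (l : seq nat) k F : scont F ->
  scont (fun s => F (map (nth 0 s) l ++ iter k behead s)).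
Proof.
apply: (@scont_map (fun i => if (i < size l)%N then Some (nth 0%N l i)
                             else Some (k + (i - size l))%N)) => s i.
rewrite nth_cat size_map; case: ifP => il /=; first by rewrite (nth_map 0%N).
by rewrite nth_iter_behead.
Qed.

Lemma itg_end2 a b b' f B : continuous f -> a <= b -> a <= b' ->
  (forall x, Num.min b b' <= x <= Num.max b b' -> `|f x| <= B) ->
  `|itg a b f - itg a b' f| <= B * `|b - b'|.
Proof.
move=> cf; wlog bb : b b' / b' <= b.
  move=> W ab ab' H; have [h|h] := leP b' b; first exact: W.
  by rewrite distrC (distrC b); apply: W; rewrite 1?minC 1?maxC//; lra.
rewrite (max_idPl bb) (min_idPr bb) => ab ab' H.
rewrite (ger0_norm (_ : 0 <= b - b')) ?subr_ge0//.
by rewrite (itg_chasles cf ab' bb) addrAC subrr add0r; exact: itg_bound.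
Qed.

Lemma is_derive0_cst (H : R -> R) a b : a <= b -> continuous H ->
  (forall x, a < x < b -> is_derive x (1:R) H 0) -> H b = H a.
Proof.
move=> ab cH dH.
have D x : x \in `]a, b[ -> is_derive x (1:R) H ((fun=> 0) x).
  by rewrite in_itv/=; exact: dH.
have [c _ /eqP] := MVT_segment ab D (continuous_subspaceT cH).
by rewrite mul0r subr_eq0 => /eqP.
Qed.

Lemma itg_param_derive c d (q : R -> R -> R) (p : R -> R) t0 :
  (forall t, continuous (q t)) -> continuous p ->
  (forall e, 0 < e -> exists2 r, 0 < r & forall t x, `|t - t0| < r ->
     c <= x <= d -> `|q t x - q t0 x - (t - t0) * p x| <= e * `|t - t0|) ->
  is_derive t0 (1:R) (fun t => itg c d (q t)) (itg c d p).
Proof.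
move=> cq cp H; apply/is_deriveE => e e0.
have [dc|cd] := ltP d c.
  by exists 1 => // t _; rewrite !itg_lt// subrr mul0r subr0 normr0 mulr_ge0// ltW.
have e1 : 0 < e / (d - c + 1) by rewrite divr_gt0//; lra.
have [r r0 rq] := H _ e1; exists r => // t tr.
rewrite mulrC -itgZ// -!itgB//; last 2 first.
- by move=> x; apply: cvgB; exact: cq.
- by move=> x; apply: cvgM; [exact: cvg_cst|exact: cp].
apply: le_trans (_ : e / (d - c + 1) * `|t - t0| * (d - c) <= _).
  apply: itg_bound => //; last by move=> x xcd; exact: rq.
  move=> x; apply: cvgB; first by apply: cvgB; exact: cq.
  by apply: cvgM; [exact: cvg_cst|exact: cp].
rewrite mulrAC ler_wpM2r// mulrAC ler_pdivrMr; last by lra.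
by rewrite ler_wpM2l//; [exact: ltW|lra].
Qed.

(** Leibniz' rule when the integrand and the upper end both depend on [t]. The
    last hypothesis is joint continuity at the corner [(t0, t0)] only. *)
Lemma itg_param_derive_end a (q : R -> R -> R) (p : R -> R) t0 : a < t0 ->
  (forall t, continuous (q t)) -> continuous p ->
  (forall e, 0 < e -> exists2 r, 0 < r & forall t x, `|t - t0| < r ->
     a <= x <= t0 -> `|q t x - q t0 x - (t - t0) * p x| <= e * `|t - t0|) ->
  (forall e, 0 < e -> exists2 r, 0 < r & forall t x, `|t - t0| < r ->
     `|x - t0| < r -> `|q t x - q t0 t0| <= e) ->
  is_derive t0 (1:R) (fun t => itg a t (q t)) (q t0 t0 + itg a t0 p).
Proof.
move=> at0 cq cp Hq Hj; apply/is_deriveE => e e0.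
have e2 : 0 < e / 2 by lra.
have /is_deriveE/(_ _ e2)[r r0 rq] := itg_param_derive cq cp Hq.
have [r' r'0 rj] := Hj _ e2.
exists (Num.min (t0 - a) (Num.min r r')) => [|t].
  by rewrite !lt_min r0 r'0 subr_gt0 at0.
rewrite !lt_min => /and3P[ta tr tr'].
have ta' : a <= t by move: ta; rewrite ltr_norml => /andP[]; lra.
rewrite (_ : _ - _ - _ = (itg a t (q t) - itg a t0 (q t) - q t0 t0 * (t - t0)) +
  (itg a t0 (q t) - itg a t0 (q t0) - itg a t0 p * (t - t0))); last by ring.
apply: le_trans (ler_normD _ _) _; rewrite [e]splitr mulrDl; apply: lerD; last exact: rq.
have cc : continuous (fun x => q t x - q t0 t0).
  by move=> x; apply: cvgB; [exact: cq|exact: cvg_cst].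
have E u : a <= u -> itg a u (q t) = itg a u (fun x => q t x - q t0 t0) + q t0 t0 * (u - a).
  move=> au; rewrite -(itg_cst (q t0 t0) au) -itgD//; last exact: cont_cst.
  by apply: eq_itg => x _; rewrite subrK.
rewrite (E t)// (E t0); last exact: ltW.
rewrite (_ : _ - _ - _ = itg a t (fun x => q t x - q t0 t0) -
    itg a t0 (fun x => q t x - q t0 t0)); last by ring.
apply: itg_end2 => //; first exact: ltW.
move=> x /andP[x1 x2]; apply: rj => //; apply: le_lt_trans tr'.
move: x1 x2; rewrite ge_min le_max => x1 x2.
have := ler_norm (t - t0); have := ler_norm (t0 - t); rewrite distrC ler_norml.
by case/orP : x1; case/orP : x2; lra.
Qed.

Lemma scont_itg_cst a b F : scont F -> scont (fun s => itg a b (fun x => F (x :: s))).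
Proof. by move=> cF; apply: (@scont_itg a (fun=> b)) => //; exact: scont_cst. Qed.

Lemma scont_swap F : scont F ->
  scont (fun s => F [:: s`_1, s`_0 & behead (behead s)]).
Proof. exact: (@scont_pick [:: 1%N; 0%N] 2). Qed.

Lemma seq_bounded s : exists2 M, 0 < M & forall i, `|s`_i| <= M.
Proof.
elim: s => [|x s [M M0 sM]]; first by exists 1 => // i; rewrite nth_nil normr0.
exists (M + `|x|) => [|[|i]/=]; first by rewrite ltr_pwDl.
  by rewrite lerDr ltW.
by rewrite (le_trans (sM i))// lerDl.
Qed.

Lemma norm_le_between a b x : a <= x <= b -> `|x| <= `|a| + `|b|.
Proof.
move=> /andP[ax xb]; have := ler_norm b; have := ler_norm (- a); rewrite normrN.
by have := normr_ge0 a; have := normr_ge0 b; rewrite ler_norml; lra.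
Qed.

Lemma itg_end_unif F s a t0 c d : scont F -> a < t0 -> forall e, 0 < e ->
  exists2 r, 0 < r & forall t y, `|t - t0| < r -> c <= y <= d ->
  `|itg a t (fun x => F [:: x, y & s]) - itg a t0 (fun x => F [:: x, y & s])
    - (t - t0) * F [:: t0, y & s]| <= e * `|t - t0|.
Proof.
move=> cF at0 e e0; have [M M0 sM] := seq_bounded s.
pose L := M + `|a| + `|t0| + 1 + `|c| + `|d|.
have [r r0 rF] := cF L _ e0.
exists (Num.min 1 (Num.min r (t0 - a))) => [|t y].
  by rewrite !lt_min ltr01 r0 subr_gt0.
rewrite !lt_min => /and3P[t1 tr ta] ycd.
have at' : a <= t by move: ta; rewrite ltr_norml => /andP[]; lra.
have cx : continuous (fun x => F [:: x, y & s]) by exact: scont_cont1.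
have cc : continuous (fun x => F [:: x, y & s] - F [:: t0, y & s]).
  by move=> x; apply: cvgB; [exact: cx|exact: cvg_cst].
have E u : a <= u -> itg a u (fun x => F [:: x, y & s]) =
    itg a u (fun x => F [:: x, y & s] - F [:: t0, y & s]) + F [:: t0, y & s] * (u - a).
  move=> au; rewrite -(itg_cst (F [:: t0, y & s]) au) -itgD//; last exact: cont_cst.
  by apply: eq_itg => x _; rewrite subrK.
rewrite (E t)// (E t0); last exact: ltW.
rewrite (_ : _ - _ - _ = itg a t (fun x => F [:: x, y & s] - F [:: t0, y & s]) -
    itg a t0 (fun x => F [:: x, y & s] - F [:: t0, y & s])); last by ring.
have yL : `|y| <= L.
  apply: le_trans (norm_le_between ycd) _.
  by have := normr_ge0 a; have := normr_ge0 t0; rewrite /L; lra.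
have sL i : `|s`_i| <= L.
  apply: le_trans (sM i) _; have := normr_ge0 a; have := normr_ge0 t0.
  by have := normr_ge0 c; have := normr_ge0 d; rewrite /L; lra.
apply: itg_end2 => //; first exact: ltW.
move=> x /andP[x1 x2].
have xt : `|x - t0| <= `|t - t0|.
  move: x1 x2; rewrite ge_min le_max => x1 x2.
  have := ler_norm (t - t0); have := ler_norm (t0 - t); rewrite distrC ler_norml.
  by case/orP : x1; case/orP : x2; lra.
have xL : `|x| <= L.
  have := ler_normD (x - t0) t0; rewrite subrK /L.
  have := normr_ge0 a; have := normr_ge0 c; have := normr_ge0 d; lra.
have t0L : `|t0| <= L.
  rewrite /L; have := normr_ge0 a; have := normr_ge0 c; have := normr_ge0 d; lra.
rewrite ltW//; apply: rF.
- by move=> [|[|i]]/=.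
- by move=> [|[|i]]/=.
- by move=> [|[|i]]/=; rewrite ?subrr ?normr0//; apply: le_lt_trans xt _.
Qed.

Lemma is_derive_sub0 (f g : R -> R) x d : is_derive x (1:R) f d ->
  is_derive x (1:R) g d -> is_derive x (1:R) (fun t => f t - g t) 0.
Proof. by move=> df dg; apply: (is_derive_eq (is_deriveB df dg)); rewrite subrr. Qed.

(** Both sides are [0] for an empty interval and have the same derivative with
    respect to the upper end of the outer interval on the left. *)
Lemma itg_swap a b c d F s : scont F ->
  itg a b (fun x => itg c d (fun y => F [:: x, y & s])) =
  itg c d (fun y => itg a b (fun x => F [:: x, y & s])).
Proof.
move=> cF; have [ba|ab] := ltP b a.
  rewrite itg_lt// (@eq_itg c d _ (fun=> 0 * 0)); last first.
    by move=> x _; rewrite itg_lt// mulr0.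
  by rewrite itgZ ?mul0r//; exact: cont_cst.
have cF' := scont_swap cF.
have cx y : continuous (fun x => F [:: x, y & s]) by exact: scont_cont1.
have cy x : continuous (fun y => F [:: x, y & s]).
  exact: (scont_cont1 (x :: s) cF').
have cix : continuous (fun x => itg c d (fun y => F [:: x, y & s])).
  exact: (scont_cont1 s (scont_itg_cst c d cF')).
have cq t : continuous (fun y => itg a t (fun x => F [:: x, y & s])).
  exact: (scont_cont1 s (scont_itg_cst a t cF)).
have cqt : continuous (fun t => itg c d (fun y => itg a t (fun x => F [:: x, y & s]))).
  have c1 := scont_itg a (scont_nth 1) (scont_pick [:: 0%N; 1%N] 3 cF).
  exact: (scont_cont1 s (scont_itg_cst c d c1)).
apply/eqP; rewrite -subr_eq0; apply/eqP.
pose H t := itg a t (fun x => itg c d (fun y => F [:: x, y & s])) -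
  itg c d (fun y => itg a t (fun x => F [:: x, y & s])).
suff <- : H b = 0 by [].
have -> : 0 = H a.
  rewrite /H itg_aa (@eq_itg c d _ (fun=> 0 * 0)); last first.
    by move=> x _; rewrite itg_aa mulr0.
  by rewrite itgZ ?mul0r ?subrr//; exact: cont_cst.
apply: is_derive0_cst => //.
  by move=> t; apply: cvgB; [exact: itg_cont|exact: cqt].
move=> t /andP[at0 _]; apply: is_derive_sub0; first exact: itg_derive.
by apply: itg_param_derive => //; exact: itg_end_unif.
Qed.

(** The square is the union of the two triangles below and above its diagonal; both
    sides have the same derivative in [t], namely the integrals over two edges. *)
Lemma itg_triangle a t F s : a <= t -> scont F ->
  itg a t (fun x => itg a t (fun y => F [:: x, y & s])) =
  itg a t (fun x => itg a x (fun y => F [:: x, y & s])) +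
  itg a t (fun y => itg a y (fun x => F [:: x, y & s])).
Proof.
move=> at0 cF; have cF' := scont_swap cF.
have cx y : continuous (fun x => F [:: x, y & s]) by exact: scont_cont1.
have cy x : continuous (fun y => F [:: x, y & s]).
  exact: (scont_cont1 (x :: s) cF').
have c1 : continuous (fun x => itg a x (fun y => F [:: x, y & s])).
  exact: (scont_cont1 s (scont_itg a (scont_nth 0) cF')).
have c2 : continuous (fun y => itg a y (fun x => F [:: x, y & s])).
  exact: (scont_cont1 s (scont_itg a (scont_nth 0) cF)).
have sq : scont (fun u => itg a u`_0 (fun y => F [:: u`_1, y & behead (behead u)])).
  have c3 := scont_itg a (scont_nth 0) (scont_pick [:: 2%N; 0%N] 3 cF).
  exact: c3.
have cqt x : continuous (fun t => itg a t (fun y => F [:: x, y & s])).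
  exact: (scont_cont1 (x :: s) sq).
have cq u : continuous (fun x => itg a u (fun y => F [:: x, y & s])).
  exact: (scont_cont1 s (scont_itg_cst a u cF')).
apply/eqP; rewrite -subr_eq0 opprD addrA; apply/eqP.
pose H t := itg a t (fun x => itg a t (fun y => F [:: x, y & s])) -
  itg a t (fun x => itg a x (fun y => F [:: x, y & s])) -
  itg a t (fun y => itg a y (fun x => F [:: x, y & s])).
rewrite -/(H t); have -> : 0 = H a by rewrite /H !itg_aa !subr0.
apply: is_derive0_cst => //.
  move=> u; apply: cvgB; last exact: itg_cont.
  apply: cvgB; last exact: itg_cont.
  have c3 := scont_itg a (scont_nth 0) (scont_pick [:: 1%N; 0%N] 2 sq).
  exact: (scont_cont1 s c3).
move=> u /andP[au _].
rewrite (_ : 0 = (itg a u (fun y => F [:: u, y & s]) + itg a u (fun x => F [:: x, u & s]))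
   - itg a u (fun y => F [:: u, y & s]) - itg a u (fun x => F [:: x, u & s])); last by ring.
apply: is_deriveB; last exact: itg_derive.
apply: is_deriveB; last exact: itg_derive.
apply: (@itg_param_derive_end a (fun t x => itg a t (fun y => F [:: x, y & s]))) => //.
  move=> e e0; have := itg_end_unif s a u cF' au e0.
  exact.
move=> e e0; have [M M0 sM] := seq_bounded s.
have [r r0 rF] := sq (M + `|u| + 1) _ e0.
exists (Num.min 1 r) => [|t' x]; first by rewrite lt_min ltr01.
rewrite !lt_min => /andP[t1 tr] /andP[x1 xr].
have B z : `|z - u| < 1 -> `|z| <= M + `|u| + 1.
  move=> zu; have := ler_normD (z - u) u; rewrite subrK; lra.
have sB i : `|s`_i| <= M + `|u| + 1 by have := sM i; have := normr_ge0 u; lra.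
rewrite ltW//; apply: (rF [:: t', x & s] [:: u, u & s]) => -[|[|i]]//=.
- exact: B.
- exact: B.
- by apply: B; rewrite subrr normr0.
- by apply: B; rewrite subrr normr0.
- by rewrite subrr normr0.
Qed.

End Integral.

(** * Hadamard's inequality *)

Section Hadamard.
Local Open Scope sesquilinear_scope.

(** Gram-Schmidt turns [A] into a triangular matrix with rows of the same norms, and
    the diagonal entries of that matrix are bounded by those norms. *)
Lemma hadamardC (C : numClosedFieldType) n (A : 'M[C]_n) (b : C) :
  (forall i j, `|A i j| ^+ 2 <= b) -> `|\det A| ^+ 2 <= (n%:R * b) ^+ n.
Proof.
move=> Ab; pose S := schmidt A; pose L := A *m S^t*.
have S1 : S *m S^t* = 1%:M by apply/unitarymxP/schmidt_unitarymx.
have S1' : S^t* *m S = 1%:M by exact: mulmx1C.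
have dS : `|\det (S^t*)| = 1.
  have dE : `|\det (S^t*)| = `|\det S|.
    by rewrite -[X in _ = X]norm_conjC -det_map_mx -map_trmx det_tr.
  have : `|\det S * \det (S^t*)| = 1 by rewrite -det_mulmx S1 det1 normr1.
  rewrite normrM -dE => /eqP; rewrite -expr2 sqrp_eq1//.
  by move/eqP.
have LT : is_trig_mx L.
  apply/is_trig_mxP => i j ij.
  have /sub_kermxP H : (row i A <= kermx ((row j S)^t*))%MS.
    apply: submx_trans (row_schmidt_sub A i) _.
    apply/sumsmx_subP => k ki; rewrite genmxE; apply/sub_kermxP.
    apply/matrixP => p q; rewrite !ord1.
    have := congr1 (fun M : 'M[C]_n => M k j) S1; rewrite !mxE.
    have -> : (k == j) = false by apply/negbTE; rewrite -val_eqE/=; move: ki ij => /=; lia.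
    rewrite mulr0n => H0; apply: etrans H0.
    by apply: eq_bigr => l _; rewrite !mxE.
  have := congr1 (fun M : 'M[C]_1 => M 0 0) H; rewrite !mxE => H0; apply: etrans H0.
  by apply: eq_bigr => l _; rewrite !mxE.
have -> : `|\det A| = `|\det L| by rewrite det_mulmx normrM dS mulr1.
rewrite (det_trig LT) normr_prod -prodrXl.
rewrite -[X in _ ^+ X]card_ord -prodr_const.
apply: ler_prod => i _; rewrite exprn_ge0//=.
have -> : n%:R * b = \sum_(j < n) b by rewrite sumr_const card_ord mulr_natl.
apply: le_trans (ler_sum _ (fun j _ => Ab i j)).
have LL : L *m L^t* = A *m A^t*.
  have -> : L^t* = S *m A^t*.
    rewrite /L trmx_mul map_mxM /= -!map_trmx trmxK; congr (_ *m _).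
    by apply/matrixP => p q; rewrite !mxE conjCK.
  by rewrite mulmxA -(mulmxA A) S1' mulmx1.
have E (M : 'M[C]_n) : (M *m M^t*) i i = \sum_j `|M i j| ^+ 2.
  by rewrite mxE; apply: eq_bigr => j _; rewrite !mxE normCK.
by rewrite -E -LL E (bigD1 i)//= lerDl sumr_ge0// => j _; rewrite exprn_ge0.
Qed.

Lemma hadamard (R : rcfType) n (A : 'M[R]_n) (b : R) :
  (forall i j, `|A i j| <= b) -> \det A ^+ 2 <= (n%:R * b ^+ 2) ^+ n.
Proof.
move=> Ab.
have := @hadamardC (R[i])%C n (map_mx (real_complex R) A) (real_complex R (b ^+ 2)).
rewrite det_map_mx normc_def/= expr0n addr0 sqrtr_sqr.
rewrite -!rmorphXn/= real_normK ?num_real// => H.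
rewrite -lecR; apply: le_trans (H _) _ => [i j|].
  rewrite mxE normc_def/= expr0n addr0 sqrtr_sqr -rmorphXn/= lecR.
  by rewrite ler_sqr ?nnegrE// (le_trans _ (Ab i j)).
by rewrite -(rmorph_nat (real_complex R)) -rmorphM -rmorphXn.
Qed.
End Hadamard.

(** * Determinants of a kernel at points *)

Section Mdet.
Variable R : comNzRingType.
Variable k : R -> R -> R.
Implicit Types (r c s : seq R).

Definition Mdet n r c : R := \det (\matrix_(i < n, j < n) k r`_i c`_j).

(** Removing the [j]-th entry; it is the sequence side of deleting a row or column
    in a cofactor expansion. *)
Definition rem_nth j s := take j s ++ drop j.+1 s.

Lemma nth_rem_nth j s i : (rem_nth j s)`_i = s`_(bump j i).
Proof.
rewrite /rem_nth nth_cat /bump nth_drop size_take.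
have [js|js] := ltnP j (size s).
  by case: ltnP => ij; [rewrite nth_take// leqNgt ij|congr nth; lia].
case: ltnP => [is_|si]; last first.
  by rewrite !nth_default//; [exact: leq_trans si (leq_addl _ _)|
    exact: leq_trans (leqW js) (leq_addr _ _)].
rewrite nth_take; last exact: leq_trans js.
by rewrite leqNgt (leq_trans is_ js).
Qed.

(** Bringing a row to the front is a cycle of length [j + 1]. *)
Lemma Mdet_move n s c j : (j <= n)%N ->
  Mdet n.+1 (s`_j :: rem_nth j s) c = (-1) ^+ j * Mdet n.+1 s c.
Proof.
move=> jn; pose j' := Ordinal (jn : (j < n.+1)%N).
rewrite /Mdet (expand_det_row _ ord0) (expand_det_row _ j') big_distrr/=.
apply: eq_bigr => l _; rewrite !mxE/= /cofactor.
have <- : row' ord0 (col' l (\matrix_(i, q) k (s`_j :: rem_nth j s)`_i c`_q)) =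
    row' j' (col' l (\matrix_(i < n.+1, q < n.+1) k s`_i c`_q)).
  by apply/matrixP => p q; rewrite !mxE/= nth_rem_nth.
have S : (-1) ^+ j * (-1) ^+ (j' + l) = (-1) ^+ l :> R.
  by rewrite exprD mulrA -expr2 sqrr_sign mul1r.
by rewrite [in RHS]mulrCA; congr (_ * _); rewrite mulrA S add0n.
Qed.

(** Expansion along the row of [x]; in the cofactor of column [s`_j] the row
    [s`_j] is moved to the front, which absorbs the sign of the cofactor. *)
Lemma Mdet_expand n x y s :
  Mdet n.+1 (x :: s) (y :: s) = k x y * Mdet n s s -
    \sum_(j < n) k x s`_j * Mdet n (s`_j :: rem_nth j s) (y :: rem_nth j s).
Proof.
rewrite {1}/Mdet (expand_det_row _ ord0) big_ord_recl; congr (_ + _).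
  rewrite mxE/= /cofactor expr0 mul1r; congr (_ * \det _).
  by apply/matrixP => p q; rewrite !mxE/=.
rewrite -sumrN; apply: eq_bigr => j _; rewrite mxE/= -mulrN; congr (_ * _).
case: n j => [[]//|n] j.
rewrite Mdet_move//; last by rewrite -ltnS.
rewrite /cofactor add0n /= /bump/= exprS mulN1r mulNr; congr (- (_ * \det _)).
apply/matrixP => p q; rewrite !mxE/=; congr (k _ _).
case: q => [[|q] qn]/=; first by rewrite /bump/=.
have -> : bump (bump 0 j) q.+1 = (bump j q).+1 by rewrite /bump; lia.
by rewrite nth_rem_nth.
Qed.

Lemma Mdet_swap n p x y s : (size p + size s).+2 = n ->
  Mdet n (p ++ [:: x, y & s]) (p ++ [:: x, y & s]) =
  Mdet n (p ++ [:: y, x & s]) (p ++ [:: y, x & s]).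
Proof.
move=> sn; have h1 : (size p < n)%N by lia. have h2 : ((size p).+1 < n)%N by lia.
pose t := tperm (Ordinal h1) (Ordinal h2).
have H (i : 'I_n) : (p ++ [:: x, y & s])`_(t i) = (p ++ [:: y, x & s])`_i.
  rewrite /t; case: tpermP => [->|->|/eqP i1 /eqP i2] /=.
  - by rewrite !nth_cat !ltnn ltnNge leqnSn/= subnn subSnn.
  - by rewrite !nth_cat !ltnn ltnNge leqnSn/= subnn subSnn.
  rewrite !nth_cat; case: ltnP => // pi.
  move: i1 i2; rewrite -!val_eqE/= => i1 i2.
  have -> : (i - size p = (i - size p).-2.+2)%N by lia.
  by [].
rewrite /Mdet.
set A := \matrix_(i, j) k (p ++ [:: x, y & s])`_i _.
have -> : \matrix_(i < n, j < n) k (p ++ [:: y, x & s])`_i (p ++ [:: y, x & s])`_j =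
   row_perm t (col_perm t A).
  by apply/matrixP => i j; rewrite !mxE !H.
rewrite row_permE col_permE !det_mulmx !det_perm.
by rewrite odd_permV mulrCA -expr2 sqrr_sign mulr1.
Qed.

End Mdet.

Arguments scont_cont1 [R F] s _.
(** * Iterated integrals *)

Section Iter.
Variable R : realType.
Variable a : R.
Implicit Types (F G h : seq R -> R) (s u : seq R) (b t x y : R).

Definition iter_int b n F : R := iter_integral `[a, b] n F.

Lemma iter_intS b n F : iter_int b n.+1 F =
  itg a b (fun x => iter_int b n (fun s => F (x :: s))).
Proof. by []. Qed.

Lemma eq_iter_int b n F G :
  (forall s, size s = n -> all (fun x => a <= x <= b) s -> F s = G s) ->
  iter_int b n F = iter_int b n G.
Proof.
elim: n F G => [|n IH] F G FG; first exact: FG.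
rewrite !iter_intS; apply: eq_itg => x xab; apply: IH => s sn sall.
by apply: FG => /=; rewrite ?sn// xab.
Qed.

Lemma scont_behead h : scont h -> scont (fun u => h (behead u)).
Proof. exact: (@scont_pick R [::] 1). Qed.

Lemma scont_iter n F h : scont F -> scont h ->
  scont (fun u => iter_int (h u) n (fun s => F (s ++ u))).
Proof.
elim: n F h => [|n IH] F h cF ch; first exact: cF.
pose F' w := F (w`_n :: take n w ++ drop n.+1 w).
have cF' : scont F'.
  pose p i := if i is i'.+1 then if (i' < n)%N then Some i' else Some i else Some n.
  apply: (@scont_map R p F (fun w => w`_n :: take n w ++ drop n.+1 w)) => // w [|i] //=.
  rewrite -/(rem_nth n w) nth_rem_nth /bump; case: leqP => //=.
have H := scont_itg a ch (IH F' (fun u => h (behead u)) cF' (scont_behead ch)).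
apply: eq_scont H => u; rewrite iter_intS; apply: eq_itg => x _ /=.
apply: eq_iter_int => s sn _; rewrite /F' nth_cat sn ltnn subnn/=.
by rewrite take_size_cat// -cat_rcons drop_size_cat// size_rcons sn.
Qed.

(** The first [m] entries of [u] are kept as parameters of the integrand while the
    end of integration varies with [u]. *)
Lemma scont_iter_param m n F h : scont F -> scont h ->
  scont (fun u => iter_int (h u) n (fun s => F (map (nth 0 u) (iota 0 m) ++ s))).
Proof.
move=> cF ch.
pose F' w := F (map (nth 0 w) (iota n m) ++ take n w).
have cF' : scont F'.
  pose p i := if (i < m)%N then Some (n + i)%N else
    if (i - m < n)%N then Some (i - m)%N else None.
  apply: (@scont_map R p F (fun w => map (nth 0 w) (iota n m) ++ take n w)) => // w i.
  rewrite /p nth_cat size_map size_iota; case: ltnP => im /=.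
    by rewrite (nth_map 0%N) ?size_iota// nth_iota.
  case: ltnP => h'; first by rewrite nth_take.
  rewrite nth_default// size_take; case: ltnP => // h''; exact: leq_trans h'' _.
apply: eq_scont (scont_iter n cF' ch) => u; apply: eq_iter_int => s sn _.
rewrite /F' take_size_cat//; congr (F (_ ++ _)).
rewrite -[X in iota X _]addn0 iotaDl -map_comp; apply: eq_map => i /=.
by rewrite nth_cat sn ltnNge leq_addr/= addKn.
Qed.

Lemma scont_iter1 b n F : scont F ->
  scont (fun u => iter_int b n (fun s => F (u`_0 :: s))).
Proof. by move=> cF; apply: (@scont_iter_param 1 n F (fun=> b)) => //; exact: scont_cst. Qed.

Lemma cont_iter1 b n F : scont F -> continuous (fun x => iter_int b n (fun s => F (x :: s))).
Proof. by move=> cF; exact: (scont_cont1 [::] (scont_iter1 b n cF)). Qed.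

Lemma scont_head x F : scont F -> scont (fun s => F (x :: s)).
Proof. by move=> cF; apply: (@scont_cons R (fun=> x)) => //; exact: scont_cst. Qed.

Lemma iter_intD b n F G : scont F -> scont G ->
  iter_int b n (fun s => F s + G s) = iter_int b n F + iter_int b n G.
Proof.
elim: n F G => [|n IH] F G cF cG //; rewrite !iter_intS -itgD; last 2 first.
- exact: cont_iter1.
- exact: cont_iter1.
by apply: eq_itg => x _; rewrite IH//; exact: scont_head.
Qed.

Lemma iter_intZ b n c F : scont F ->
  iter_int b n (fun s => c * F s) = c * iter_int b n F.
Proof.
elim: n F => [|n IH] F cF //; rewrite !iter_intS -itgZ; last exact: cont_iter1.
by apply: eq_itg => x _; rewrite IH//; exact: scont_head.
Qed.

Lemma iter_int_sum b n m (F : nat -> seq R -> R) : (forall j, scont (F j)) ->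
  iter_int b n (fun s => \sum_(j < m) F j s) = \sum_(j < m) iter_int b n (F j).
Proof.
move=> cF; elim: m => [|m IH].
  rewrite big_ord0 (@eq_iter_int b n _ (fun _ => 0 * 0)).
    by rewrite iter_intZ ?mul0r//; exact: scont_cst.
  by move=> s _ _; rewrite big_ord0 mul0r.
rewrite big_ord_recr/= -IH -iter_intD//; last exact: scont_sum.
by apply: eq_iter_int => s _ _; rewrite big_ord_recr.
Qed.

Lemma iter_int_bound b n F B : scont F -> a <= b ->
  (forall s, size s = n -> all (fun x => a <= x <= b) s -> `|F s| <= B) ->
  `|iter_int b n F| <= B * (b - a) ^+ n.
Proof.
move=> cF ab; elim: n F cF => [|n IH] F cF FB; first by rewrite expr0 mulr1; exact: FB.
rewrite iter_intS exprSr mulrA; apply: itg_bound => //; first exact: cont_iter1.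
move=> x xab; apply: IH; first exact: scont_head.
by move=> s sn sall; apply: FB => /=; rewrite ?sn// xab.
Qed.

(** By induction this is the exchange of two successive integrals. *)
Lemma iter_move b n j F : scont F -> (j < n)%N ->
  iter_int b n (fun s => F (s`_j :: rem_nth j s)) = iter_int b n F.
Proof.
move=> cF; elim: j n F cF => [|j IH] n F cF jn.
  apply: eq_iter_int => s sn _; case: s sn jn => [<-//|x s] _ _ /=.
  by rewrite /rem_nth/= drop0.
case: n jn => [//|n] jn; rewrite iter_intS.
pose Fx x w := F (w`_0 :: x :: behead w).
have cFx x : scont (Fx x).
  exact: (scont_head x (scont_swap cF)).
transitivity (itg a b (fun x => iter_int b n (Fx x))).
  apply: eq_itg => x _; rewrite -(IH n (Fx x))//.
case: n jn => [//|n] jn.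
have c2 := @scont_iter_param 2 n F (fun=> b) cF (scont_cst _).
exact: (esym (itg_swap a b a b [::] c2)).
Qed.

Definition sym_fun n F := forall p x y s, (size p + size s).+2 = n ->
  F (p ++ [:: x, y & s]) = F (p ++ [:: y, x & s]).

(** For a symmetric integrand the cube is the union of the [n + 1] pieces on which a
    given coordinate is the largest, and these contribute equally. *)
Lemma iter_sym n F t : a <= t -> scont F -> sym_fun n.+1 F ->
  iter_int t n.+1 F =
  n.+1%:R * itg a t (fun x => iter_int x n (fun s => F (x :: s))).
Proof.
elim: n F t => [|n IH] F t at0 cF sF; first by rewrite mul1r.
have sFx x : sym_fun n.+1 (fun s => F (x :: s)).
  by move=> p y z s sn; apply: (sF (x :: p)) => /=; rewrite -sn.
have cFx x : scont (fun s => F (x :: s)) by exact: scont_head.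
pose G u := iter_int u`_1 n (fun s => F [:: u`_0, u`_1 & s]).
have cG : scont G by apply: (@scont_iter_param 2 n F (nth 0 ^~ 1%N)) => //; exact: scont_nth.
rewrite iter_intS.
have E1 t' : a <= t' -> itg a t' (fun x => iter_int t' n.+1 (fun s => F (x :: s))) =
  n.+1%:R * itg a t' (fun x => itg a t' (fun y => G [:: x; y])).
  move=> at'; rewrite -itgZ; last first.
    exact: (scont_cont1 [::] (scont_itg_cst a t' (scont_swap cG))).
  by apply: eq_itg => x _; rewrite (IH _ t').
rewrite (E1 t at0); have -> := itg_triangle [::] at0 cG; rewrite mulrDr.
have E2 : n.+1%:R * itg a t (fun x => itg a x (fun y => G [:: x; y])) =
  itg a t (fun x => iter_int x n.+1 (fun s => F (x :: s))).
  rewrite -itgZ; last first.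
    exact: (scont_cont1 [::] (scont_itg a (scont_nth 0) (scont_swap cG))).
  by apply: eq_itg => x /andP[ax _]; rewrite (IH _ x).
rewrite E2; have -> : itg a t (fun y => itg a y (fun x => G [:: x; y])) =
  itg a t (fun x => iter_int x n.+1 (fun s => F (x :: s))).
  apply: eq_itg => y _; rewrite iter_intS; apply: eq_itg => x _.
  by apply: eq_iter_int => s sn _ /=; apply: (sF [::]); rewrite add0n sn.
by rewrite -[n.+2%:R]natr1 mulrDl mul1r addrC.
Qed.

Lemma iter_trunc n F t : a <= t -> scont F ->
  (forall s, size s = n -> all (fun x => x < t) s -> has (fun x => x < a) s -> F s = 0) ->
  iter_integral `]-oo, t[ n F = iter_int t n F.
Proof.
move=> at0; elim: n F => [|n IH] F cF F0 //.
have cg : continuous (fun x => iter_int t n (fun s => F (x :: s))) by exact: cont_iter1.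
have Z m (G : seq R -> R) : (forall s, size s = m -> all (fun x => x < t) s -> G s = 0) ->
    iter_integral `]-oo, t[ m G = 0.
  elim: m G => [|m IHm] G G0; first exact: G0.
  rewrite /= -[RHS](mul0r (fine ((@lebesgue_measure R) `]-oo, t[))) -Rintegral_cst//.
  apply: eq_Rintegral => x; rewrite inE/= in_itv/= => xt.
  by apply: IHm => s sm st; apply: G0 => /=; rewrite ?sm// xt.
transitivity (\int[@lebesgue_measure R]_(x in `[a, t[)
    iter_integral `]-oo, t[ n (fun s => F (x :: s))).
  have -> : `[a, t[%classic = `]-oo, t[ `&` `[a, +oo[%classic :> set R.
    by apply/seteqP; split=> x /=; rewrite !in_itv/= andbT;
      [move=> /andP[-> ->]|move=> [-> ->]].
  rewrite Rintegral_mkcondr; apply: eq_Rintegral => x; rewrite inE/= in_itv/= => xt.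
  rewrite patchE; case: ifPn => //; rewrite notin_setE/= in_itv/= andbT => /negP.
  rewrite -ltNge => xa; apply: Z => s sn st; apply: F0 => /=; rewrite ?sn// ?xt//.
  by rewrite xa.
transitivity (\int[@lebesgue_measure R]_(x in `[a, t[) iter_int t n (fun s => F (x :: s))).
  apply: eq_Rintegral => x; rewrite inE/= in_itv/= => /andP[ax xt].
  rewrite IH//; first exact: scont_head.
  by move=> s sn st sa; apply: F0 => /=; rewrite ?sn// ?xt// sa orbT.
rewrite iter_intS /itg Rintegral_itv_bndo_bndc//.
by apply: integrableS (cont_integrable a t cg) => //; apply: subset_itv_co_cc.
Qed.

End Iter.

(** * Series with a common majorant *)

Section DominatedSeries.
Variable R : realType.
Implicit Types (u v : nat -> R) (C Q e : R).

Definition series_sum u : R := limn (series u).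

(** Hadamard's inequality bounds squares of coefficients; splitting the square root
    of a product leaves one exponential and one geometric term, see [norm_le_sum]. *)
Definition maj C Q (n : nat) : R := C * (Q ^+ n / n`!%:R + 4^-1 ^+ n).

Lemma maj_ge0 C Q n : 0 <= C -> 0 <= Q -> 0 <= maj C Q n.
Proof.
by move=> C0 Q0; rewrite mulr_ge0// addr_ge0// ?divr_ge0 ?exprn_ge0// invr_ge0.
Qed.

Lemma cvg_maj (C Q : R) : cvgn (series (maj C Q)).
Proof.
have q1 : `|4^-1 : R| < 1 by rewrite ger0_norm ?invr_ge0// invf_lt1// ltr1n.
have c2 := @is_cvg_geometric_series R 1 4^-1 q1.
have c1 := @is_cvg_series_exp_coeff R Q.
have -> : maj C Q = C *: (exp_coeff Q + geometric 1 4^-1).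
  apply/funext => n; rewrite /maj; congr (C * (_ + _)).
  by rewrite /geometric /= mul1r.
by apply: is_cvg_seriesZ; exact: is_cvg_seriesD.
Qed.

Definition tail C Q (N : nat) : R := limn (series (maj C Q)) - series (maj C Q) N.

Lemma tail_small C Q e : 0 < e -> exists N0, forall N, (N0 <= N)%N -> `|tail C Q N| <= e.
Proof.
move=> e0; have cm : cvgn (series (maj C Q)) by exact: cvg_maj.
have /cvgrPdist_le/(_ _ e0)[N0 _ H] := cm.
by exists N0 => N h; apply: H.
Qed.

Definition dominated C Q u := forall n, `|u n| <= maj C Q n.

Lemma is_cvg_dominated C Q u : 0 <= C -> 0 <= Q -> dominated C Q u -> cvgn (series u).
Proof.
move=> C0 Q0 du; apply: normed_cvg.
apply: (@series_le_cvg R (fun n => `|u n|) (maj C Q)) => //.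
  by move=> n; exact: maj_ge0.
exact: cvg_maj.
Qed.

Lemma series_sum_tail C Q u N : 0 <= C -> 0 <= Q -> dominated C Q u ->
  `|series_sum u - series u N| <= tail C Q N.
Proof.
move=> C0 Q0 du; have cu := is_cvg_dominated C0 Q0 du.
have c1 : (fun n => `|series u n - series u N|) @ \oo --> `|series_sum u - series u N|.
  by apply: cvg_norm; apply: cvgB => //; exact: cvg_cst.
have c2 : (fun n => series (maj C Q) n - series (maj C Q) N) @ \oo --> tail C Q N.
  by apply: cvgB; [exact: cvg_maj|exact: cvg_cst].
apply: (ler_cvg_to c1 c2); exists N => // n /= Nn.
rewrite !sub_series_geq//; apply: le_trans (ler_norm_sum _ _ _) _.
by apply: ler_sum => k _; exact: du.
Qed.

Lemma series_sum_unique u (l : R) :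
  (forall e, 0 < e -> exists N0, forall N, (N0 <= N)%N -> `|l - series u N| <= e) ->
  series_sum u = l.
Proof.
move=> H; apply: cvg_lim => //; apply/cvgrPdist_le => e e0.
by have [N0 h] := H _ e0; exists N0.
Qed.

Lemma series_sumD u v : cvgn (series u) -> cvgn (series v) ->
  series_sum (fun n => u n + v n) = series_sum u + series_sum v.
Proof. exact: lim_seriesD. Qed.

Lemma series_sumB u v : cvgn (series u) -> cvgn (series v) ->
  series_sum (fun n => u n - v n) = series_sum u - series_sum v.
Proof. exact: lim_seriesB. Qed.

Lemma series_sumZ u (c : R) : cvgn (series u) -> series_sum (fun n => c * u n) = c * series_sum u.
Proof. by move=> cu; exact: (lim_seriesZ c cu). Qed.

Lemma series_shift u n : series u n.+1 = u 0%N + series (fun k => u k.+1) n.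
Proof. by rewrite /series/= !big_mkord big_ord_recl. Qed.

Lemma is_cvg_series_recl u : cvgn (series u) -> cvgn (series (fun k => u k.+1)).
Proof.
move=> /cvg_ex[/= l cl]; apply/cvg_ex; exists (l - u 0%N).
apply/cvgrPdist_le => e e0; have /cvgrPdist_le/(_ _ e0)[N0 _ HN] := cl.
exists N0 => // N /= h; have := HN N.+1 (leqW h); rewrite series_shift.
by rewrite opprD addrA.
Qed.

Lemma series_sum_recl u : cvgn (series (fun k => u k.+1)) ->
  series_sum u = u 0%N + series_sum (fun k => u k.+1).
Proof.
move=> cu; apply: series_sum_unique => e e0.
have /cvgrPdist_le/(_ _ e0)[N0 _ H] := cu.
exists N0.+1 => -[//|N] h; rewrite series_shift opprD addrACA subrr add0r.
exact: H.
Qed.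

Lemma eq_series_sum u v : (forall n, u n = v n) -> series_sum u = series_sum v.
Proof. by move=> /funext ->. Qed.

Lemma itg_series_sum C Q (f : nat -> R -> R) (a b : R) : 0 <= C -> 0 <= Q ->
  (forall n, continuous (f n)) -> continuous (fun x => series_sum (f ^~ x)) ->
  (forall x, a <= x <= b -> dominated C Q (f ^~ x)) ->
  series_sum (fun n => itg a b (f n)) = itg a b (fun x => series_sum (f ^~ x)).
Proof.
move=> C0 Q0 cf cF dF; apply: series_sum_unique => e e0.
have cs N : continuous (fun x => series (f ^~ x) N).
  elim: N => [|N IH]; first by rewrite /series/=; under eq_fun do rewrite big_geq//;
    exact: cont_cst.
  under eq_fun do rewrite seriesSr.
  by move=> x; apply: cvgD; [exact: IH|exact: cf].
have E N : series (fun n => itg a b (f n)) N = itg a b (fun x => series (f ^~ x) N).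
  elim: N => [|N IH].
    rewrite /series/= big_geq// (@eq_itg _ a b _ (fun=> 0 * 0)).
      by rewrite itgZ ?mul0r//; exact: cont_cst.
    by move=> x _; rewrite big_geq// mul0r.
  rewrite seriesSr IH -itgD//; apply: eq_itg => x _.
  by rewrite -seriesSr.
have [ba|ab] := ltP b a.
  by exists 0%N => N _; rewrite E !itg_lt// subrr normr0 ltW.
have e1 : 0 < e / (b - a + 1) by rewrite divr_gt0//; lra.
have [N0 H] := tail_small C Q e1; exists N0 => N h.
rewrite E -itgB//.
apply: (@le_trans _ _ (e / (b - a + 1) * (b - a))).
  apply: itg_bound => //; first by move=> x; apply: cvgB; [exact: cF|exact: cs].
  move=> x xab; apply: le_trans (series_sum_tail N C0 Q0 (dF _ xab)) _.
  exact: le_trans (ler_norm _) (H _ h).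
rewrite mulrAC ler_pdivrMr; last by lra.
by rewrite ler_wpM2l//; [exact: ltW|lra].
Qed.

Lemma scont_series_sum (f : nat -> seq R -> R) :
  (forall n, scont (f n)) ->
  (forall L : R, exists C Q : R, [/\ 0 <= C, 0 <= Q &
    forall s, (forall i, `|s`_i| <= L) -> dominated C Q (f ^~ s)]) ->
  scont (fun s => series_sum (f ^~ s)).
Proof.
move=> cf H; apply: (@scont_lim R (fun N s => series (f ^~ s) N)).
  move=> N; rewrite /series/=; apply: eq_scont (scont_sum (iota 0 N) xpredT cf) => s.
  by rewrite /index_iota subn0.
move=> L e e0; have [C [Q [C0 Q0 dF]]] := H L.
have [N0 HN] := tail_small C Q e0; exists N0 => s sL; rewrite distrC.
apply: le_trans (series_sum_tail N0 C0 Q0 (dF _ sL)) _.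
exact: le_trans (ler_norm _) (HN _ (leqnn _)).
Qed.

End DominatedSeries.

Lemma bin_le_expn n p : ('C(n, p) <= 2 ^ n)%N.
Proof.
have [pn|np] := leqP p n; last by rewrite bin_small.
rewrite -[2%N]/(1 + 1)%N expnDn (bigD1 (Ordinal (pn : (p < n.+1)%N)))//=.
by rewrite !exp1n !muln1 leq_addr.
Qed.

(** A weak form of Stirling's estimate, enough to compare Hadamard's [n ^ (n / 2)]
    with [n!]. *)
Lemma expnn_le n : (n ^ n <= 4 ^ n * n`!)%N.
Proof.
apply: (@leq_trans ((n + n) ^_ n)); last first.
  rewrite -bin_ffact leq_mul2r; apply/orP; right.
  apply: leq_trans (bin_le_expn _ _) _.
  by rewrite addnn -mul2n expnM.
rewrite ffact_prod -[X in (n ^ X <= _)%N]card_ord -prod_nat_const.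
by apply: leq_prod => i _; have := ltn_ord i; lia.
Qed.

(** * Coefficients of Fredholm's series *)

Section FredholmCoef.
Variable R : realType.
Variable K : R -> R.
Hypothesis cK : continuous K.
Variable a : R.
Implicit Types (t x y L C Q g : R) (s u : seq R) (n p : nat).

Let k x y := K (x + y).

Lemma scont_Mdet n (r c : seq R -> seq R) :
  (forall i, scont (fun s => (r s)`_i)) -> (forall i, scont (fun s => (c s)`_i)) ->
  scont (fun s => Mdet k n (r s) (c s)).
Proof.
move=> cr cc; rewrite /Mdet /determinant; apply: scont_sum => /= p.
apply: scontZ; apply: eq_scont (scont_prod (index_enum 'I_n) xpredT
  (F := fun i s => K ((r s)`_i + (c s)`_(p i))) _) => [s|i].
  by apply: eq_bigr => i _; rewrite mxE.
by apply: scont_comp => //; apply: scontD.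
Qed.

Lemma scont_MdetD n : scont (fun s => Mdet k n s s).
Proof. by apply: scont_Mdet => i; exact: scont_nth. Qed.

Lemma scont_consE x i : scont (fun s => (x :: s)`_i).
Proof. by case: i => [|i] /=; [exact: scont_cst|exact: scont_nth]. Qed.

Lemma scont_MdetM n x y : scont (fun s => Mdet k n (x :: s) (y :: s)).
Proof. by apply: scont_Mdet => i; exact: scont_consE. Qed.

(** The coefficients of Fredholm's determinant and first minor of the kernel
    [K (x + y)] on [[a, t]]. *)
Definition det_coef n t : R := n`!%:R^-1 * iter_int a t n (fun s => Mdet k n s s).
Definition minor_coef n t x y : R :=
  n`!%:R^-1 * iter_int a t n (fun s => Mdet k n.+1 (x :: s) (y :: s)).

Lemma scont_det_coef n : scont (fun u => det_coef n u`_0).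
Proof.
apply: scontZ.
exact: (@scont_iter_param R a 0 n _ (nth 0 ^~ 0%N) (scont_MdetD n) (scont_nth 0)).
Qed.

Lemma scont_minor_coef n : scont (fun u => minor_coef n u`_0 u`_1 u`_2).
Proof.
apply: scontZ.
pose F w := Mdet k n.+1 (w`_1 :: behead (behead (behead w)))
                        (w`_2 :: behead (behead (behead w))).
have cF : scont F.
  have E (w : seq R) i : (behead (behead (behead w)))`_i = w`_(3 + i).
    by rewrite !nth_behead.
  apply: scont_Mdet => -[|i] /=; rewrite ?(funext (fun w => E w i)); exact: scont_nth.
exact: (@scont_iter_param R a 3 n F (nth 0 ^~ 0%N) cF (scont_nth 0)).
Qed.

Lemma fact_neq0 n : n`!%:R != 0 :> R.
Proof. by rewrite pnatr_eq0 -lt0n fact_gt0. Qed.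

Lemma det_coef0 t : det_coef 0 t = 1.
Proof. by rewrite /det_coef /iter_int /= /Mdet det_mx00 invr1 mulr1. Qed.

Lemma det_coef_rec n t : n.+1%:R * det_coef n.+1 t = itg a t (fun x => minor_coef n t x x).
Proof.
rewrite /minor_coef itgZ; last first.
  exact: (@cont_iter1 R a t n _ (scont_MdetD n.+1)).
by rewrite /det_coef factS natrM invfM !mulrA mulfV ?pnatr_eq0// mul1r.
Qed.

(** Every term of the expansion of the determinant along its first row has the same
    integral, by [iter_move]. *)
Lemma minor_coef_rec n t x y : minor_coef n t x y = K (x + y) * det_coef n t -
  (if n is n'.+1 then itg a t (fun z => K (x + z) * minor_coef n' t z y) else 0).
Proof.
have c1 : scont (fun s => K (x + y) * Mdet k n s s).
  by apply: scontZ; exact: scont_MdetD.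
have c2 j : scont (fun s => K (x + s`_j) *
    Mdet k n (s`_j :: rem_nth j s) (y :: rem_nth j s)).
  apply: scontM.
    by apply: scont_comp => //; apply: scontD; [exact: scont_cst|exact: scont_nth].
  have c3 i : scont (fun s => (rem_nth j s)`_i).
    by apply: eq_scont (scont_nth (bump j i)) => s; rewrite nth_rem_nth.
  apply: scont_Mdet => -[|i] //=; [exact: scont_nth|exact: scont_cst].
have -> : minor_coef n t x y = n`!%:R^-1 * (K (x + y) * iter_int a t n (fun s => Mdet k n s s)
  - \sum_(j < n) iter_int a t n (fun s => K (x + s`_j) *
    Mdet k n (s`_j :: rem_nth j s) (y :: rem_nth j s))).
  rewrite /minor_coef; congr (_ * _).
  have cs := scont_sum (index_enum 'I_n) xpredT (fun j : 'I_n => c2 j).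
  rewrite -iter_intZ; last exact: scont_MdetD.
  rewrite -(iter_int_sum a t n n c2) -mulN1r -iter_intZ// -iter_intD//; last exact: scontZ.
  by apply: eq_iter_int => s _ _; rewrite mulN1r Mdet_expand.
rewrite mulrBr /det_coef mulrCA; congr (_ - _).
case: n c1 c2 => [|n] c1 c2; first by rewrite big_ord0 mulr0.
have E (j : 'I_n.+1) : iter_int a t n.+1 (fun s => K (x + s`_j) *
    Mdet k n.+1 (s`_j :: rem_nth j s) (y :: rem_nth j s)) =
    n`!%:R * itg a t (fun z => K (x + z) * minor_coef n t z y).
  pose F s := K (x + s`_0) * Mdet k n.+1 s (y :: behead s).
  have cF : scont F.
    apply: eq_scont (c2 0%N) => -[|w s] //; rewrite /F /rem_nth/=.
    - rewrite /Mdet; congr (_ * \det _); apply/matrixP => p q; rewrite !mxE.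
      by case: p => [[|p] ip] /=; rewrite ?nth_nil.
    - by rewrite drop0.
  have -> := @iter_move R a t n.+1 j F cF (ltn_ord j).
  rewrite iter_intS -itgZ; last first.
    have c3 := scont_minor_coef n.
    apply: (scont_cont1 [:: t; y] (F := fun s => K (x + s`_0) * minor_coef n s`_1 s`_0 s`_2)).
    apply: scontM; last exact: (scont_pick [:: 1%N; 0%N; 2] 3 c3).
    by apply: scont_comp => //; apply: scontD; [exact: scont_cst|exact: scont_nth].
  apply: eq_itg => z _; rewrite /F/= mulrCA /minor_coef mulVKf ?fact_neq0//.
  by rewrite -iter_intZ; last exact: scont_MdetM.
rewrite (eq_bigr _ (fun j _ => E j)) sumr_const card_ord factS natrM invfM.
rewrite -[X in _ * X = _]mulr_natl mulrACA mulVf ?pnatr_eq0// mul1r.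
by rewrite mulKf// fact_neq0.
Qed.

(** The integrand is symmetric in all coordinates, so its iterated integral may be
    ordered by the largest coordinate: it is [n + 1] times the integral over the
    position [x] of that coordinate of the minor on [[a, x]]. *)
Lemma det_coef_end n t : a <= t -> det_coef n.+1 t = itg a t (fun x => minor_coef n x x x).
Proof.
move=> at0; rewrite /det_coef iter_sym//; last 2 first.
- exact: scont_MdetD.
- by move=> p x y s sn; apply: Mdet_swap.
rewrite /minor_coef itgZ; last first.
  pose F s := Mdet k n.+1 s s.
  exact: (scont_cont1 [::] (@scont_iter_param R a 1 n F (nth 0 ^~ 0%N) (scont_MdetD n.+1) (scont_nth 0))).
by rewrite factS natrM invfM [n.+1%:R^-1 * _]mulrC -mulrA mulKf ?pnatr_eq0.
Qed.

Lemma Mdet_sqr_le n (r c : seq R) L kap : 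
  (forall z, `|z| <= 2 * L -> `|K z| <= kap) ->
  (forall i, `|r`_i| <= L) -> (forall i, `|c`_i| <= L) ->
  Mdet k n r c ^+ 2 <= (n%:R * kap ^+ 2) ^+ n.
Proof.
move=> Kk rL cL; apply: hadamard => i j; rewrite mxE; apply: Kk.
by apply: le_trans (ler_normD _ _) _; rewrite mulr2n mulrDl mul1r lerD.
Qed.

Lemma iter_int_bound_len b l n (F : seq R -> R) (B : R) : scont F -> 0 <= B -> 0 <= l ->
  b - a <= l -> (forall s, size s = n -> all (fun x => a <= x <= b) s -> `|F s| <= B) ->
  `|iter_int a b n F| <= B * l ^+ n.
Proof.
move=> cF B0 l0 bl FB; have [ab|ba] := leP a b.
  apply: le_trans (iter_int_bound cF ab FB) _.
  by rewrite ler_wpM2l// lerXn2r// nnegrE; lra.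
case: n FB => [|n] FB; first by rewrite expr0 mulr1; exact: FB.
by rewrite iter_intS itg_lt// normr0 mulr_ge0// exprn_ge0.
Qed.

(** Arithmetic-geometric mean, used to split a square root of a product. *)
Lemma norm_le_sum (v c X Y : R) : 0 <= c -> 0 <= X -> 0 <= Y ->
  v ^+ 2 <= c ^+ 2 * (X * Y) -> `|v| <= c * (X + Y).
Proof.
move=> c0 X0 Y0 h; rewrite -ler_sqr ?nnegrE ?mulr_ge0 ?addr_ge0//.
rewrite real_normK ?num_real//; apply: le_trans h _; rewrite exprMn.
rewrite ler_wpM2l ?exprn_ge0//; have := mulr_ge0 X0 Y0; have := sqr_ge0 X.
by have := sqr_ge0 Y; rewrite !expr2; lra.
Qed.

(** Hadamard gives [q ^ n * n ^ (n / 2) / n!] for some [q], and [n ^ n / n!] is at most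
    [4 ^ n]; the constant [16] leaves room for the weights [2 * 2 ^+ n] of
    [geom_weight]. *)
Lemma coef_dominated L : exists C Q, [/\ 0 <= C, 0 <= Q & forall t x y,
  `|t| <= L -> `|x| <= L -> `|y| <= L -> forall n,
  `|det_coef n t| <= C * (Q ^+ n / n`!%:R + 16^-1 ^+ n) /\
  `|minor_coef n t x y| <= C * (Q ^+ n / n`!%:R + 16^-1 ^+ n)].
Proof.
pose L' := Num.max `|L| `|a|.
have L'0 : 0 <= L' by rewrite /L' le_max normr_ge0.
have [kap kap0 Kk] := cont_bounded (2 * L') cK.
pose l := 2 * L'; have l0 : 0 <= l by rewrite mulr_ge0.
pose q := 8 * kap ^+ 2 * l ^+ 2.
have q0 : 0 <= q by rewrite !mulr_ge0 ?exprn_ge0// ltW.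
exists (2 * kap + 1), (16 * q); split; [by rewrite addr_ge0// mulr_ge0// ltW|
  by rewrite mulr_ge0|].
move=> t x y tL xL yL n.
have LL' (z : R) : `|z| <= L -> `|z| <= L'.
  by move=> h; rewrite /L' le_max (le_trans h)// ler_norm.
have tal : t - a <= l.
  have := LL' _ tL; have : `|a| <= L' by rewrite /L' le_max lexx orbT.
  by have := ler_norm t; have := ler_norm (- a); rewrite normrN /l; lra.
clearbody l.
have sL s : all (fun x => a <= x <= t) s -> forall i, `|s`_i| <= L'.
  move=> sall i; have [h|h] := ltnP i (size s); last first.
    by rewrite nth_default// normr0.
  have /andP[h1 h2] := all_nthP 0 sall i h.
  have tL' := LL' _ tL; have aL' : `|a| <= L' by rewrite /L' le_max lexx orbT.
  by rewrite ler_norml; have := ler_norm t; have := ler_norm (- a); rewrite normrN; lra.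
have X0 : 0 <= (16 * q) ^+ n / n`!%:R by rewrite divr_ge0// exprn_ge0// mulr_ge0.
have Y0 : 0 <= (16^-1 : R) ^+ n by rewrite exprn_ge0// invr_ge0.
have c0 : 0 <= 2 * kap + 1 by rewrite addr_ge0// mulr_ge0// ltW.
have XY : (16 * q) ^+ n / n`!%:R * 16^-1 ^+ n = q ^+ n / n`!%:R.
  by rewrite mulrAC -exprMn [16 * q]mulrC mulfK.
have f0 : 0 < n`!%:R :> R by rewrite ltr0n fact_gt0.
have nn m : (m%:R : R) ^+ m <= 4 ^+ m * m`!%:R.
  by rewrite -!natrX -natrM ler_nat expnn_le.
have key m (F : seq R -> R) (c : R) : scont F -> 0 <= c ->
    (forall s, size s = n -> all (fun x => a <= x <= t) s ->
      F s ^+ 2 <= (m%:R * kap ^+ 2) ^+ m) ->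
    (m%:R * kap ^+ 2) ^+ m * l ^+ n ^+ 2 / n`!%:R ^+ 2 <= (2 * kap + 1) ^+ 2 * (q ^+ n / n`!%:R) ->
    `|n`!%:R^-1 * iter_int a t n F| <= (2 * kap + 1) * ((16 * q) ^+ n / n`!%:R + 16^-1 ^+ n).
  move=> cF _ FB h; apply: norm_le_sum => //; rewrite XY; apply: le_trans h.
  have B0 : 0 <= (m%:R * kap ^+ 2) ^+ m by rewrite exprn_ge0// mulr_ge0// exprn_ge0// ltW.
  rewrite exprMn mulrC exprVn ler_wpM2r ?invr_ge0 ?exprn_ge0//.
  rewrite -(sqr_sqrtr B0) -exprMn -[X in X <= _]real_normK ?num_real//.
  rewrite lerXn2r ?nnegrE//; first by rewrite mulr_ge0 ?exprn_ge0// sqrtr_ge0.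
  apply: iter_int_bound_len => //.
  move=> s sn sall; rewrite -sqrtr_sqr ler_wsqrtr//; exact: FB.
split.
  apply: (key n _ 0) => //; first exact: scont_MdetD.
    by move=> s sn sall; apply: (@Mdet_sqr_le n s s L'); [exact: Kk|exact: sL..].
  have -> : (n%:R * kap ^+ 2) ^+ n * l ^+ n ^+ 2 / n`!%:R ^+ 2 =
    (n%:R ^+ n / n`!%:R) * ((kap ^+ 2 * l ^+ 2) ^+ n / n`!%:R).
    rewrite (exprMn n n%:R (kap ^+ 2)) (exprMn n (kap ^+ 2) (l ^+ 2)) [l ^+ n ^+ 2]exprAC.
    move: (kap ^+ 2 ^+ n) (l ^+ 2 ^+ n) (n%:R ^+ n) => w1 w2 w3.
    by field; rewrite gt_eqF.
  have h1 : n%:R ^+ n / n`!%:R <= (4 : R) ^+ n by rewrite ler_pdivrMr.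
  have kl : 0 <= kap ^+ 2 * l ^+ 2 by rewrite mulr_ge0 ?exprn_ge0// ltW.
  apply: (@le_trans _ _ (4 ^+ n * ((kap ^+ 2 * l ^+ 2) ^+ n / n`!%:R))).
    by rewrite ler_wpM2r// divr_ge0// exprn_ge0.
  rewrite mulrA -(exprMn n 4) [X in _ <= X]mulrA ler_wpM2r ?invr_ge0 ?(ltW f0)//.
  rewrite -[X in X <= _]mul1r; apply: ler_pM; rewrite ?exprn_ge0 ?mulr_ge0 ?(ltW kap0)//.
    by rewrite exprn_ege1// lerDr mulr_ge0// ltW.
  have hq : 4 * (kap ^+ 2 * l ^+ 2) <= q by rewrite /q; lra.
  by apply: lerXn2r => //; rewrite nnegrE mulr_ge0.
apply: (key n.+1 _ 0) => //; first exact: scont_MdetM.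
  move=> s sn sall; apply: (@Mdet_sqr_le n.+1 (x :: s) (y :: s) L') => //.
    by move=> [|i] /=; [exact: LL'|exact: sL].
  by move=> [|i] /=; [exact: LL'|exact: sL].
have h1 : n.+1%:R ^+ n.+1 / n`!%:R <= 4 * (8 : R) ^+ n.
  rewrite ler_pdivrMr//; apply: le_trans (nn n.+1) _.
  rewrite exprS -[X in _ <= X]mulrA -[X in X <= _]mulrA ler_wpM2l//.
  rewrite factS natrM mulrA ler_wpM2r//.
  rewrite (_ : 8 = 4 * 2); last by ring.
  by rewrite exprMn ler_wpM2l ?exprn_ge0// -natrX ler_nat ltn_expl.
have -> : (n.+1%:R * kap ^+ 2) ^+ n.+1 * l ^+ n ^+ 2 / n`!%:R ^+ 2 =
    (n.+1%:R ^+ n.+1 / n`!%:R) * (kap ^+ 2 * ((kap ^+ 2 * l ^+ 2) ^+ n / n`!%:R)).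
  rewrite (exprMn n.+1 n.+1%:R (kap ^+ 2)) (exprMn n (kap ^+ 2) (l ^+ 2)) [l ^+ n ^+ 2]exprAC [kap ^+ 2 ^+ n.+1]exprS.
  move: (kap ^+ 2 ^+ n) (l ^+ 2 ^+ n) (n.+1%:R ^+ n.+1) => w1 w2 w3.
  by field; rewrite gt_eqF.
have kl : 0 <= kap ^+ 2 * l ^+ 2 by rewrite mulr_ge0 ?exprn_ge0// ltW.
have k2 : 0 <= kap ^+ 2 by rewrite exprn_ge0// ltW.
apply: (@le_trans _ _ (4 * 8 ^+ n * (kap ^+ 2 * ((kap ^+ 2 * l ^+ 2) ^+ n / n`!%:R)))).
  by rewrite ler_wpM2r// mulr_ge0// divr_ge0 ?exprn_ge0// ltW.
have -> : 4 * 8 ^+ n * (kap ^+ 2 * ((kap ^+ 2 * l ^+ 2) ^+ n / n`!%:R)) =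
    (4 * kap ^+ 2) * (q ^+ n / n`!%:R).
  rewrite /q -[8 * _ * _]mulrA (exprMn n 8).
  by move: (8 ^+ n) ((kap ^+ 2 * l ^+ 2) ^+ n) => w1 w2; ring.
rewrite ler_wpM2r//; first by rewrite divr_ge0 ?exprn_ge0// ltW.
by rewrite expr2 [X in _ <= X]expr2; nra.
Qed.

End FredholmCoef.

Lemma sum_bin_le n m : (\sum_(p < m) 'C(n, p) <= 2 ^ n)%N.
Proof.
elim: n m => [|n IH] [|m]; rewrite ?big_ord0// big_ord_recl.
  by rewrite bin0 big1// => i _.
rewrite (eq_bigr (fun i : 'I_m => 'C(n, i.+1) + 'C(n, i))%N) => [|i _]; last by rewrite -binS.
rewrite big_split/= addnA expnS mul2n -addnn; apply: leq_add; last exact: IH.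
by apply: leq_trans (IH m.+1); rewrite big_ord_recl !bin0.
Qed.

(** * Fredholm determinant, minor and resolvent *)

Section Fredholm.
Variable R : realType.
Variable K : R -> R.
Hypothesis cK : continuous K.
Variable a : R.
Implicit Types (t x y L C Q g : R) (s u : seq R) (n p : nat) (w : nat -> R).

(** Fredholm's series with arbitrary weights in place of the powers of the
    parameter, so that the Taylor coefficients in the parameter are covered too. *)
Definition fdetw w t : R := series_sum (fun n => w n * det_coef K a n t).
Definition fminorw w t x y : R := series_sum (fun n => w n * minor_coef K a n t x y).

Definition geom_weight w := forall n, `|w n| <= 2 * 2 ^+ n.

Lemma coef_weighted L : exists C Q, [/\ 0 <= C, 0 <= Q & forall w t x y,
  geom_weight w -> `|t| <= L -> `|x| <= L -> `|y| <= L ->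
  dominated C Q (fun n => w n * det_coef K a n t) /\
  dominated C Q (fun n => w n * minor_coef K a n t x y)].
Proof.
have [C [Q [C0 Q0 H]]] := coef_dominated cK a L.
exists (2 * C), (2 * Q); split; rewrite ?mulr_ge0// => w t x y ww tL xL yL.
have key v n : `|v| <= C * (Q ^+ n / n`!%:R + 16^-1 ^+ n) ->
    `|w n * v| <= maj (2 * C) (2 * Q) n.
  move=> h; rewrite normrM /maj.
  apply: (@le_trans _ _ (2 * 2 ^+ n * (C * (Q ^+ n / n`!%:R + 16^-1 ^+ n)))).
    exact: ler_pM.
  rewrite mulrACA ler_wpM2l ?mulr_ge0// mulrDr exprMn mulrA lerD2l -exprMn.
  by apply: lerXn2r; rewrite ?nnegrE; lra.
by split=> n; apply: key; have [] := H t x y tL xL yL n.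
Qed.

Lemma cvg_det_coef w t : geom_weight w -> cvgn (series (fun n => w n * det_coef K a n t)).
Proof.
move=> ww; have [C [Q [C0 Q0 H]]] := coef_weighted `|t|.
have [h1 _] := H w t t t ww (lexx _) (lexx _) (lexx _).
exact: is_cvg_dominated C0 Q0 h1.
Qed.

Lemma cvg_minor_coef w t x y : geom_weight w -> cvgn (series (fun n => w n * minor_coef K a n t x y)).
Proof.
move=> ww; have [C [Q [C0 Q0 H]]] := coef_weighted (`|t| + `|x| + `|y|).
have [|||_ h] := H w t x y ww.
- by rewrite -addrA lerDl addr_ge0.
- by rewrite addrAC lerDr addr_ge0.
- by rewrite lerDr addr_ge0.
exact: is_cvg_dominated C0 Q0 h.
Qed.

Lemma scont_fdetw w : geom_weight w -> scont (fun u => fdetw w u`_0).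
Proof.
move=> ww; apply: (@scont_series_sum R (fun n u => w n * det_coef K a n u`_0)).
  by move=> n; apply: scontZ; exact: scont_det_coef.
move=> L; have [C [Q [C0 Q0 H]]] := coef_weighted L.
by exists C, Q; split=> // u uL; exact: (H w u`_0 u`_0 u`_0 ww _ _ _).1.
Qed.

Lemma scont_fminorw w : geom_weight w -> scont (fun u => fminorw w u`_0 u`_1 u`_2).
Proof.
move=> ww; apply: (@scont_series_sum R (fun n u => w n * minor_coef K a n u`_0 u`_1 u`_2)).
  by move=> n; apply: scontZ; exact: scont_minor_coef.
move=> L; have [C [Q [C0 Q0 H]]] := coef_weighted L.
by exists C, Q; split=> // u uL; exact: (H w u`_0 u`_1 u`_2 ww _ _ _).2.
Qed.

(** Shifting the weights is what multiplication by the kernel does to the minor. *)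
Definition wshift w n := w n.+1.

(** Fredholm's first equation, summed from [minor_coef_rec]. *)
Lemma fminorw_eq w t x y : geom_weight w -> geom_weight (wshift w) ->
  fminorw w t x y + itg a t (fun z => K (x + z) * fminorw (wshift w) t z y) =
  K (x + y) * fdetw w t.
Proof.
move=> ww ww'.
pose v n := if n is n'.+1 then
  w n'.+1 * itg a t (fun z => K (x + z) * minor_coef K a n' t z y) else 0.
have cKx : continuous (fun z => K (x + z)).
  move=> z; apply: (continuous_comp (f := fun z => x + z) (g := K)); last exact: cK.
  by apply: cvgD; [exact: cvg_cst|exact: cvg_id].
have cm n : continuous (fun z => minor_coef K a n t z y).
  exact: (scont_cont1 [:: t; y] (scont_pick [:: 1%N; 0%N; 2%N] 3 (scont_minor_coef cK a n))).
have cM : continuous (fun z => fminorw (wshift w) t z y).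
  exact: (scont_cont1 [:: t; y] (scont_pick [:: 1%N; 0%N; 2%N] 3 (scont_fminorw ww'))).
have E n : w n * minor_coef K a n t x y = K (x + y) * (w n * det_coef K a n t) - v n.
  rewrite minor_coef_rec// mulrBr mulrCA; congr (_ - _).
  by case: n => [|n]; rewrite ?mulr0.
pose L := `|a| + `|t| + `|y|.
have [C [Q [C0 Q0 H]]] := coef_weighted L.
have [B B0 KB] := cont_bounded (`|a| + `|t|) cKx.
have dv x' : a <= x' <= t -> dominated (B * C) Q (fun n => wshift w n * (K (x + x') * minor_coef K a n t x' y)).
  move=> h n; have xat := norm_le_between h.
  rewrite mulrCA normrM /maj -mulrA ler_pM//; first exact: KB.
  apply: (H (wshift w) t x' y ww' _ _ _).2; rewrite /L.
  - by have := normr_ge0 a; have := normr_ge0 y; lra.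
  - by have := normr_ge0 y; lra.
  - by have := normr_ge0 a; have := normr_ge0 t; lra.
have cMs x' : cvgn (series (fun n => wshift w n * minor_coef K a n t x' y)) by exact: cvg_minor_coef.
have Sv : itg a t (fun z => K (x + z) * fminorw (wshift w) t z y) =
    series_sum (fun n => v n.+1) /\ cvgn (series (fun n => v n.+1)).
  have E2 : (fun z => K (x + z) * fminorw (wshift w) t z y) =
      (fun z => series_sum (fun n => wshift w n * (K (x + z) * minor_coef K a n t z y))).
    apply/funext => z; rewrite /fminorw -series_sumZ//; apply: eq_series_sum => n.
    by rewrite mulrCA.
  have E3 n : v n.+1 = itg a t (fun z => wshift w n * (K (x + z) * minor_coef K a n t z y)).
    rewrite itgZ// => z; apply: cvgM; [exact: cKx|exact: cm].
  have BC : 0 <= B * C by rewrite mulr_ge0// ltW.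
  split.
    rewrite E2 -(@itg_series_sum R (B * C) Q)//.
    - by apply: eq_series_sum => n; rewrite E3.
    - move=> n z; apply: cvgM; first exact: cvg_cst.
      by apply: cvgM; [exact: cKx|exact: cm].
    - by rewrite -E2 => z; apply: cvgM; [exact: cKx|exact: cM].
  have [at0|ta] := leP a t; last first.
    rewrite (_ : (fun n => v n.+1) = fun=> 0).
      apply: (@is_cvg_dominated R 0 0) => // n; rewrite normr0 /maj mul0r//.
    by apply/funext => n; rewrite E3 itg_lt.
  apply: (@is_cvg_dominated R (B * C * (t - a)) Q) => //.
    by rewrite mulr_ge0// subr_ge0.
  move=> n; rewrite E3 /maj mulrAC; apply: itg_bound => //; last by move=> z zat; exact: dv.
  move=> z; apply: cvgM; first exact: cvg_cst.
  by apply: cvgM; [exact: cKx|exact: cm].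
have [-> cv] := Sv.
rewrite /fminorw (eq_series_sum E).
have cvv : cvgn (series v).
  have /cvg_ex[/= l cl] := cv; apply/cvg_ex; exists l.
  apply/cvgrPdist_le => e e0; have /cvgrPdist_le/(_ _ e0)[N0 _ HN] := cl.
  exists N0.+1 => // -[//|N] /= h; rewrite series_shift /= add0r; exact: HN.
rewrite series_sumB//; last by apply: is_cvg_seriesZ; exact: cvg_det_coef.
rewrite series_sumZ; last exact: cvg_det_coef.
by rewrite (series_sum_recl cv) /= add0r /fdetw subrK.
Qed.

(** The trace of the minor is the derivative of the determinant with respect to the
    parameter. *)
Lemma itg_fminorw_diag w t : geom_weight w ->
  itg a t (fun x => fminorw w t x x) =
  series_sum (fun n => w n * (n.+1%:R * det_coef K a n.+1 t)).
Proof.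
move=> ww; have [C [Q [C0 Q0 H]]] := coef_weighted (`|a| + `|t|).
have cm n : continuous (fun x => minor_coef K a n t x x).
  exact: (scont_cont1 [:: t] (scont_pick [:: 1%N; 0%N; 0%N] 2 (scont_minor_coef cK a n))).
rewrite -(@itg_series_sum R C Q)//.
- by apply: eq_series_sum => n; rewrite itgZ// det_coef_rec.
- by move=> n x; apply: cvgM; [exact: cvg_cst|exact: cm].
- exact: (scont_cont1 [:: t] (scont_pick [:: 1%N; 0%N; 0%N] 2 (scont_fminorw ww))).
move=> x xat; apply: (H w t x x ww _ _ _).2; rewrite ?(norm_le_between xat)//.
by rewrite lerDr.
Qed.

Lemma geom_weight_exp g : `|g| = 1 -> geom_weight (fun n => g ^+ n).
Proof.
move=> g1 n; rewrite normrX g1 expr1n.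
by have := @exprn_ege1 R n 2 (ler1n R 2); lra.
Qed.

Definition fdet g t := fdetw (fun n => g ^+ n) t.
Definition fminor g t x y := fminorw (fun n => g ^+ n) t x y.

Lemma scont_fdet g : `|g| = 1 -> scont (fun u => fdet g u`_0).
Proof. by move=> g1; apply: scont_fdetw; exact: geom_weight_exp. Qed.

Lemma scont_fminor g : `|g| = 1 -> scont (fun u => fminor g u`_0 u`_1 u`_2).
Proof. by move=> g1; apply: scont_fminorw; exact: geom_weight_exp. Qed.

Lemma fminorwZ c w t x y : geom_weight w ->
  fminorw (fun n => c * w n) t x y = c * fminorw w t x y.
Proof.
by move=> ww; rewrite /fminorw -series_sumZ; [apply: eq_series_sum => n; rewrite mulrA|exact: cvg_minor_coef].
Qed.

Lemma fminorwD w1 w2 t x y : geom_weight w1 -> geom_weight w2 ->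
  fminorw (fun n => w1 n + w2 n) t x y = fminorw w1 t x y + fminorw w2 t x y.
Proof.
move=> h1 h2; rewrite /fminorw -series_sumD; [|exact: cvg_minor_coef..].
by apply: eq_series_sum => n; rewrite mulrDl.
Qed.

Lemma cont_shift x : continuous (fun z => K (x + z)).
Proof.
move=> z; apply: (continuous_comp (f := fun z => x + z) (g := K)); last exact: cK.
by apply: cvgD; [exact: cvg_cst|exact: cvg_id].
Qed.

Lemma cont_mulK x (f : R -> R) : continuous f -> continuous (fun z => K (x + z) * f z).
Proof. by move=> cf z; apply: cvgM; [exact: cont_shift|exact: cf]. Qed.

Lemma cont_fminorw w t y : geom_weight w -> continuous (fun x => fminorw w t x y).
Proof.
move=> ww.
exact: (scont_cont1 [:: t; y] (scont_pick [:: 1%N; 0%N; 2%N] 3 (scont_fminorw ww))).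
Qed.

Lemma geom_weight_shift_exp g : `|g| = 1 -> geom_weight (wshift (fun n => g ^+ n)).
Proof.
move=> g1 n; rewrite /wshift normrX g1 expr1n.
by have := @exprn_ege1 R n 2 (ler1n R 2); lra.
Qed.

Lemma fminor_eq g t x y : `|g| = 1 ->
  fminor g t x y + g * itg a t (fun z => K (x + z) * fminor g t z y) =
  K (x + y) * fdet g t.
Proof.
move=> g1; have gw := geom_weight_exp g1.
rewrite -itgZ; last by apply: cont_mulK; exact: cont_fminorw.
rewrite -fminorw_eq//; last exact: geom_weight_shift_exp.
congr (_ + _); apply: eq_itg => z _; rewrite mulrCA; congr (_ * _).
by rewrite -fminorwZ//; apply: eq_series_sum => n; rewrite /wshift exprS.
Qed.

(** Injectivity of [1 + g K] on continuous functions on the line; a solution of the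
    homogeneous equation is determined by its restriction to [[a, t]]. *)
Definition inj_at g t := forall f : R -> R, continuous f ->
  (forall x, f x + g * itg a t (fun z => K (x + z) * f z) = 0) -> forall x, f x = 0.

(** The weights of the [p]-th derivative with respect to the parameter, divided by
    [p!], at the parameter [g]. *)
Definition taylor_weight g p n := 'C(n, p)%:R * g ^+ (n - p).

Lemma taylor_weight_le g p n : `|g| = 1 -> `|taylor_weight g p n| <= 2 ^+ n.
Proof.
move=> g1; rewrite normrM normrX g1 expr1n mulr1 ger0_norm// -natrX ler_nat.
exact: bin_le_expn.
Qed.

Lemma taylor_weightS g p n : taylor_weight g p.+1 n.+1 = g * taylor_weight g p.+1 n + taylor_weight g p n.
Proof.
rewrite /taylor_weight binS natrD mulrDl subSS; congr (_ + _).
rewrite mulrCA; have [h|h] := ltnP n p.+1; first by rewrite bin_small// !mul0r.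
by congr (_ * _); rewrite -exprS -subSn.
Qed.

Lemma geom_weight_taylor_weight g p : `|g| = 1 -> geom_weight (taylor_weight g p).
Proof.
move=> g1 n; apply: le_trans (taylor_weight_le p n g1) _.
by have := @exprn_ege1 R n 2 (ler1n R 2); lra.
Qed.

Lemma geom_weight_taylor_weight_shift g p : `|g| = 1 -> geom_weight (wshift (taylor_weight g p)).
Proof. by move=> g1 n; rewrite -exprS; exact: taylor_weight_le. Qed.

(** If the determinant vanished at [g], the minor would solve the homogeneous
    equation, hence vanish; by the trace formula the derivative of the determinant
    would vanish, then that of the minor, and so on. All Taylor coefficients of the
    determinant at [g] would be [0], whereas its value at the parameter [0] is [1]. *)
Lemma fdet_neq0 g t : `|g| = 1 -> inj_at g t -> fdet g t != 0.
Proof.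
move=> g1 inj; apply/eqP => d0.
have gw p := geom_weight_taylor_weight p g1; have gs p := geom_weight_taylor_weight_shift p g1.
have w0 : taylor_weight g 0 = fun n => g ^+ n.
  by apply/funext => n; rewrite /taylor_weight bin0 subn0 mul1r.
have H p : fdetw (taylor_weight g p) t = 0 /\ forall x y, fminorw (taylor_weight g p) t x y = 0.
  elim: p => [|p [e0 M0]].
    rewrite w0; split=> // x y; move: x.
    apply: (inj (fun x => fminor g t x y)); first by apply: cont_fminorw; exact: geom_weight_exp.
    by move=> x; rewrite fminor_eq// d0 mulr0.
  have e1 : fdetw (taylor_weight g p.+1) t = 0.
    have /esym := itg_fminorw_diag t (gw p).
    rewrite (@eq_itg _ a t _ (fun=> 0 * 0)); last by move=> x _; rewrite M0 mul0r.
    rewrite itgZ ?mul0r; last exact: cont_cst.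
    have -> : (fun n => taylor_weight g p n * (n.+1%:R * det_coef K a n.+1 t)) =
        (fun n => p.+1%:R * (wshift (taylor_weight g p.+1) n * det_coef K a n.+1 t)).
      apply/funext => n; rewrite mulrA [RHS]mulrA; congr (_ * _).
      rewrite /wshift /taylor_weight subSS mulrAC [RHS]mulrA -!natrM.
      by have /= <- := mul_bin_diag n.+1 p; rewrite mulnC.
    have c1 : cvgn (series (fun n => wshift (taylor_weight g p.+1) n * det_coef K a n.+1 t)).
      exact: (is_cvg_series_recl (@cvg_det_coef _ t (gw p.+1))).
    rewrite series_sumZ// => /eqP; rewrite mulf_eq0 pnatr_eq0/= => /eqP e1.
    by rewrite /fdetw series_sum_recl// e1 addr0 /taylor_weight bin0n !mul0r.
  split=> // x y; move: x; apply: inj; first exact: cont_fminorw.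
  move=> x; rewrite -itgZ; last by apply: cont_mulK; exact: cont_fminorw.
  have := fminorw_eq t x y (gw p.+1) (gs p.+1); rewrite e1 mulr0 => E.
  rewrite -[RHS]E; congr (_ + _); apply: eq_itg => z _; rewrite mulrCA; congr (_ * _).
  rewrite -fminorwZ// -[LHS]addr0 -(M0 z y) -fminorwD//.
    by apply: eq_series_sum => n; rewrite /wshift taylor_weightS.
  by move=> n; rewrite normrM g1 mul1r; exact: gw.
have [C [Q [C0 Q0 HC]]] := coef_weighted `|t|.
have e2 : 0 < 2^-1 :> R by rewrite invr_gt0.
have [N0 tN] := tail_small C Q e2.
pose v n := \sum_(p < N0.+1) (- g) ^+ p * taylor_weight g p n.
have v0 n : (n <= N0)%N -> v n = (n == 0)%:R.
  move=> nN; rewrite /v; have -> : (n == 0)%:R = (g + - g) ^+ n.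
    by rewrite subrr expr0n.
  rewrite exprDn (big_ord_widen N0.+1 (fun i => g ^+ (n - i) * (- g) ^+ i *+ 'C(n, i)))//.
  rewrite [RHS]big_mkcond; apply: eq_bigr => i _; case: ifPn => [_|].
    by rewrite /taylor_weight mulrCA mulr_natl mulrC.
  by rewrite -leqNgt => h; rewrite /taylor_weight bin_small// mul0r mulr0.
have vle n : `|v n| <= 2 ^+ n.
  apply: le_trans (ler_norm_sum _ _ _) _.
  apply: (@le_trans _ _ (\sum_(p < N0.+1) 'C(n, p)%:R)).
    apply: ler_sum => p _; rewrite normrM normrX normrN g1 expr1n mul1r.
    by rewrite /taylor_weight normrM normrX g1 expr1n mulr1 ger0_norm.
  by rewrite -natr_sum -natrX ler_nat sum_bin_le.
have vw : geom_weight v.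
  by move=> n; apply: le_trans (vle n) _; have := @exprn_ege1 R n 2 (ler1n R 2); lra.
(* a partial sum of the Taylor expansion at [g], evaluated at the parameter [0] *)
have S0 m : fdetw (fun n => \sum_(p < m) (- g) ^+ p * taylor_weight g p n) t = 0 /\
    cvgn (series (fun n => (\sum_(p < m) (- g) ^+ p * taylor_weight g p n) * det_coef K a n t)).
  elim: m => [|m [IH1 IH2]].
    have -> : (fun n => (\sum_(p < 0) (- g) ^+ p * taylor_weight g p n) * det_coef K a n t) = fun=> 0.
      by apply/funext => n; rewrite big_ord0 mul0r.
    have c0 : cvgn (series (fun=> 0 : R)).
      by apply: (@is_cvg_dominated R 0 0) => // n; rewrite normr0 /maj mul0r.
    split=> //; rewrite /fdetw (@eq_series_sum _ _ (fun n => 0 * 0)).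
      by rewrite series_sumZ ?mul0r.
    by move=> n; rewrite big_ord0 !mul0r.
  have c1 := is_cvg_seriesZ (k := (- g) ^+ m) (@cvg_det_coef _ t (gw m)).
  have E : (fun n => (\sum_(p < m.+1) (- g) ^+ p * taylor_weight g p n) * det_coef K a n t) =
    (fun n => (\sum_(p < m) (- g) ^+ p * taylor_weight g p n) * det_coef K a n t) +
    (- g) ^+ m *: (fun n => taylor_weight g m n * det_coef K a n t).
    by apply/funext => n; rewrite big_ord_recr/= mulrDl -mulrA.
  split; last by rewrite E; exact: is_cvg_seriesD.
  rewrite /fdetw E /series_sum lim_seriesD// lim_seriesZ; last exact: cvg_det_coef.
  rewrite -/(series_sum _) -/(fdetw _ _) IH1 -/(series_sum _) -/(fdetw _ _).
  by have [-> _] := H m; rewrite scaler0 addr0.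
have [Sv _] := S0 N0.+1.
have [hv _] := HC v t t t vw (lexx _) (lexx _) (lexx _).
have := series_sum_tail N0.+1 C0 Q0 hv; rewrite -/(fdetw v t) Sv.
have -> : series (fun n => v n * det_coef K a n t) N0.+1 = 1.
  rewrite series_shift v0// eqxx mul1r det_coef0 -[RHS]addr0; congr (_ + _).
  rewrite /series/= big_nat_cond big1// => n; rewrite andbT => /andP[_ h].
  by rewrite v0// mul0r.
rewrite sub0r normrN normr1 => h1; have := tN N0.+1 (leqnSn _).
by have := ler_norm (tail C Q N0.+1); lra.
Qed.

(** Each coefficient is an integral over the position of the largest coordinate, see
    [det_coef_end], so the determinant is an integral of diagonal values of minors. *)
Lemma fdet_itg g t : `|g| = 1 -> a <= t ->
  fdet g t = 1 + g * itg a t (fun x => fminor g x x x).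
Proof.
move=> g1 at0; have gw := geom_weight_exp g1.
have [C [Q [C0 Q0 H]]] := coef_weighted (`|a| + `|t|).
have cm n : continuous (fun x => minor_coef K a n x x x).
  exact: (scont_cont1 [::] (scont_pick [:: 0%N; 0%N; 0%N] 1 (scont_minor_coef cK a n))).
rewrite -(@itg_series_sum R C Q (fun n x => g ^+ n * minor_coef K a n x x x))//; last 3 first.
- by move=> n x; apply: cvgM; [exact: cvg_cst|exact: cm].
- exact: (scont_cont1 [::] (scont_pick [:: 0%N; 0%N; 0%N] 1 (scont_fminorw gw))).
- move=> x xat; have xb := norm_le_between xat.
  by have [_ h] := H _ x x x gw xb xb xb.
have c1 : cvgn (series (fun n => wshift (fun n => g ^+ n) n * det_coef K a n.+1 t)).
  exact: (is_cvg_series_recl (@cvg_det_coef _ t gw)).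
rewrite /fdet /fdetw series_sum_recl// expr0 mul1r det_coef0; congr (_ + _).
have g0 : g != 0 by rewrite -normr_gt0 g1.
have E n : itg a t (fun x => g ^+ n * minor_coef K a n x x x) =
    g^-1 * (wshift (fun n => g ^+ n) n * det_coef K a n.+1 t).
  by rewrite itgZ// -det_coef_end// /wshift exprS -[g * _ * _]mulrA mulKf.
by rewrite (eq_series_sum E) series_sumZ// mulVKf.
Qed.

Lemma fdet_derive g t : `|g| = 1 -> a < t ->
  is_derive t (1:R) (fdet g) (g * fminor g t t t).
Proof.
move=> g1 at0; have gw := geom_weight_exp g1.
have cM : continuous (fun x => fminor g x x x).
  exact: (scont_cont1 [::] (scont_pick [:: 0%N; 0%N; 0%N] 1 (scont_fminorw gw))).
have /is_deriveE D := itg_derive cM at0.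
apply/is_deriveE => e e0; have [r r0 H] := D _ e0.
exists (Num.min r (t - a)) => [|y]; first by rewrite lt_min r0 subr_gt0.
rewrite lt_min => /andP[yr ya].
have ay : a <= y by move: ya; rewrite ltr_norml => /andP[]; lra.
rewrite !fdet_itg//; last exact: ltW.
rewrite (_ : _ - _ - _ = g * (itg a y (fun x => fminor g x x x) -
  itg a t (fun x => fminor g x x x) - fminor g t t t * (y - t))); last by ring.
by rewrite normrM g1 mul1r; exact: H.
Qed.

Definition resolvent g t x y := fminor g t x y / fdet g t.

Lemma resolvent_eq g t x y : `|g| = 1 -> fdet g t != 0 ->
  resolvent g t x y + g * itg a t (fun z => K (x + z) * resolvent g t z y) = K (x + y).
Proof.
move=> g1 d0; have gw := geom_weight_exp g1.
rewrite -[RHS](mulfK d0) -fminor_eq// mulrDl; congr (_ + _).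
rewrite -mulrA; congr (_ * _); rewrite mulrC -itgZ; last first.
  by apply: cont_mulK; exact: cont_fminorw.
by apply: eq_itg => z _; rewrite /resolvent; ring.
Qed.

End Fredholm.

(** * Uniform continuity of quotients, and constancy from a zero derivative *)

Section Quot.
Variable R : realType.
Implicit Types (F D : seq R -> R) (t L e : R) (s : seq R).

(** Joint continuity in [t] and in the other variables at [t0], where the
    denominator is not [0]. *)
Lemma quot_unif F D L t0 : scont F -> scont D -> D [:: t0] != 0 ->
  forall e, 0 < e -> exists2 r, 0 < r & forall t s s', `|t - t0| < r ->
    (forall i, `|s`_i| <= L) -> (forall i, `|s'`_i| <= L) ->
    (forall i, `|s`_i - s'`_i| < r) ->
    `|F (t :: s) / D [:: t] - F (t0 :: s') / D [:: t0]| < e.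
Proof.
move=> cF cD D0 e e0; pose L' := Num.max L (`|t0| + 1).
have [M M0 FM] := scont_bounded L' cF.
pose d := `|D [:: t0]|; have d0 : 0 < d by rewrite normr_gt0.
have e1 : 0 < e * d / 4 by rewrite divr_gt0// mulr_gt0.
have e2 : 0 < e * d ^+ 2 / (8 * M) by rewrite divr_gt0 ?mulr_gt0// exprn_gt0.
have [r1 r10 H1] := cF L' _ e1.
have [r2 r20 H2] := (contP _).1 (scont_cont1 [::] cD) t0 _ e2.
have d2 : 0 < d / 2 by rewrite divr_gt0.
have [r3 r30 H3] := (contP _).1 (scont_cont1 [::] cD) t0 _ d2.
exists (Num.min 1 (Num.min r1 (Num.min r2 r3))) => [|t s s' tt sL s'L ss].
  by rewrite !lt_min ltr01 r10 r20.
move: tt; rewrite !lt_min => /and4P[tt1 ttr1 ttr2 ttr3].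
have inL (x : R) (u : seq R) : `|x| <= `|t0| + 1 -> (forall i, `|u`_i| <= L) ->
    forall i, `|(x :: u)`_i| <= L'.
  by move=> xL uL [|i] /=; rewrite /L' le_max ?xL ?orbT ?uL.
have tL : `|t| <= `|t0| + 1 by have := ler_normD (t - t0) t0; rewrite subrK; lra.
have t0L : `|t0| <= `|t0| + 1 by lra.
have h1 : `|F (t :: s) - F (t0 :: s')| < e * d / 4.
  apply: H1; [exact: inL..|move=> [|i] //=].
  by have := ss i; rewrite !lt_min => /and4P[].
have h2 : `|D [:: t0] - D [:: t]| < e * d ^+ 2 / (8 * M) by apply: H2; rewrite distrC.
have h3 : `|D [:: t0] - D [:: t]| < d / 2 by apply: H3; rewrite distrC.
have Dt : d / 2 < `|D [:: t]|.
    have := ler_normD (D [:: t0] - D [:: t]) (D [:: t]); rewrite subrK -/d => h5.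
  by move: h3 h5; move: `|D [:: t0] - _| `|D [:: t]| => w1 w2; lra.
have Dt0 : D [:: t] != 0 by rewrite -normr_gt0; lra.
rewrite (_ : _ - _ = ((F (t :: s) - F (t0 :: s')) + F (t0 :: s') *
   (D [:: t0] - D [:: t]) / D [:: t0]) / D [:: t]); last by field; rewrite Dt0.
rewrite normrM normfV ltr_pdivrMr ?normr_gt0//.
apply: (@lt_trans _ _ (e * (d / 2))); last by rewrite ltr_pM2l.
apply: le_lt_trans (ler_normD _ _) _.
suff h4 : `|F (t0 :: s') * (D [:: t0] - D [:: t]) / D [:: t0]| <= e * d / 8 by lra.
rewrite normrM normfV -/d ler_pdivrMr// normrM.
apply: (@le_trans _ _ (M * (e * d ^+ 2 / (8 * M)))).
  by apply: ler_pM => //; [apply: FM; exact: inL|exact: ltW].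
rewrite expr2 le_eqVlt; apply/orP; left; apply/eqP; field; rewrite gt_eqF//.
Qed.
End Quot.

Lemma is_derive_shiftr (R : realType) (f : R -> R) (x y d : R) :
  is_derive (x + y) (1:R) f d -> is_derive x (1:R) (fun z => f (z + y)) d.
Proof.
move=> /is_deriveE H; apply/is_deriveE => e e0; have [r r0 h] := H e e0.
by exists r => // z zx; have := h (z + y); rewrite opprD addrACA subrr addr0; exact.
Qed.

Lemma is_derive0_in (R : realType) (H : R -> R) (x y : R) : x <= y ->
  (forall z, x <= z <= y -> is_derive z (1:R) H 0) -> H y = H x.
Proof.
rewrite le_eqVlt => /predU1P[->//|xy] dH.
have D z : z \in `]x, y[ -> is_derive z (1:R) H ((fun=> 0) z).
  by rewrite in_itv/= => /andP[h1 h2]; apply: dH; rewrite !ltW.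
have cH : {within `[x, y], continuous H}.
  apply: derivable_within_continuous => z; rewrite in_itv/= => h.
  by have [] := dH _ h.
have [c _ /eqP] := MVT xy D cH.
by rewrite mul0r subr_eq0 => /eqP.
Qed.

(** * The integral equation on a compact interval *)

Section Truncated.
Variable R : realType.
Variable K : R -> R.
Hypothesis cK : continuous K.
Hypothesis K0 : forall x, x < 0 -> K x = 0.
Variables (T U : R).
Hypothesis UT : U <= T.
Hypothesis T0 : 0 < T.
Implicit Types (t x y z L e g b : R).

Let a := - T.
Let D g t := fdet K a g t.
Let Rs g t x y := resolvent K a g t x y.

Hypothesis inj : forall g t, `|g| = 1 -> a < t -> t < U -> inj_at K a g t.

Lemma D_neq0 g t : `|g| = 1 -> a < t -> t < U -> D g t != 0.
Proof. by move=> g1 at0 tU; apply: fdet_neq0 => //; exact: inj. Qed.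

Lemma Kle0 x : x <= 0 -> K x = 0.
Proof.
rewrite le_eqVlt => /predU1P[->|]; last exact: K0.
apply/eqP; rewrite -normr_le0; apply/ler_addgt0Pl => e e0; rewrite addr0.
have [r r0 H] := (contP _).1 cK 0 _ e0.
have r2 : 0 < r / 2 by rewrite divr_gt0.
have := H (- (r / 2)); rewrite sub0r opprK gtr0_norm// (@K0 (- (r / 2))); last by lra.
by rewrite subr0 => h; rewrite ltW// h//; lra.
Qed.

Lemma scont_resolvent g t : `|g| = 1 -> scont (fun u => Rs g t u`_0 u`_1).
Proof.
move=> g1; have c := scont_cons (scont_cst t) (scont_fminor cK a g1).
by apply: eq_scont (scontZ (D g t)^-1 c) => u; rewrite /Rs /resolvent mulrC.
Qed.

Lemma cont_resolventr g t x : `|g| = 1 -> continuous (fun y => Rs g t x y).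
Proof.
by move=> g1; exact: (scont_cont1 [:: x] (scont_pick [:: 1%N; 0%N] 2 (scont_resolvent t g1))).
Qed.

Lemma cont_resolventl g t y : `|g| = 1 -> continuous (fun x => Rs g t x y).
Proof. by move=> g1; exact: (scont_cont1 [:: y] (scont_resolvent t g1)). Qed.

Lemma cont_itg_resolvent g t b (h : R -> R) : `|g| = 1 -> continuous h ->
  continuous (fun x => itg a b (fun y => Rs g t x y * h y)).
Proof.
move=> g1 ch.
have c : scont (fun u => Rs g t u`_1 u`_0 * h u`_0).
  apply: scontM; first exact: (scont_pick [:: 1%N; 0%N] 2 (scont_resolvent t g1)).
  by apply: scont_comp => //; exact: scont_nth.
exact: (scont_cont1 [::] (scont_itg_cst a b c)).
Qed.

Lemma resolvent_apply g t b (h : R -> R) x : `|g| = 1 -> a < t -> t < U -> continuous h ->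
  itg a b (fun y => Rs g t x y * h y) +
  g * itg a t (fun z => K (x + z) * itg a b (fun y => Rs g t z y * h y)) =
  itg a b (fun y => K (x + y) * h y).
Proof.
move=> g1 at0 tU ch; have D0 := D_neq0 g1 at0 tU.
have cRh z : continuous (fun y => Rs g t z y * h y).
  by move=> y; apply: cvgM; [exact: cont_resolventr|exact: ch].
have cF : scont (fun u => K (x + u`_0) * (Rs g t u`_0 u`_1 * h u`_1)).
  apply: scontM.
    by apply: scont_comp => //; apply: scontD; [exact: scont_cst|exact: scont_nth].
  apply: scontM; first exact: scont_resolvent.
  by apply: scont_comp => //; exact: scont_nth.
have -> : itg a t (fun z => K (x + z) * itg a b (fun y => Rs g t z y * h y)) =
    itg a b (fun y => itg a t (fun z => K (x + z) * (Rs g t z y * h y))).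
  rewrite -(itg_swap a t a b [::] cF)/=; apply: eq_itg => z _.
  by rewrite itgZ.
rewrite -itgZ; last exact: (scont_cont1 [::] (scont_itg_cst a t cF)).
rewrite -itgD//; last first.
  move=> y; apply: cvgM; first exact: cvg_cst.
  exact: (scont_cont1 [::] (scont_itg_cst a t cF)).
apply: eq_itg => y _; have E := @resolvent_eq R K cK a g t x y g1 D0.
rewrite -E mulrDl; congr (_ + _).
rewrite -mulrA; congr (_ * _); rewrite mulrC -itgZ; last first.
  by apply: cont_mulK => //; exact: cont_resolventl.
by apply: eq_itg => z _; rewrite [LHS]mulrA [LHS]mulrC.
Qed.

(** The solution of the equation with right-hand side [1], obtained from the
    resolvent. The factor [1] in the integrand makes it an instance of
    [resolvent_apply]. *)
Definition sol g t x := 1 - g * itg a t (fun y => Rs g t x y * 1).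

Lemma cont_sol g t : `|g| = 1 -> continuous (sol g t).
Proof.
move=> g1 x; apply: cvgB; first exact: cvg_cst.
apply: cvgM; first exact: cvg_cst.
exact: (@cont_itg_resolvent g t t (fun=> 1) g1 (@cont_cst R 1)).
Qed.

Lemma sol_eq g t x : `|g| = 1 -> a < t -> t < U ->
  sol g t x + g * itg a t (fun y => K (x + y) * sol g t y) = 1.
Proof.
move=> g1 at0 tU.
have c1 : continuous (fun z => itg a t (fun y => Rs g t z y * 1)).
  exact: (@cont_itg_resolvent g t t (fun=> 1) g1 (@cont_cst R 1)).
have c2 : continuous (fun z => K (x + z) * itg a t (fun y => Rs g t z y * 1)) by exact: cont_mulK.
have -> : itg a t (fun y => K (x + y) * sol g t y) = itg a t (fun y => K (x + y) * 1) -
    g * itg a t (fun z => K (x + z) * itg a t (fun y => Rs g t z y * 1)).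
  rewrite -itgZ// -itgB; last 2 first.
  - by apply: cont_mulK => //; exact: cont_cst.
  - by move=> z; apply: cvgM; [exact: cvg_cst|exact: c2].
  by apply: eq_itg => z _; rewrite /sol; ring.
by rewrite -(@resolvent_apply g t t (fun=> 1) x)// /sol; [ring|exact: cont_cst].
Qed.

(** The difference of two solutions need only be controlled on [[- T, T]]: replacing
    it outside by minus the integral term extends the homogeneous equation to the
    whole line. *)
Lemma inj_sub g t (f1 f2 : R -> R) : `|g| = 1 -> a < t -> t < U ->
  continuous f1 -> continuous f2 ->
  (forall x, a <= x <= T -> f1 x + g * itg a t (fun z => K (x + z) * f1 z) =
    f2 x + g * itg a t (fun z => K (x + z) * f2 z)) ->
  forall x, a <= x <= T -> f1 x = f2 x.
Proof.
move=> g1 at0 tU c1 c2 E.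
pose f z := f1 z - f2 z.
have cf : continuous f by move=> z; apply: cvgB; [exact: c1|exact: c2].
have Ef x : itg a t (fun z => K (x + z) * f z) =
    itg a t (fun z => K (x + z) * f1 z) - itg a t (fun z => K (x + z) * f2 z).
  rewrite -itgB; [|exact: cont_mulK..].
  by apply: eq_itg => z _; rewrite /f mulrBr.
(* [h] equals [f] on [[- T, T]] and satisfies the homogeneous equation everywhere *)
pose h x := - g * itg a t (fun z => K (x + z) * f z).
have ch : continuous h.
  move=> x; apply: cvgM; first exact: cvg_cst.
  have c : scont (fun u => K (u`_1 + u`_0) * f u`_0).
    apply: scontM; apply: scont_comp => //; [apply: scontD|]; exact: scont_nth.
  exact: (scont_cont1 [::] (scont_itg_cst a t c)).
have fh x : a <= x <= T -> f x = h x.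
  move=> xT; rewrite /h Ef /f; have := E x xT; lra.
have h0 := inj g1 at0 tU ch.
move=> x xT; apply/eqP; rewrite -subr_eq0; apply/eqP; rewrite -/(f x) fh//; apply: h0.
move=> y; rewrite /h mulNr addrC; apply/eqP; rewrite subr_eq0; apply/eqP.
congr (_ * _); apply: eq_itg => z /andP[z1 z2]; congr (_ * _).
have zT : a <= z <= T.
  by rewrite z1/=; apply: le_trans z2 _; apply: le_trans UT; exact: ltW.
by rewrite -[LHS]/(h z) -fh.
Qed.

(** Subtracting the equations at [s] and [t] gives an equation at [s] whose right-hand
    side is an integral over [[s, t]]; the resolvent solves it. *)
Lemma sol_diff g s t x : `|g| = 1 -> a < s -> s < U -> a < t -> t < U ->
  a <= x <= T ->
  sol g t x - sol g s x = - g * (itg a t (fun y => Rs g s x y * sol g t y) -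
    itg a s (fun y => Rs g s x y * sol g t y)).
Proof.
move=> g1 as0 sU at0 tU xT.
have cs := @cont_sol g t g1; have css := @cont_sol g s g1.
pose r b x := itg a b (fun y => Rs g s x y * sol g t y).
have cr b : continuous (r b) by exact: (@cont_itg_resolvent g s b (sol g t) g1 cs).
have c1 : continuous (fun x => sol g t x - sol g s x).
  by move=> z; apply: cvgB; [exact: cs|exact: css].
have c2 : continuous (fun x => - g * (r t x - r s x)).
  move=> z; apply: cvgM; first exact: cvg_cst.
  by apply: cvgB; exact: cr.
move: x xT; apply: (inj_sub g1 as0 sU c1 c2) => x xT.
have k1 := cont_mulK cK (x := x) cs; have k2 := cont_mulK cK (x := x) css.
have k3 b := cont_mulK cK (x := x) (cr b).
have -> : itg a s (fun z => K (x + z) * (sol g t z - sol g s z)) =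
  itg a s (fun z => K (x + z) * sol g t z) - itg a s (fun z => K (x + z) * sol g s z).
  by rewrite -(itgB a s k1 k2); apply: eq_itg => z _; rewrite mulrBr.
have -> : itg a s (fun z => K (x + z) * (- g * (r t z - r s z))) =
  - g * (itg a s (fun z => K (x + z) * r t z) - itg a s (fun z => K (x + z) * r s z)).
  rewrite -(itgB a s (k3 t) (k3 s)).
  have k4 : continuous (fun z => K (x + z) * r t z - K (x + z) * r s z).
    by move=> z; apply: cvgB; exact: k3.
  by rewrite -(itgZ a s (- g) k4); apply: eq_itg => z _; ring.
have e1 := sol_eq x g1 at0 tU; have e2 := sol_eq x g1 as0 sU.
have e3 := resolvent_apply t x g1 as0 sU cs; have e4 := resolvent_apply s x g1 as0 sU cs.
rewrite -/(r t x) in e3; rewrite -/(r s x) in e4.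
transitivity (- g * (itg a t (fun y => K (x + y) * sol g t y) -
  itg a s (fun y => K (x + y) * sol g t y))).
  have -> : sol g t x = 1 - g * itg a t (fun y => K (x + y) * sol g t y).
    by rewrite -e1 addrK.
  have -> : sol g s x = 1 - g * itg a s (fun y => K (x + y) * sol g s y).
    by rewrite -e2 addrK.
  have key (G X Y Z : R) : 1 - G * X - (1 - G * Z) + G * (Y - Z) = - G * (X - Y) by ring.
  exact: key.
rewrite -e3 -e4.
have key (G A B X Y : R) : - G * (A + G * X - (B + G * Y)) =
  - G * (A - B) + G * (- G * (X - Y)) by ring.
exact: key.
Qed.

Definition solnum g (u : seq R) : R :=
  D g u`_0 - g * itg a u`_0 (fun y => fminor K a g u`_0 u`_1 y).

Lemma scont_solnum g : `|g| = 1 -> scont (solnum g).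
Proof.
move=> g1; apply: scontB; first exact: scont_fdet.
apply: scontZ.
exact: (scont_itg a (scont_nth 0) (scont_pick [:: 1%N; 2%N; 0%N] 3 (scont_fminor cK a g1))).
Qed.

Lemma sol_quot g t x : `|g| = 1 -> a < t -> t < U ->
  sol g t x = solnum g [:: t; x] / D g t.
Proof.
move=> g1 at0 tU; have D0 := D_neq0 g1 at0 tU.
rewrite /solnum /sol /= mulrBl divff//; congr (_ - _); rewrite -mulrA; congr (_ * _).
rewrite mulrC -itgZ; last first.
  exact: (scont_cont1 [:: t; x] (scont_pick [:: 1%N; 2%N; 0%N] 3 (scont_fminor cK a g1))).
by apply: eq_itg => y _; rewrite /Rs /resolvent mulr1 mulrC.
Qed.

Lemma lt_near t0 : a < t0 -> t0 < U -> exists2 r, 0 < r &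
  forall t, `|t - t0| < r -> a < t /\ t < U.
Proof.
move=> at0 t0U; exists (Num.min (t0 - a) (U - t0)).
  by rewrite lt_min !subr_gt0 at0.
by move=> t; rewrite lt_min !ltr_norml => /andP[/andP[h1 h2] /andP[h3 h4]]; lra.
Qed.

Lemma sol_joint g t0 L : `|g| = 1 -> a < t0 -> t0 < U ->
  forall e, 0 < e -> exists2 r, 0 < r & forall t x x', `|t - t0| < r ->
    `|x| <= L -> `|x'| <= L -> `|x - x'| < r -> `|sol g t x - sol g t0 x'| < e.
Proof.
move=> g1 at0 t0U e e0; have D0 := D_neq0 g1 at0 t0U.
have [r r0 H] := quot_unif (Num.max L 0) (scont_solnum g1) (scont_fdet cK a g1) D0 e0.
have [r' r'0 H'] := lt_near at0 t0U.
exists (Num.min r r') => [|t x x']; first by rewrite lt_min r0.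
rewrite !lt_min => /andP[tr /H'[at' tU]] xL x'L /andP[xr _].
rewrite !sol_quot//; apply: (H t [:: x] [:: x']) => // -[|[|i]]//=; rewrite ?le_max ?xL ?x'L ?normr0 ?lexx ?orbT ?subrr ?normr0//.
Qed.

Lemma resolvent_sol_joint g t0 L : `|g| = 1 -> a < t0 -> t0 < U ->
  forall e, 0 < e -> exists2 r, 0 < r & forall t x x' y, `|t - t0| < r ->
    `|x| <= L -> `|x'| <= L -> `|y - t0| < r -> `|x - x'| < r ->
    `|Rs g t0 x y * sol g t y - Rs g t0 x' t0 * sol g t0 t0| < e.
Proof.
move=> g1 at0 t0U e e0; have D0 := D_neq0 g1 at0 t0U.
have c1 : scont (fun u => fminor K a g t0 u`_1 u`_2 * solnum g [:: u`_0; u`_2]).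
  apply: scontM.
    have c := scont_cons (scont_cst t0) (scont_fminor cK a g1).
    exact: (scont_pick [:: 1%N; 2%N] 3 c).
  exact: (scont_pick [:: 0%N; 2%N] 3 (scont_solnum g1)).
have c2 : scont (fun u => D g t0 * D g u`_0) by apply: scontZ; exact: scont_fdet.
have D2 : D g t0 * D g [:: t0]`_0 != 0 by rewrite mulf_neq0.
have [r r0 H] := quot_unif (Num.max L (`|t0| + 1)) c1 c2 D2 e0.
have [r' r'0 H'] := lt_near at0 t0U.
exists (Num.min 1 (Num.min r r')) => [|t x x' y]; first by rewrite !lt_min ltr01 r0.
rewrite !lt_min => /and3P[t1 tr /H'[at' tU]] xL x'L /and3P[y1 yr _] /and3P[_ xr _].
have D1 := D_neq0 g1 at' tU.
have yL : `|y| <= `|t0| + 1 by have := ler_normD (y - t0) t0; rewrite subrK; lra.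
have t0L : `|t0| <= `|t0| + 1 by lra.
have L0 : 0 <= Num.max L (`|t0| + 1) by rewrite le_max addr_ge0 ?orbT.
have := H t [:: x; y] [:: x'; t0] tr; rewrite /=.
rewrite !sol_quot// /Rs /resolvent -/(D g t0).
set A1 := fminor K a g t0 x y; set A2 := fminor K a g t0 x' t0.
rewrite (_ : A1 / D g t0 * _ = A1 * solnum g [:: t; y] / (D g t0 * D g t)); last first.
  by field; rewrite D0 D1.
rewrite (_ : A2 / D g t0 * _ = A2 * solnum g [:: t0; t0] / (D g t0 * D g t0)); last first.
  by field; rewrite D0.
by move=> HH; apply: HH => -[|[|[|i]]] /=; rewrite ?nth_nil ?subrr ?normr0//= le_max ?xL ?x'L ?yL ?t0L ?orbT.
Qed.

(** From [sol_diff], by joint continuity of the resolvent and of [sol]. *)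
Lemma sol_t_unif g t0 : `|g| = 1 -> a < t0 -> t0 < U ->
  forall e, 0 < e -> exists2 r, 0 < r & forall t x, `|t - t0| < r -> a <= x <= T ->
    `|sol g t x - sol g t0 x - (t - t0) * (- g * (Rs g t0 x t0 * sol g t0 t0))|
      <= e * `|t - t0|.
Proof.
move=> g1 at0 t0U e e0.
have [r r0 H] := resolvent_sol_joint (`|a| + `|T|) g1 at0 t0U e0.
have [r' r'0 H'] := lt_near at0 t0U.
exists (Num.min r r') => [|t x]; first by rewrite lt_min r0.
rewrite !lt_min => /andP[tr /H'[at' tU]] xT.
have cs := @cont_sol g t g1.
have cf : continuous (fun y => Rs g t0 x y * sol g t y).
  by move=> y; apply: cvgM; [exact: cont_resolventr|exact: cs].
set c := Rs g t0 x t0 * sol g t0 t0.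
have cfc : continuous (fun y => Rs g t0 x y * sol g t y - c).
  by move=> y; apply: cvgB; [exact: cf|exact: cvg_cst].
have E u : a <= u -> itg a u (fun y => Rs g t0 x y * sol g t y) =
    itg a u (fun y => Rs g t0 x y * sol g t y - c) + c * (u - a).
  move=> au; rewrite -(itg_cst c au) -(itgD a u cfc (@cont_cst R c)).
  by apply: eq_itg => y _; rewrite subrK.
rewrite sol_diff// (E t (ltW at')) (E t0 (ltW at0)).
rewrite (_ : _ - _ = - g * (itg a t (fun y => Rs g t0 x y * sol g t y - c) -
   itg a t0 (fun y => Rs g t0 x y * sol g t y - c))); last by ring.
rewrite normrM normrN g1 mul1r; apply: itg_end2 => //; [exact: ltW..|].
move=> y /andP[y1 y2]; rewrite ltW//; apply: H => //.
- exact: norm_le_between.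
- exact: norm_le_between.
- apply: le_lt_trans tr; move: y1 y2; rewrite ge_min le_max => x1 x2.
  have := ler_norm (t - t0); have := ler_norm (t0 - t); rewrite distrC ler_norml.
  by case/orP : x1; case/orP : x2; lra.
- by rewrite subrr normr0.
Qed.

Lemma sol_diag_derive g t0 ds : `|g| = 1 -> a < t0 -> t0 < U ->
  is_derive t0 (1:R) (sol g t0) ds ->
  is_derive t0 (1:R) (fun t => sol g t t) (- g * (Rs g t0 t0 t0 * sol g t0 t0) + ds).
Proof.
move=> g1 at0 t0U /is_deriveE dS; apply/is_deriveE => e e0.
have e3 : 0 < e / 3 by rewrite divr_gt0.
have [r1 r10 H1] := sol_t_unif g1 at0 t0U e3.
have [r2 r20 H2] := dS _ e3.
have [r3 r30 H3] := resolvent_sol_joint (`|a| + `|T|) g1 at0 t0U e3.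
have [r' r'0 H'] := lt_near at0 t0U.
exists (Num.min (Num.min r1 r2) (Num.min r3 r')) => [|t].
  by rewrite !lt_min r10 r20 r30.
rewrite !lt_min => /andP[/andP[tr1 tr2] /andP[tr3 /H'[at' tU]]].
have UT' := UT.
have tT : a <= t <= T by lra.
have t0T : a <= t0 <= T by lra.
set c := - g * (Rs g t0 t0 t0 * sol g t0 t0).
set c' := - g * (Rs g t0 t t0 * sol g t0 t0).
have h1 : `|c' - c| <= e / 3.
  rewrite /c' /c -mulrBr normrM normrN g1 mul1r ltW//; apply: H3 => //.
  - by rewrite subrr normr0.
  - exact: norm_le_between.
  - exact: norm_le_between.
  - by rewrite subrr normr0.
have h2 := H1 t t tr1 tT; have h3 := H2 t tr2.
have key (A B C u v w h : R) : A - C - (u + v) * h =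
  (A - B - h * w) + ((B - C - v * h) + (w - u) * h) by ring.
rewrite (key _ (sol g t0 t) _ _ _ c').
apply: le_trans (ler_normD _ _) _; rewrite (_ : e = e / 3 + (e / 3 + e / 3)); last by field.
rewrite [X in _ <= X]mulrDl; apply: lerD => //; apply: le_trans (ler_normD _ _) _.
by rewrite [X in _ <= X]mulrDl; apply: lerD => //; rewrite normrM ler_wpM2r.
Qed.

Let H u := itg (- (2 * T)) u K.

Lemma primK_le0 u : u <= 0 -> H u = 0.
Proof.
move=> u0; rewrite /H (@eq_itg _ _ _ _ (fun=> 0 * 0)).
  by rewrite itgZ ?mul0r//; exact: cont_cst.
by move=> z /andP[_ zu]; rewrite mulr0 Kle0//; exact: le_trans zu u0.
Qed.

Lemma primK_derive z y : - (2 * T) < z + y ->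
  is_derive z (1:R) (fun z => H (z + y)) (K (z + y)).
Proof. by move=> zy; apply: is_derive_shiftr; exact: itg_derive. Qed.

Lemma cont_primK y : continuous (fun z => H (z + y)).
Proof.
move=> z; apply: (continuous_comp (f := fun z => z + y) (g := H)).
  by apply: cvgD; [exact: cvg_id|exact: cvg_cst].
by apply: itg_cont.
Qed.

Lemma itg_kernel_shift x y : a <= x -> a <= y -> y <= T ->
  itg a x (fun z => K (z + y)) = H (x + y).
Proof.
move=> ax ay yT; have T0' := T0; rewrite /a in ax ay.
have cKy : continuous (fun z => K (z + y)).
  move=> z; apply: (continuous_comp (f := fun z => z + y) (g := K)); last exact: cK.
  by apply: cvgD; [exact: cvg_id|exact: cvg_cst].
have dH z : a < z < x -> is_derive z (1:R) (fun z => H (z + y)) (K (z + y)).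
  by move=> /andP[z1 z2]; apply: primK_derive; rewrite /a in z1; lra.
rewrite (itg_FTC ax cKy (@cont_primK y) dH).
by rewrite [X in _ - X]primK_le0 ?subr0// /a; lra.
Qed.

(** With [r z = Rs (- g) t z t] and [Q] its primitive, integrating the resolvent
    equation in its first variable, and then by parts, shows that
    [Q + g K Q = (1 + g Q(t)) K 1]. So [1 - g Q / (1 + g Q(t))] solves the equation
    of [sol g t], and its value at [t] is [1 / (1 + g Q(t))]. *)
Lemma sol_x g t x : `|g| = 1 -> a < t -> t < U -> a <= x <= T ->
  sol g t x = 1 - g * sol g t t * itg a x (fun z => Rs (- g) t z t).
Proof.
move=> g1 at0 tU xT; have T0' := T0; have UT' := UT.
have ng1 : `|- g| = 1 by rewrite normrN.
have tT : t <= T by lra.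
have D0 := D_neq0 ng1 at0 tU.
pose r z := Rs (- g) t z t; pose Q x := itg a x r.
have cr : continuous r by exact: cont_resolventl.
have cQ : continuous Q by exact: itg_cont.
have QE y : a <= y <= T -> Q y = H (y + t) + g * itg a t (fun z => r z * H (y + z)).
  move=> /andP[ay yT].
  have cF : scont (fun u => K (u`_0 + u`_1) * r u`_1).
    by apply: scontM; apply: scont_comp => //; [apply: scontD|]; exact: scont_nth.
  have E z : r z = K (z + t) + g * itg a t (fun v => K (z + v) * r v).
    have h := @resolvent_eq R K cK a (- g) t z t ng1 D0.
    rewrite -[X in X + _]h -/(r z) mulNr; exact: (esym (subrK _ _)).
  have c1 : continuous (fun z => itg a t (fun v => K (z + v) * r v)).
    exact: (scont_cont1 [::] (scont_itg_cst a t (scont_swap cF))).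
  have c2 : continuous (fun z => K (z + t)).
    move=> z; apply: (continuous_comp (f := fun z => z + t) (g := K)); last exact: cK.
    by apply: cvgD; [exact: cvg_id|exact: cvg_cst].
  rewrite /Q (@eq_itg _ a y _ _ (fun z _ => E z)) itgD//; last first.
    by move=> z; apply: cvgM; [exact: cvg_cst|exact: c1].
  rewrite itgZ// itg_kernel_shift//; last exact: ltW.
  congr (_ + _ * _); rewrite (itg_swap a y a t [::] cF)/=.
  apply: eq_itg => v /andP[av vt].
  have vT : v <= T by lra.
  rewrite mulrC -(itg_kernel_shift ay av vT) mulrC -itgZ.
    by apply: eq_itg => z _; rewrite mulrC.
  move=> z; apply: (continuous_comp (f := fun z => z + v) (g := K)); last exact: cK.
  by apply: cvgD; [exact: cvg_id|exact: cvg_cst].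
have cKQ y : continuous (fun z => K (y + z) * Q z) by exact: cont_mulK.
have crH y : continuous (fun z => r z * H (y + z)).
  move=> z; apply: cvgM; first exact: cr.
  apply: (continuous_comp (f := fun z => y + z) (g := H)); last by apply: itg_cont.
  by apply: cvgD; [exact: cvg_cst|exact: cvg_id].
have IBP y : a <= y <= T -> itg a t (fun z => r z * H (y + z)) =
    Q t * H (y + t) - itg a t (fun z => K (y + z) * Q z).
  move=> /andP[ay yT]; apply/eqP; rewrite -subr_eq opprK eq_sym; apply/eqP.
  have dF z : a < z < t -> is_derive z (1:R) (fun z => Q z * H (y + z))
      (r z * H (y + z) + K (y + z) * Q z).
    move=> /andP[z1 z2]; have dQ : is_derive z (1:R) Q (r z) by exact: itg_derive.
    have dH : is_derive z (1:R) (fun z => H (y + z)) (K (y + z)).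
      rewrite [y + z]addrC (_ : (fun z => H (y + z)) = fun z => H (z + y)).
        by apply: primK_derive; rewrite /a in z1 ay; lra.
      by apply/funext => v; rewrite addrC.
    apply: (is_derive_eq (is_deriveM dQ dH)).
    by rewrite -[_ *: _]/(Q z * K (y + z)) -[_ *: r z]/(H (y + z) * r z); ring.
  have c1 : continuous (fun z => r z * H (y + z) + K (y + z) * Q z).
    by move=> z; apply: cvgD; [exact: crH|exact: cKQ].
  have c2 : continuous (fun z => Q z * H (y + z)).
    move=> z; apply: cvgM; first exact: cQ.
    apply: (continuous_comp (f := fun z => y + z) (g := H)); last by apply: itg_cont.
    by apply: cvgD; [exact: cvg_cst|exact: cvg_id].
  rewrite -(itgD a t (crH y) (cKQ y)) (itg_FTC (ltW at0) c1 c2 dF).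
  have -> : Q a = 0 by rewrite /Q itg_aa.
  by rewrite mul0r subr0.
have QE2 y : a <= y <= T ->
    Q y + g * itg a t (fun z => K (y + z) * Q z) = H (y + t) * (1 + g * Q t).
  by move=> yT; rewrite QE// IBP//; ring.
have K1 y : a <= y <= T -> itg a t (fun z => K (y + z) * 1) = H (y + t).
  move=> /andP[ay yT]; rewrite (addrC y t) -itg_kernel_shift//; last exact: ltW.
  by apply: eq_itg => z _; rewrite mulr1 addrC.
have c1 : continuous (fun _ : R => 1 : R) by exact: cont_cst.
have tT2 : a <= t <= T by rewrite (ltW at0).
(* otherwise [Q] would solve the homogeneous equation, so that [Q t = 0] *)
have b0 : 1 + g * Q t != 0.
  apply/eqP => b0.
  have Q0 : Q t = 0.
    apply: (@inj_sub g t Q (fun=> 0) g1 at0 tU cQ (@cont_cst R 0)) => // y yT.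
    rewrite QE2// b0 mulr0 (@eq_itg _ a t _ (fun=> 0 * 0)); last by move=> z _; rewrite !mulr0.
    by rewrite itgZ ?mul0r ?mulr0 ?addr0//; exact: cont_cst.
  by move: b0; rewrite Q0 mulr0 addr0 => /eqP; rewrite oner_eq0.
pose be := g / (1 + g * Q t).
have cf : continuous (fun y => 1 - be * Q y).
  by move=> y; apply: cvgB; [exact: cvg_cst|apply: cvgM; [exact: cvg_cst|exact: cQ]].
have S y : a <= y <= T -> sol g t y = 1 - be * Q y.
  apply: (inj_sub g1 at0 tU (@cont_sol g t g1) cf) => {}y yT.
  rewrite sol_eq//.
  have -> : itg a t (fun z => K (y + z) * (1 - be * Q z)) =
      itg a t (fun z => K (y + z) * 1) - be * itg a t (fun z => K (y + z) * Q z).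
    have c3 : continuous (fun z => be * (K (y + z) * Q z)).
      by move=> z; apply: cvgM; [exact: cvg_cst|exact: cKQ].
    rewrite -(itgZ a t be (cKQ y)) -(itgB a t (cont_mulK cK (x := y) c1) c3).
    by apply: eq_itg => z _; ring.
  rewrite K1//; have h := QE2 y yT.
  have hb : be * (1 + g * Q t) = g by rewrite /be divfK.
  have key (q I h' b' c : R) : q + g * I = h' * b' -> c * b' = g ->
      1 = 1 - c * q + g * (h' - c * I).
    move=> h1 h2; have -> : q = h' * b' - g * I by rewrite -h1 addrK.
    have -> : 1 - c * (h' * b' - g * I) + g * (h' - c * I) = 1 + h' * (g - c * b') by ring.
    by rewrite h2 subrr mulr0 addr0.
  exact: key h hb.
rewrite S// S//; congr (1 - _ * _); rewrite /be; field; exact: b0.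
Qed.

Definition diag_sol g t := sol g t t.

Lemma diag_sol_derive g t : `|g| = 1 -> a < t -> t < U ->
  is_derive t (1:R) (diag_sol g)
    (- g * diag_sol g t * (Rs g t t t + Rs (- g) t t t)).
Proof.
move=> g1 at0 tU; have UT' := UT.
have ng1 : `|- g| = 1 by rewrite normrN.
have cr : continuous (fun z => Rs (- g) t z t) by exact: cont_resolventl.
have dS : is_derive t (1:R) (sol g t) (- (g * sol g t t * Rs (- g) t t t)).
  have /is_deriveE dQ := itg_derive cr at0.
  apply/is_deriveE => e e0.
  have b0 : 0 < `|g * sol g t t| + 1 by rewrite ltr_wpDl.
  have [r r0 H1] := dQ _ (divr_gt0 e0 b0).
  have [r' r'0 H'] := lt_near at0 tU.
  exists (Num.min r r') => [|y]; first by rewrite lt_min r0.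
  rewrite lt_min => /andP[yr /H'[ay yU]].
  have yT : a <= y <= T by lra.
  have tT : a <= t <= T by lra.
  have h := H1 y yr.
  have key (v p b' q1 q2 w k : R) : v = 1 - b' * q1 -> p = 1 - b' * q2 ->
      v - p - - (b' * w) * k = - b' * (q1 - q2 - w * k).
    by move=> -> ->; ring.
  rewrite (key _ _ _ _ _ _ _ (sol_x g1 at0 tU yT) (sol_x g1 at0 tU tT)) normrM normrN.
  apply: (@le_trans _ _ (`|g * sol g t t| * (e / (`|g * sol g t t| + 1) * `|y - t|))).
    by rewrite ler_wpM2l.
  rewrite mulrA ler_wpM2r// mulrA ler_pdivrMr// mulrC ler_wpM2l//; first exact: ltW.
  by rewrite lerDl.
apply: (is_derive_eq (sol_diag_derive g1 at0 tU dS)); rewrite /diag_sol.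
have key (p u v : R) : - g * (u * p) + - (g * p * v) = - g * p * (u + v) by ring.
exact: key.
Qed.

Lemma fminor_diag_le0 g t : `|g| = 1 -> t <= 0 -> fminor K a g t t t = 0.
Proof.
move=> g1 t0; have := @fminor_eq R K cK a g t t t g1.
rewrite (Kle0 (_ : t + t <= 0)); last by lra.
rewrite mul0r (@eq_itg _ a t _ (fun=> 0 * 0)); last first.
  by move=> z /andP[_ zt]; rewrite Kle0 ?mul0r ?mulr0//; lra.
by rewrite itgZ ?mul0r ?mulr0 ?addr0//; exact: cont_cst.
Qed.

(** For [t <= 0] the kernel is [0] at all pairs of points of [[a, t]]. *)
Lemma fdet_le0 g t : `|g| = 1 -> a <= t -> t <= 0 -> D g t = 1.
Proof.
move=> g1 at0 t0; rewrite /D fdet_itg// (@eq_itg _ a t _ (fun=> 0 * 0)); last first.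
  by move=> z /andP[_ zt]; rewrite fminor_diag_le0 ?mul0r//; exact: le_trans zt t0.
by rewrite itgZ ?mul0r ?mulr0 ?addr0//; exact: cont_cst.
Qed.

Lemma sol_lt g t x : `|g| = 1 -> a < t -> t < U -> x <= - t -> sol g t x = 1.
Proof.
move=> g1 at0 tU xt; rewrite -[RHS](sol_eq x g1 at0 tU).
rewrite (@eq_itg _ a t _ (fun=> 0 * 0)); last first.
  by move=> z /andP[_ zt]; rewrite Kle0 ?mul0r//; lra.
by rewrite itgZ ?mul0r ?mulr0 ?addr0//; exact: cont_cst.
Qed.

(** By [diag_sol_derive] and [fdet_derive] the product [D g * diag_sol g / D (- g)] has
    derivative [0], and it is [1] for [t <= 0]. *)
Lemma diag_sol_fdet g t : `|g| = 1 -> a < t -> t < U ->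
  sol g t t = D (- g) t / D g t.
Proof.
move=> g1 at0 tU; have ng1 : `|- g| = 1 by rewrite normrN.
have T0' := T0; have UT' := UT.
pose W s := D g s * diag_sol g s / D (- g) s.
have dW s : a < s -> s < U -> is_derive s (1:R) W 0.
  move=> as0 sU; have D1 := D_neq0 g1 as0 sU; have D2 := D_neq0 ng1 as0 sU.
  have d1 := fdet_derive cK g1 as0; have d2 := fdet_derive cK ng1 as0.
  have d3 := diag_sol_derive g1 as0 sU.
  have d4 := is_deriveM (is_deriveM d1 d3) (is_deriveV D2 d2).
  apply: (is_derive_eq d4).
  have key (A B P m1 m2 : R) : A != 0 -> B != 0 ->
      (A * P) * (- (B ^- 2) * (- g * m2)) +
      B^-1 * (A * (- g * P * (m1 / A + m2 / B)) + P * (g * m1)) = 0.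
    by move=> A0 B0; field; rewrite A0 B0.
  exact: key.
(* a time before [0] and [t] at which the product is known *)
pose t1 := (a + Num.min 0 t) / 2.
have mt : a < Num.min 0 t by rewrite lt_min at0 andbT /a; lra.
have t10 : t1 <= 0.
  have : Num.min 0 t <= 0 by rewrite ge_min lexx.
  by rewrite /t1; move: mt; move: (Num.min 0 t) => v; rewrite /a; lra.
have at1 : a < t1 by rewrite /t1; move: mt; move: (Num.min 0 t) => v; lra.
have t1t : t1 <= t.
  have : Num.min 0 t <= t by rewrite ge_min lexx orbT.
  by rewrite /t1; move: mt; move: (Num.min 0 t) => v; lra.
have W1 : W t1 = 1.
  rewrite /W !fdet_le0//; [|exact: ltW..]; rewrite /diag_sol sol_lt//; last 2 first.
  - by apply: le_lt_trans tU.
  - by lra.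
  by rewrite mulr1 divr1.
have Wt : W t = 1.
  rewrite -W1; apply: is_derive0_in => // s /andP[h1 h2]; apply: dW.
  - exact: lt_le_trans h1.
  - exact: le_lt_trans h2 tU.
have D1 := D_neq0 g1 at0 tU; have D2 := D_neq0 ng1 at0 tU.
move: Wt; rewrite /W /diag_sol => /(congr1 (fun v => v * D (- g) t / D g t)).
by rewrite mul1r divfK// mulrAC divff// mul1r.
Qed.

End Truncated.

Local Open Scope complex_scope.
(** * Local integrability and continuity of solutions *)

Section LocInt.
Variable R : realType.
Notation mu := (@lebesgue_measure R).
Variable K : R -> R.
Hypothesis cK : continuous K.
Implicit Types (t x y z L e g b : R) (u : R -> R).

Lemma trunc_cover b x h : 0 < h -> b <= x ->
  exists j, (j%:R * h <= x - b < j.+1%:R * h).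
Proof.
move=> h0 bx; exists (Num.truncn ((x - b) / h)).
have hx : 0 <= (x - b) / h by rewrite divr_ge0 ?subr_ge0// ltW.
by have := truncn_itv hx; rewrite ler_pdivlMr// ltr_pdivrMr.
Qed.

Lemma cont_mul (f g : R -> R) : continuous f -> continuous g ->
  continuous (fun x => f x * g x).
Proof. by move=> cf cg x; apply: cvgM; [exact: cf|exact: cg]. Qed.

Lemma cont_add (f g : R -> R) : continuous f -> continuous g ->
  continuous (fun x => f x + g x).
Proof. by move=> cf cg x; apply: cvgD; [exact: cf|exact: cg]. Qed.

Lemma cont_sum N (f : 'I_N -> R -> R) : (forall j, continuous (f j)) ->
  continuous (fun x => \sum_(j < N) f j x).
Proof.
elim: N f => [|N IH] f cf.
  by under eq_fun do rewrite big_ord0; exact: cont_cst.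
under eq_fun do rewrite big_ord_recl.
by apply: cont_add => //; apply: IH.
Qed.

Lemma integrable_mul_cont (b t M : R) (h u : R -> R) : continuous h ->
  (forall y, b <= y < t -> `|h y| <= M) ->
  mu.-integrable `[b, t[ (fun y => (u y)%:E) ->
  mu.-integrable `[b, t[ (fun y => (h y * u y)%:E).
Proof.
move=> ch hM iu.
have m1 : measurable_fun `[b, t[ h.
  by apply: measurable_funTS; exact: measurable_realfun.continuous_measurable_fun.
have b1 : [bounded h y | y in `[b, t[ ].
  exists M; split; first exact: num_real.
  move=> w Mw y /=; rewrite in_itv/= => yb; apply: le_trans (ltW Mw).
  exact: hM.
have := @integrableMr _ _ _ mu _ _ h (fun y => (u y)%:E) m1 b1 iu.
by apply; exact: measurable_itv.
Qed.

(** Near any point some translate of [K] is bounded away from [0]. Finitely many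
    translates [p j] suffice on [[b, t]], and
    [u = \sum_j (p j / S) (p j u)] with [S = \sum_j (p j) ^+ 2] writes [u] as a
    combination of integrable functions with bounded coefficients. *)
Lemma locint_of_shift t b u :
  (forall x, mu.-integrable `]-oo, t[ (fun y => (K (x + y) * u y)%:E)) ->
  (exists x0, K x0 != 0) -> mu.-integrable `[b, t[ (fun y => (u y)%:E).
Proof.
move=> iu [x0 Kx0]; pose k := `|K x0| / 2.
have k0 : 0 < k by rewrite divr_gt0// normr_gt0.
have [d d0 dK] : exists2 d, 0 < d & forall y, `|x0 - y| < d -> k <= `|K y|.
  have /contP/(_ x0 _ k0)[d d0 dK] := cK; exists d => // y /dK.
  rewrite /k => h; have := lerB_normD (K x0) (- K y).
  have := ler_normD (K x0 - K y) (K y); rewrite subrK; lra.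
pose N := (Num.truncn ((t - b) / (d / 2))).+1.
have d20 : 0 < d / 2 by rewrite divr_gt0.
(* translates that carry [x0] to the points of a subdivision of step [d / 2] *)
pose p j y := K (x0 - b - j%:R * (d / 2) + y).
have cp j : continuous (p j) by exact: cont_shift.
pose S y := Num.max (k ^+ 2) (\sum_(j < N) p j y ^+ 2).
have k20 : 0 < k ^+ 2 by rewrite exprn_gt0.
have cS : continuous S.
  move=> y; apply: (@continuous_max _ _ (cst (k ^+ 2)) (fun y => \sum_(j < N) p j y ^+ 2)).
    exact: cvg_cst.
  apply: cont_sum => j; exact: cont_mul.
have S0 y : 0 < S y by rewrite /S lt_max k20.
have SE y : b <= y < t -> S y = \sum_(j < N) p j y ^+ 2.
  move=> /andP[byy yt]; apply/max_idPr.
  have [j /andP[j1 j2]] := trunc_cover d20 byy.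
  have jN : (j < N)%N.
    rewrite ltnS /N; rewrite -(ler_nat R).
    rewrite -(@ler_pM2r _ (d / 2))//.
    have tb : 0 <= (t - b) / (d / 2) by rewrite divr_ge0 ?ltW// subr_gt0 (le_lt_trans byy).
    rewrite ler_pM2r// ler_nat (truncn_ge_nat _ tb)//.
    by rewrite ler_pdivlMr// (le_trans j1)// lerB// ltW.
  rewrite (bigD1 (Ordinal jN))//=; apply: ler_wpDr; first by apply: sumr_ge0 => i _; exact: sqr_ge0.
  rewrite -(real_normK (num_real (p j y))) lerXn2r ?nnegrE//; first exact: ltW.
  apply: dK; rewrite (_ : _ - _ = j%:R * (d / 2) - (y - b)); last by ring.
  by rewrite -natr1 mulrDl mul1r in j2; rewrite ltr_norml; apply/andP; split; lra.
have ii j : mu.-integrable `[b, t[ (fun y => (p j y / S y * (p j y * u y))%:E).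
  have [M M0 pM] := cont_bounded (`|b| + `|t|) (cp j).
  apply: (@integrable_mul_cont _ _ (M / k ^+ 2)).
  - by move=> y; apply: cvgM; [exact: cp|apply: cvgV; [rewrite gt_eqF|exact: cS]].
  - move=> y /andP[h1 h2]; rewrite normrM; apply: ler_pM => //.
      by apply: pM; apply: norm_le_between; rewrite h1 ltW.
    by rewrite normfV lef_pV2 ?posrE ?normr_gt0 ?gt_eqF// gtr0_norm// /S le_max lexx.
  - apply: integrableS (iu (x0 - b - j%:R * (d / 2))) => //.
    by move=> y /=; rewrite !in_itv/= => /andP[].
apply: eq_integrable (_ : mu.-integrable _ (fun y => \sum_(j < N) (p j y / S y * (p j y * u y))%:E)%E) => //.
  move=> y; rewrite inE/= in_itv/= => hy; rewrite sumEFin; congr (_%:E).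
  rewrite (eq_bigr (fun j : 'I_N => p j y ^+ 2 * (u y / S y))); last by move=> j _; ring.
  by rewrite -mulr_suml -SE// mulrCA mulfV ?mulr1// gt_eqF.
by apply: integrable_sum.
Qed.

Lemma cont_shift_integral t u : (forall x, x < 0 -> K x = 0) ->
  (forall b, mu.-integrable `[b, t[ (fun y => (u y)%:E)) ->
  continuous (fun x => \int[mu]_(y in `]-oo, t[) (K (x + y) * u y)).
Proof.
move=> K0 iu; apply/contP => x e e0; pose L := `|x| + 1.
have E z : `|z| <= L -> \int[mu]_(y in `]-oo, t[) (K (z + y) * u y) =
    \int[mu]_(y in `[- L, t[) (K (z + y) * u y).
  move=> zL.
  have -> : `[- L, t[%classic = `]-oo, t[ `&` `[- L, +oo[%classic :> set R.
    by apply/seteqP; split=> w /=; rewrite !in_itv/= andbT;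
      [move=> /andP[-> ->]|move=> [-> ->]].
  rewrite Rintegral_mkcondr; apply: eq_Rintegral => y; rewrite inE/= in_itv/= => yt.
  rewrite patchE; case: ifPn => //; rewrite notin_setE/= in_itv/= andbT => /negP.
  rewrite -ltNge => yL; rewrite K0 ?mul0r//.
  by move: zL; rewrite ler_norml => /andP[_]; lra.
have iKu z : mu.-integrable `[- L, t[ (fun y => (K (z + y) * u y)%:E).
  have [M M0 pM] := cont_bounded (`|- L| + `|t|) (cont_shift cK (x := z)).
  apply: (@integrable_mul_cont _ _ M) (iu (- L)); first exact: cont_shift.
  by move=> y /andP[h1 h2]; apply: pM; apply: norm_le_between; rewrite h1 ltW.
pose I := \int[mu]_(y in `[- L, t[) `|u y|.
have I0 : 0 <= I by apply: Rintegral_ge0.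
have e1 : 0 < e / (I + 1) by rewrite divr_gt0// ltr_wpDl.
have [d d0 dK] := heine (L + (L + `|t|)) cK e1.
exists (Num.min 1 d) => [|x']; first by rewrite lt_min ltr01.
rewrite lt_min => /andP[h1 hd].
have xL : `|x| <= L by rewrite /L lerDl.
have x'L : `|x'| <= L.
  have := ler_normB x (x - x'); rewrite opprB addrC subrK /L; lra.
have iB : mu.-integrable `[- L, t[ (fun y => (K (x + y) * u y - K (x' + y) * u y)%:E).
  by apply: eq_integrable (integrableB _ (iKu x) (iKu x')) => // y _; rewrite /= -EFinB.
rewrite !E// -RintegralB//; [|exact: iKu..].
apply: le_lt_trans (le_normr_Rintegral _ _) _ => //.
apply: (@le_lt_trans _ _ (\int[mu]_(y in `[- L, t[) (e / (I + 1) * `|u y|))).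
  apply: le_Rintegral => //.
  - exact: integrable_norm iB.
  - apply: eq_integrable (integrableZl _ (e / (I + 1)) (integrable_norm (iu (- L)))) => //.
  - move=> y; rewrite /= in_itv/= => /andP[y1 y2].
    rewrite -mulrBl normrM ler_wpM2r// ltW// dK//.
      rewrite (le_trans (ler_normD _ _))// lerD//.
      have -> : L + `|t| = `|- L| + `|t| by rewrite normrN (ger0_norm (le_trans _ xL)).
      by apply: norm_le_between; rewrite y1 ltW.
    by rewrite opprD addrACA subrr addr0.
rewrite RintegralZl//; last by apply: integrable_norm.
by rewrite -/I mulrAC -mulrA gtr_pMr// ltr_pdivrMr ?mul1r ?ltrDl// ltr_wpDl.
Qed.

End LocInt.

(** * From the half-line to the compact interval *)

Section Link.
Variable R : realType.
Notation mu := (@lebesgue_measure R).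
Variable K : R -> R.
Hypothesis cK : continuous K.
Hypothesis K0 : forall x, x < 0 -> K x = 0.
Implicit Types (t x y z L e g b T : R) (u : R -> R).

Lemma scont_fun (f : R -> R) i : continuous f -> scont (fun s => f s`_i).
Proof. by move=> cf; apply: scont_comp => //; exact: scont_nth. Qed.

(** The integrand is [0] for [y < - T], as [x <= T]. *)
Lemma integral_trunc T t x u : continuous u -> x <= T -> - T <= t ->
  \int[mu]_(y in `]-oo, t[) (K (x + y) * u y) =
  itg (- T) t (fun y => K (x + y) * u y).
Proof.
move=> cu xT Tt.
have := @iter_trunc R (- T) 1 (fun s => K (x + s`_0) * u s`_0) t Tt.
apply.
  by apply: scontM; [apply: (@scont_fun (fun z => K (x + z))); exact: cont_shift|exact: scont_fun].
case=> [//|y [|//]] _ _ /=; rewrite orbF => yT.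
by rewrite K0 ?mul0r//; lra.
Qed.

Lemma solves_cont g t k u : `|g| = 1 ->
  (forall x, mu.-integrable `]-oo, t[ (fun y => (K (x + y) * u y)%:E) /\
    u x + g * \int[mu]_(y in `]-oo, t[) (K (x + y) * u y) = k) -> continuous u.
Proof.
move=> g1 H.
have uE : u = fun x => k - g * \int[mu]_(y in `]-oo, t[) (K (x + y) * u y).
  by apply/funext => x; have [_ <-] := H x; rewrite addrK.
have [[x0 Kx0]|nK] := pselect (exists x0, K x0 != 0); last first.
  have KE x : K x = 0.
    by apply/eqP; apply/negPn/negP => Kx; apply: nK; exists x.
  rewrite uE => x; apply: cvgB; first exact: cvg_cst.
  rewrite [X in _ @[_ --> _] --> X]mulrC.
  under eq_fun do under eq_Rintegral do rewrite KE mul0r.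
  under [X in X * _]eq_Rintegral do rewrite KE mul0r.
  rewrite mulrC; exact: cvg_cst.
have iu b : mu.-integrable `[b, t[ (fun y => (u y)%:E).
  by apply: (locint_of_shift cK) => [x|]; [case: (H x)|exists x0].
rewrite uE; apply: cont_add; first exact: cont_cst.
have h := cont_shift_integral cK K0 iu.
by move=> x; apply: cvgN; apply: cvgM; [exact: cvg_cst|exact: h].
Qed.

(** The constant [k] is [1] for the real part of a given solution and [0] for its
    imaginary part. *)
Lemma solves_real g t k u : `|g| = 1 ->
  (forall x, mu.-integrable `]-oo, t[ (fun y => (K (x + y) * u y)%:E) /\
    u x + g * \int[mu]_(y in `]-oo, t[) (K (x + y) * u y) = k) ->
  [/\ continuous u, (forall x, x <= - t -> u x = k) &
   forall T x, - T <= t -> x <= T -> u x + g * itg (- T) t (fun y => K (x + y) * u y) = k].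
Proof.
move=> g1 H; have cu := solves_cont g1 H.
split=> // [x xt|T x Tt xT]; have [_ <-] := H x; last by rewrite (integral_trunc cu xT Tt).
rewrite -[LHS]addr0; congr (_ + _); rewrite -(mulr0 g); congr (_ * _).
transitivity (\int[mu]_(y in `]-oo, t[) (0 : R)); last first.
  apply: eq_Rintegral => y; rewrite inE/= in_itv/= => yt.
  by rewrite K0 ?mul0r//; lra.
by rewrite Rintegral_cst// mul0r.
Qed.

(** When some coordinate of [s] is below [- T], the matrix has a row of zeros. *)
Lemma det1D_fdet T t g : - T <= t -> t <= T -> det1D K t g = fdet K (- T) g t.
Proof.
move=> Tt tT; rewrite /det1D /fredholm_det /fdet /fdetw /series_sum.
congr (limn (series _)); apply/funext => n; rewrite /det_coef mulrA; congr (_ * _).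
rewrite (iter_trunc (a := - T))//.
  exact: (scont_MdetD cK).
move=> s sn /allP st /hasP[x xs xT].
pose i := index x s.
have im : (i < n)%N by rewrite -sn index_mem.
rewrite (expand_det_row _ (Ordinal im)) big1// => j _.
rewrite mxE /= nth_index// K0 ?mul0r//.
have := st s`_j; rewrite mem_nth ?sn// => /(_ isT); lra.
Qed.

(** A nonzero continuous solution of the homogeneous equation vanishes before [- t],
    so it is square integrable and an eigenfunction for the eigenvalue [- g]. *)
Lemma inj_at_K5 T t g : `|g| = 1 -> - T <= t -> t <= T ->
  (0 <= t -> ~ eigenvalue_opK K t (- g)%:C) -> inj_at K (- T) g t.
Proof.
move=> g1 Tt tT ne f cf Hf.
have [t0|t0] := ltP t 0.
  have f0 x : x <= t -> f x = 0.
    move=> xt; rewrite -(Hf x) (@eq_itg _ _ _ _ (fun=> 0)).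
      by rewrite itg_cst// mul0r mulr0 addr0.
    by move=> z /andP[_ zt]; rewrite K0 ?mul0r//; lra.
  move=> x; rewrite -(Hf x) (@eq_itg _ _ _ _ (fun=> 0)).
    by rewrite itg_cst// mul0r mulr0 addr0.
  by move=> z /andP[_ zt]; rewrite f0 ?mulr0//; lra.
have fle x : x <= - t -> f x = 0.
  move=> xt; rewrite -(Hf x) (@eq_itg _ _ _ _ (fun=> 0)).
    by rewrite itg_cst// mul0r mulr0 addr0.
  by move=> z /andP[_ zt]; rewrite (Kle0 cK K0) ?mul0r//; lra.
have gg : g * g = 1 by rewrite -expr2 -(real_normK (num_real g)) g1 expr1n.
move=> x; apply: contrapT => fx; apply: (ne t0); exists (fun x => (f x)%:C).
have mD : measurable (`]-oo, t[%classic : set R) by exact: measurable_itv.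
split; [split; [|split]|split].
- by apply: measurable_funTS; exact: measurable_realfun.continuous_measurable_fun.
- exact: measurable_cst.
- rewrite /= integrable_mkcond; last exact: measurable_itv.
  have -> : (fun x => (f x ^+ 2 + 0 ^+ 2)%:E) \_ `]-oo, t[ =
            (fun x => (f x ^+ 2)%:E) \_ `[- T, t[.
    apply/funext => y; rewrite !patchE !mem_setE !in_itv/= expr0n/= addr0.
    have [yt|yt] := ltP y t; rewrite ?andbF// andbT; case: leP => // yT.
    by rewrite fle ?expr0n//; lra.
  rewrite -integrable_mkcond; last exact: measurable_itv.
  apply: integrableS (cont_integrable (- T) t _) => //; last first.
    by move=> y; apply: cvgM; exact: cf.
  exact: subset_itv_co_cc.
- move=> Hae; apply: fx; rewrite -(Hf x) -[LHS]addr0; congr (_ + _).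
    have iI : mu.-integrable `[- T, t[ (EFin \o (fun z => K (x + z) * f z)).
    apply: integrableS (cont_integrable (- T) t (cont_mul (cont_shift cK (x := x)) cf)) => //.
    exact: subset_itv_co_cc.
  rewrite -(mulr0 g); congr (_ * _); rewrite /itg -Rintegral_itv_bndo_bndc//.
  rewrite /Rintegral (@ae_eq_integral _ _ _ mu _ (cst 0%E))//.
  - by rewrite integral_cst// mul0e.
  - exact: measurable_int iI.
  - apply: negligibleS Hae => y /= Hy Hy'; apply: Hy; rewrite in_itv/= => /andP[_ yt].
    by move: Hy'; rewrite in_itv/= => /(_ yt) [->]; rewrite mulr0.
- apply: aeW => y /=; rewrite in_itv/= => yt.
  rewrite /opK indicE mem_set/= ?in_itv//= mul1r /cintegral.
  have E z : (K (y + z))%:C * (f z)%:C = (K (y + z) * f z)%:C by rewrite rmorphM.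
  under eq_Rintegral do rewrite E/=.
  under [X in _ +i* X]eq_Rintegral do rewrite E/=.
  rewrite Rintegral_cst// mul0r.
  rewrite (@integral_trunc T)//; last by lra.
  rewrite -rmorphM/=; congr (_ +i* _).
  by have := Hf y; move: (itg _ _ _) => I /eqP; rewrite addr_eq0 => /eqP ->; rewrite mulrNN mulrA gg mul1r.
Qed.

End Link.

(** * The two families of solutions *)

Section Family.
Variable R : realType.
Variable K : R -> R.
Hypothesis cK : continuous K.
Hypothesis K0 : forall x, x < 0 -> K x = 0.
Variable tau : \bar R.
Variable phi : R -> R -> R -> R.
Implicit Types (t x y z L e g b T U : R).

Hypothesis phi_cont : forall g t, `|g| = 1 -> (t%:E < tau)%E -> continuous (phi g t).
Hypothesis phi_eq : forall g t T x, `|g| = 1 -> (t%:E < tau)%E -> - T <= t -> x <= T ->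
  phi g t x + g * itg (- T) t (fun y => K (x + y) * phi g t y) = 1.
Hypothesis inj : forall g t T, `|g| = 1 -> (t%:E < tau)%E -> - T <= t -> t <= T ->
  inj_at K (- T) g t.

(** The real number [U] replaces [tau] in the compact setting, where [U <= T]. *)
Lemma local_bound t T : (t%:E < tau)%E -> `|t| < T ->
  exists U, [/\ U <= T, t < U & forall s, s < U -> (s%:E < tau)%E].
Proof.
move=> + /ltr_normlP[_ tT]; case: tau => [r|_|//].
- rewrite lte_fin => tr; exists (Num.min T r); rewrite ge_min lexx lt_min tT tr.
  by split=> // s; rewrite lt_min lte_fin => /andP[].
- by exists T; split=> // s _; rewrite ltry.
Qed.

Lemma phi_sol g t T U x : `|g| = 1 -> U <= T -> (forall s, s < U -> (s%:E < tau)%E) ->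
  - T < t -> t < U -> - T <= x <= T -> phi g t x = sol K T g t x.
Proof.
move=> g1 UT Utau Tt tU; have ttau := Utau _ tU; move: x.
have UT' := UT.
have inj' g' s : `|g'| = 1 -> - T < s -> s < U -> inj_at K (- T) g' s.
  by move=> g'1 Ts sU; apply: inj => //; [exact: Utau|exact: ltW|lra].
apply: (@inj_sub R K cK T U UT inj' g t) => //.
- exact: phi_cont.
- exact: cont_sol.
- move=> x /andP[Tx xT]; rewrite (@sol_eq R K cK T U inj' g t x)//.
  by rewrite phi_eq//; exact: ltW.
Qed.

(** The function [r g] is the resolvent at [t0], evaluated at [(x, t0)]. *)
Lemma phi_local t0 T : (t0%:E < tau)%E -> `|t0| < T -> exists r : R -> R -> R,
  [/\ forall g, `|g| = 1 -> continuous (r g),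
      forall g e, `|g| = 1 -> 0 < e -> exists2 d, 0 < d & forall t x, `|t - t0| < d ->
        - T <= x <= T ->
        `|phi g t x - phi g t0 x - (t - t0) * (- g * (r g x * phi g t0 t0))|
          <= e * `|t - t0|,
      forall g x, `|g| = 1 -> - T <= x <= T ->
        phi g t0 x = 1 - g * phi g t0 t0 * itg (- T) x (r (- g)) &
      forall g e, `|g| = 1 -> 0 < e -> exists2 d, 0 < d & forall t x, `|t - t0| < d ->
        `|x - t0| < d -> `|phi g t x - phi g t0 t0| < e].
Proof.
move=> t0tau t0T; have [U [UT t0U Utau]] := local_bound t0tau t0T.
have T0 : 0 < T by apply: le_lt_trans t0T.
have [nt0T t0T'] : - T < t0 /\ t0 < T by move: t0T; rewrite ltr_norml => /andP.
have UT' := UT.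
have inj' g' s : `|g'| = 1 -> - T < s -> s < U -> inj_at K (- T) g' s.
  by move=> g'1 Ts sU; apply: inj => //; [exact: Utau|exact: ltW|lra].
have t0t0 : - T <= t0 <= T by rewrite !ltW.
have [n n0 nU] := lt_near nt0T t0U.
have S g t x : `|g| = 1 -> - T < t -> t < U -> - T <= x <= T -> phi g t x = sol K T g t x.
  by move=> g1; exact: phi_sol.
exists (fun g x => resolvent K (- T) g t0 x t0); split.
- by move=> g g1; exact: cont_resolventl.
- move=> g e g1 e0.
  have [d d0 dH] := @sol_t_unif R K cK T U UT inj' g t0 g1 nt0T t0U e e0.
  exists (Num.min d n) => [|t x]; first by rewrite lt_min d0.
  rewrite lt_min => /andP[td /nU[tT tU]] xT.
  by rewrite !S//; exact: dH.
- move=> g x g1 xT; rewrite !S//.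
  exact: (@sol_x R K cK K0 T U UT T0 inj' g t0 x g1 nt0T t0U).
- move=> g e g1 e0.
  have [d d0 dH] := @sol_joint R K cK T U inj' g t0 T g1 nt0T t0U e e0.
  have tT0 : 0 < T - `|t0| by rewrite subr_gt0.
  exists (Num.min (T - `|t0|) (Num.min d n)) => [|t x]; first by rewrite !lt_min d0 n0 tT0.
  rewrite !lt_min => /and3P[_ td /nU[tT tU]] /and3P[xT xd _].
  have xT' : `|x| <= T by have := ler_normD (x - t0) t0; rewrite subrK; lra.
  rewrite !S//; last by rewrite -ler_norml.
  by apply: dH => //; exact: ltW.
Qed.

Lemma phi_diag g t : `|g| = 1 -> (t%:E < tau)%E ->
  phi g t t = det1D K t (- g) / det1D K t g /\ det1D K t g != 0.
Proof.
move=> g1 ttau; pose T := `|t| + 1.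
have tT : `|t| < T by rewrite ltrDl.
have [U [UT tU Utau]] := local_bound ttau tT.
have T0 : 0 < T by apply: le_lt_trans tT.
have [ntT tT'] : - T < t /\ t < T by move: tT; rewrite ltr_norml => /andP.
have UT' := UT.
have inj' g' s : `|g'| = 1 -> - T < s -> s < U -> inj_at K (- T) g' s.
  by move=> g'1 Ts sU; apply: inj => //; [exact: Utau|exact: ltW|lra].
rewrite !(det1D_fdet cK K0 (T := T)) ?ltW//; split; last first.
  by apply: fdet_neq0 => //; exact: inj'.
rewrite (@phi_sol g t T U)// ?ltW//.
exact: (@diag_sol_fdet R K cK K0 T U UT T0 inj').
Qed.

Lemma phi_diagN g t : `|g| = 1 -> (t%:E < tau)%E -> phi g t t * phi (- g) t t = 1.
Proof.
move=> g1 ttau; have [-> d0] := phi_diag g1 ttau.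
have Ng1 : `|- g| = 1 by rewrite normrN.
have [-> d1] := phi_diag Ng1 ttau; rewrite opprK.
by rewrite mulrACA [X in _ * X]mulrC mulrACA mulrC !divff// mulr1.
Qed.

Lemma phi_diag_gamma t : (t%:E < tau)%E ->
  phi (- 1) t t ^+ 2 = gamma_fun K t /\ phi 1 t t ^+ 2 = (gamma_fun K t)^-1.
Proof.
move=> ttau; have g1 : `|1 : R| = 1 by rewrite normr1.
have Ng1 : `|- 1 : R| = 1 by rewrite normrN.
have [e1 d1] := phi_diag g1 ttau; have [e2 d2] := phi_diag Ng1 ttau.
rewrite opprK in e2; rewrite /gamma_fun /m_fun e1 e2.
by rewrite -exprVn invf_div.
Qed.

Lemma phi_diag_cont g t e : `|g| = 1 -> (t%:E < tau)%E -> 0 < e ->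
  exists2 d, 0 < d & forall s, `|s - t| < d -> `|phi g s s - phi g t t| < e.
Proof.
move=> g1 ttau e0; have tT : `|t| < `|t| + 1 by rewrite ltrDl.
have [r [_ _ _ H]] := phi_local ttau tT; have [d d0 dH] := H g e g1 e0.
by exists d => // s sd; exact: dH.
Qed.

Lemma phi_le g t x : `|g| = 1 -> (t%:E < tau)%E -> x <= - t -> phi g t x = 1.
Proof.
move=> g1 ttau xt; have x1 := ler_norm x; have t1 := ler_norm (- t).
rewrite normrN in t1; have t2 := normr_ge0 x; have t3 := normr_ge0 t.
rewrite -(@phi_eq g t (`|x| + `|t|) x)//; [|lra|lra].
rewrite (@eq_itg _ _ _ _ (fun=> 0)) ?itg_cst ?mul0r ?mulr0 ?addr0//; first by lra.
by move=> y /andP[_ yt]; rewrite (Kle0 cK K0) ?mul0r//; lra.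
Qed.

Lemma tau_near t0 : (t0%:E < tau)%E -> exists2 d, 0 < d &
  forall t, `|t - t0| < d -> (t%:E < tau)%E.
Proof.
move=> t0tau; have tT : `|t0| < `|t0| + 1 by rewrite ltrDl.
have [U [UT tU Utau]] := local_bound t0tau tT.
exists (U - t0) => [|t]; first by rewrite subr_gt0.
by rewrite ltr_norml => /andP[_ h]; apply: Utau; lra.
Qed.

(** The two derivatives of [phi], tested against a weight: in [t] for [g], and in
    [x], by parts, for [- g]. The same bracket appears in both. *)
Lemma phi_int_derive t0 T : (t0%:E < tau)%E -> `|t0| < T ->
  exists r : R -> R -> R,
  [/\ forall g, `|g| = 1 -> continuous (r g),
   forall g h, `|g| = 1 -> continuous h ->
    is_derive t0 (1:R) (fun t => itg (- T) t (fun x => phi g t x * h x))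
    (phi g t0 t0 * (h t0 - g * itg (- T) t0 (fun x => r g x * h x))) &
   forall g h dh, `|g| = 1 -> continuous h -> continuous dh ->
    (forall x, is_derive x (1:R) h (dh x)) ->
    itg (- T) t0 (fun x => phi (- g) t0 x * dh x) =
    phi (- g) t0 t0 * (h t0 - g * itg (- T) t0 (fun x => r g x * h x)) - h (- T)].
Proof.
move=> t0tau t0T; have [r [cr H1 H2 H3]] := phi_local t0tau t0T; exists r.
have [nt0T t0T'] : - T < t0 /\ t0 < T by move: t0T; rewrite ltr_norml => /andP.
split=> // [g h g1 ch|g h dh g1 ch cdh dhE].
- (* the integrand has to be continuous for all [t], including those past [tau] *)
  pose q t x := if (t%:E < tau)%E then phi g t x * h x else 0.
  have cq t : continuous (q t).
    have [ttau|nt] := boolP (t%:E < tau)%E; last first.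
      by rewrite /q (negbTE nt); exact: cont_cst.
    by rewrite /q ttau; apply: cont_mul => //; exact: phi_cont.
  have [n n0 ntau] := tau_near t0tau.
  have chb L := cont_bounded L ch.
  pose p x := - g * (r g x * phi g t0 t0) * h x.
  have cp : continuous p.
    apply: cont_mul => //; apply: cont_mul; first exact: cont_cst.
    by apply: cont_mul; [exact: cr|exact: cont_cst].
  have qE t : (t%:E < tau)%E -> q t = fun x => phi g t x * h x by rewrite /q => ->.
  have D : is_derive t0 (1:R) (fun t => itg (- T) t (q t)) (q t0 t0 + itg (- T) t0 p).
    apply: itg_param_derive_end => // e e0.
    + have [M M0 hM] := chb T; have e1 : 0 < e / M by rewrite divr_gt0.
      have [d d0 dH] := H1 g _ g1 e1.
      exists (Num.min d n) => [|t x]; first by rewrite lt_min d0.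
      rewrite lt_min => /andP[td /ntau ttau] /andP[x1 x2].
      have xT : - T <= x <= T by rewrite x1 (le_trans x2)// ltW.
      rewrite !qE// /p.
      rewrite (_ : _ - _ = (phi g t x - phi g t0 x - (t - t0) * (- g * (r g x * phi g t0 t0))) * h x); last by ring.
      rewrite normrM; apply: le_trans (ler_pM _ _ (dH t x td xT) (hM x _)) _ => //.
        by rewrite ler_norml.
      by rewrite mulrAC divfK// gt_eqF.
    + have e2 : 0 < e / 2 by rewrite divr_gt0.
      have [M M0 hM] := chb T; have e1 : 0 < e / 2 / M by rewrite !divr_gt0.
      have [d d0 dH] := H3 g _ g1 e1.
      pose P := `|phi g t0 t0| + 1; have P0 : 0 < P by rewrite ltr_wpDl.
      have e3 : 0 < e / 2 / P by rewrite !divr_gt0.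
      have /contP/(_ t0 _ e3)[d' d'0 dh'] := ch.
      have tT0 : 0 < T - `|t0| by rewrite subr_gt0.
      exists (Num.min (Num.min d n) (Num.min d' (T - `|t0|))) => [|t x].
        by rewrite !lt_min d0 n0 d'0.
      rewrite !lt_min => /andP[/andP[td /ntau ttau] _] /andP[/andP[xd _] /andP[xd' xT]].
      have xT' : `|x| <= T by have := ler_normD (x - t0) t0; rewrite subrK; lra.
      rewrite !qE//.
      rewrite (_ : _ - _ = (phi g t x - phi g t0 t0) * h x - phi g t0 t0 * (h t0 - h x)); last by ring.
      apply: le_trans (ler_normB _ _) _; rewrite !normrM [e]splitr; apply: lerD.
        apply: le_trans (ler_pM _ _ (ltW (dH t x td xd)) (hM x xT')) _ => //.
        by rewrite divfK// gt_eqF.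
      have h1 : `|phi g t0 t0| <= P by rewrite lerDl.
      have h2 : `|h t0 - h x| <= e / 2 / P by rewrite ltW// dh'// distrC.
      apply: le_trans (ler_pM _ _ h1 h2) _ => //.
      by rewrite mulrC divfK// gt_eqF.
  have E : q t0 t0 + itg (- T) t0 p =
      phi g t0 t0 * (h t0 - g * itg (- T) t0 (fun x => r g x * h x)).
    rewrite qE// /p mulrBr; congr (_ + _).
    have c1 : continuous (fun x => r g x * h x) by apply: cont_mul => //; exact: cr.
    rewrite mulrA -mulNr -itgZ//; apply: eq_itg => x _.
    by move: (phi _ _ _) (r _ _) (h x) => A B C; ring.
  rewrite -E; move/is_deriveE: D => D; apply/is_deriveE => e e0.
  have [d d0 dD] := D e e0.
  exists (Num.min d n) => [|t]; first by rewrite lt_min d0.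
  rewrite lt_min => /andP[td /ntau ttau]; have := dD t td.
  by rewrite !qE.
- have Ng1 : `|- g| = 1 by rewrite normrN.
  pose P := phi (- g) t0 t0.
  have dphi x : - T < x < t0 -> is_derive x (1:R) (phi (- g) t0) (g * P * r g x).
    move=> /andP[x1 x2].
    have D : is_derive x (1:R) (fun y => 1 + g * P * itg (- T) y (r g)) (g * P * r g x).
      have d1 := itg_derive (cr g g1) x1.
      have d2 := is_deriveD (is_derive_cst (1 : R) x 1) (is_deriveZ (g * P) d1).
      by rewrite add0r in d2; exact: d2.
    have E y : - T <= y <= T -> phi (- g) t0 y = 1 + g * P * itg (- T) y (r g).
      by move=> yT; rewrite H2// opprK !mulNr opprK.
    move/is_deriveE: D => D; apply/is_deriveE => e e0; have [d d0 dD] := D e e0.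
    exists (Num.min d (Num.min (x + T) (t0 - x))) => [|y].
      by rewrite !lt_min d0; lra.
    rewrite !lt_min => /and3P[yd y1 y2]; have := dD y yd.
    move: y1 y2; rewrite !ltr_norml => /andP[y1 _] /andP[_ y2].
    by rewrite !E//; apply/andP; split; lra.
  have cphi := phi_cont Ng1 t0tau.
  have cr' := cr g g1.
  have c1 : continuous (fun x => r g x * h x) by exact: cont_mul.
  have c2 : continuous (fun x => phi (- g) t0 x * dh x) by exact: cont_mul.
  have c3 : continuous (fun x => g * P * (r g x * h x)).
    by apply: cont_mul => //; exact: cont_cst.
  have F : itg (- T) t0 (fun x => phi (- g) t0 x * dh x + g * P * (r g x * h x)) =
           phi (- g) t0 t0 * h t0 - phi (- g) t0 (- T) * h (- T).
    apply: (@itg_FTC R (- T) t0 _ (fun x => phi (- g) t0 x * h x)).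
    - exact: ltW.
    - exact: cont_add.
    - exact: cont_mul.
    - move=> x xT; have d1 := dphi x xT; have d2 := dhE x.
      apply: (is_derive_eq (is_deriveM d1 d2)).
      by rewrite /GRing.scale/=; ring.
  rewrite itgD// itgZ// in F.
  rewrite (@phi_le (- g) t0 (- T)) ?mul1r// in F; last by lra.
  move: F; rewrite -/P; clearbody P; move: (itg _ _ _) (itg _ _ _) (h t0) (h (- T)) => B A C D F.
  have -> : A = P * C - D - g * P * B by rewrite -F; ring.
  by ring.
Qed.
End Family.

(** * Complex-valued functions and the exponential *)

Section Cplx.
Variable R : realType.
Implicit Types (z w d h c : R[i]) (x y a b t T L M e r : R) (f g : R -> R[i]).
Notation Re := complex.Re.
Notation Im := complex.Im.

Lemma cplx_ext z w : Re z = Re w -> Im z = Im w -> z = w.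
Proof. by case: z w => [a b] [c d] /= -> ->. Qed.
Lemma Re_add z w : Re (z + w) = Re z + Re w. Proof. by case: z; case: w. Qed.
Lemma Im_add z w : Im (z + w) = Im z + Im w. Proof. by case: z; case: w. Qed.
Lemma Re_opp z : Re (- z) = - Re z. Proof. by case: z. Qed.
Lemma Im_opp z : Im (- z) = - Im z. Proof. by case: z. Qed.
Lemma Re_conjc z : Re z^* = Re z. Proof. by case: z. Qed.
Lemma Im_conjc z : Im z^* = - Im z. Proof. by case: z. Qed.
Lemma Re_mul z w : Re (z * w) = Re z * Re w - Im z * Im w. Proof. by case: z; case: w. Qed.
Lemma Im_mul z w : Im (z * w) = Re z * Im w + Im z * Re w.
Proof. by case: z => a b; case: w => c d /=. Qed.
Definition partE := (Re_add, Im_add, Re_opp, Im_opp, Re_mul, Im_mul).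

(** A real-valued norm on the complex numbers, submultiplicative and equivalent to the
    modulus, which makes estimates reduce to those of real and imaginary parts. *)
Definition cN z : R := `|Re z| + `|Im z|.

Lemma cN_ge0 z : 0 <= cN z. Proof. by rewrite addr_ge0. Qed.
Lemma cN0 : cN 0 = 0. Proof. by rewrite /cN normr0 addr0. Qed.
Lemma cND z w : cN (z + w) <= cN z + cN w.
Proof. by rewrite /cN !partE addrACA; apply: lerD; exact: ler_normD. Qed.
Lemma cNN z : cN (- z) = cN z. Proof. by rewrite /cN !partE !normrN. Qed.
Lemma cNM z w : cN (z * w) <= cN z * cN w.
Proof.
rewrite /cN !partE.
apply: le_trans (lerD (ler_normB _ _) (ler_normD _ _)) _.
by rewrite !normrM le_eqVlt; apply/orP; left; apply/eqP; ring.
Qed.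
Lemma cN_real x : cN x%:C = `|x|. Proof. by rewrite /cN/= normr0 addr0. Qed.
Lemma cN_i : cN 'i = 1. Proof. by rewrite /cN/= normr0 normr1 add0r. Qed.
Lemma Re_le_cN z : `|Re z| <= cN z. Proof. by rewrite lerDl. Qed.
Lemma Im_le_cN z : `|Im z| <= cN z. Proof. by rewrite lerDr. Qed.
Lemma cN_eq0 z : cN z = 0 -> z = 0.
Proof.
by move/eqP; rewrite paddr_eq0// !normr_eq0 => /andP[/eqP h1 /eqP h2]; exact: cplx_ext.
Qed.

Lemma norm_le_cN z : `|z| <= (cN z)%:C.
Proof.
have -> : z = (Re z)%:C + 'i * (Im z)%:C.
  by apply: cplx_ext; rewrite !partE/=; ring.
apply: le_trans (ler_normD _ _) _.
have n1 x : `|x%:C| = `|x|%:C by rewrite normc_def/= expr0n/= addr0 sqrtr_sqr.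
have n2 x : `|'i * x%:C| = `|x|%:C.
  have -> : 'i * x%:C = 0 +i* x by apply: cplx_ext; rewrite !partE/=; ring.
  by rewrite normc_def/= expr0n/= add0r sqrtr_sqr.
rewrite n2 n1 -rmorphD/= lecR /cN !partE/=.
by rewrite !(mul0r, mul1r, addr0, subr0, add0r).
Qed.

Lemma cN_le_norm z : (cN z)%:C <= 2 * `|z|.
Proof.
rewrite normc_def -[2](rmorph_nat (real_complex R)) -rmorphM/= lecR /cN.
have h x y : `|x| <= Num.sqrt (x ^+ 2 + y ^+ 2).
  by rewrite -sqrtr_sqr ler_sqrt ?addr_ge0 ?sqr_ge0// lerDl sqr_ge0.
have := h (Re z) (Im z); have := h (Im z) (Re z); rewrite [X in Num.sqrt X]addrC; lra.
Qed.

Lemma cderivable_of (F : R[i] -> R[i]) z d :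
  (forall e, 0 < e -> exists2 r, 0 < r & forall h, cN h < r ->
    cN (F (z + h) - F z - d * h) <= e * cN h) ->
  derivable (F : R[i]^o -> R[i]^o) z 1.
Proof.
move=> H; apply/cvg_ex; exists (d : R[i]^o); apply/cvgrPdist_le => e e0.
have [er e'0] : e = (Re e)%:C /\ 0 < Re e.
  by move: e0; case: e => p q; rewrite ltcE/= => /andP[/eqP-> p0]; split.
have e2 : 0 < Re e / 2 by rewrite divr_gt0.
have [r r0 rH] := H _ e2.
have r20 : 0 < (r / 2)%:C by rewrite ltcR divr_gt0.
near=> h.
have h0 : h != 0 by near: h; exact: nbhs_dnbhs_neq.
have hr : `|h| < (r / 2)%:C by near: h; apply: dnbhs0_lt.
have hN : cN h < r.
  rewrite -ltcR; apply: le_lt_trans (cN_le_norm h) _.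
  rewrite (_ : r%:C = 2 * (r / 2)%:C); first by rewrite ltr_pM2l.
  by rewrite -[2](rmorph_nat (real_complex R)) -rmorphM/= mulrC divfK// pnatr_eq0.
have := rH h hN => hh.
have -> : d - h^-1 *: (F (h *: 1 + z) - F z) = - (h^-1 * (F (z + h) - F z - d * h)).
  have -> : h *: (1 : R[i]^o) + z = z + h by rewrite addrC; congr (_ + _); exact: mulr1.
  change (d - h^-1 * (F (z + h) - F z) = - (h^-1 * (F (z + h) - F z - d * h))).
  by rewrite [in RHS]mulrBr [h^-1 * (d * h)]mulrCA mulVf// mulr1 opprB.
rewrite normrN normrM normfV ler_pdivrMl ?normr_gt0//.
apply: le_trans (norm_le_cN _) _.
have le1 : (cN (F (z + h) - F z - d * h))%:C <= ((Re e / 2) * cN h)%:C by rewrite lecR.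
apply: le_trans le1 _; rewrite rmorphM/=.
apply: le_trans (ler_wpM2l _ (cN_le_norm h)) _; first by rewrite lecR ltW.
rewrite mulrA [X in _ <= X]mulrC ler_wpM2r//.
have E : (Re e / 2)%:C * 2 = (Re e)%:C :> R[i].
  by rewrite -[X in _%:C * X](rmorph_nat (real_complex R)) -rmorphM/= divfK// pnatr_eq0.
by rewrite -er in E; rewrite le_eqVlt; apply/orP; left; apply/eqP; exact: E.
Unshelve. all: by end_near. Qed.

(** The difference quotient at [z] in direction [h] is minus the one at [- z] in
    direction [- h]. *)
Lemma derivable_reflect (F : R[i] -> R[i]) z : derivable (F : R[i]^o -> R[i]^o) (- z) 1 ->
  derivable ((fun w => F (- w)) : R[i]^o -> R[i]^o) z 1.
Proof.
move=> /cvg_ex[d /cvgrPdist_le H]; apply/cvg_ex; exists (- d); apply/cvgrPdist_le => e e0.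
have := H e e0; rewrite /dnbhs !near_withinE => /nbhs_ballP[r r0 rH].
apply/nbhs_ballP; exists r => // h rh h0.
have rh' : ball 0 r (- h) by move: rh; rewrite -!ball_normE/= !sub0r opprK normrN.
have := rH (- h) rh'; rewrite oppr_eq0 => /(_ h0).
have sA w : w *: (1 : R[i]^o) = w by exact: mulr1.
rewrite /= !sA.
change (`|d - (- h)^-1 * (F (- h + - z) - F (- z))| <= e ->
  `|- d - h^-1 * (F (- (h + z)) - F (- z))| <= e).
by rewrite invrN mulNr opprK opprD -[X in _ -> `|X| <= _]opprK normrN opprB opprK addrC.
Qed.

Definition ccont f := continuous (fun x => Re (f x)) /\ continuous (fun x => Im (f x)).
Definition citg a b f : R[i] :=
  itg a b (fun x => Re (f x)) +i* itg a b (fun x => Im (f x)).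
(** Complex-valued functions of a real variable are handled through their real and
    imaginary parts, as in the definition of [cderive]. *)
Definition cder f x d :=
  is_derive x (1:R) (fun y => Re (f y)) (Re d) /\ is_derive x (1:R) (fun y => Im (f y)) (Im d).

Lemma eq_ccont f g : f =1 g -> ccont f -> ccont g.
Proof. by move=> /funext ->. Qed.
Lemma ccont_cst c : ccont (fun=> c). Proof. by split; exact: cont_cst. Qed.
Lemma ccontD f g : ccont f -> ccont g -> ccont (fun x => f x + g x).
Proof.
move=> [f1 f2] [g1 g2]; split; under eq_fun do rewrite partE; exact: cont_add.
Qed.
Lemma cont_opp (u : R -> R) : continuous u -> continuous (fun x => - u x).
Proof. by move=> cu x; apply: cvgN; exact: cu. Qed.
Lemma ccontM f g : ccont f -> ccont g -> ccont (fun x => f x * g x).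
Proof.
move=> [f1 f2] [g1 g2]; split; under eq_fun do rewrite partE; apply: cont_add.
- exact: cont_mul.
- by apply: cont_opp; exact: cont_mul.
- exact: cont_mul.
- exact: cont_mul.
Qed.
Lemma ccontZ c f : ccont f -> ccont (fun x => c * f x).
Proof. by apply: ccontM; exact: ccont_cst. Qed.
Lemma ccontN f : ccont f -> ccont (fun x => - f x).
Proof. by move=> cf; apply: eq_ccont (ccontZ (-1) cf) => x; rewrite mulN1r. Qed.
Lemma ccontB f g : ccont f -> ccont g -> ccont (fun x => f x - g x).
Proof. by move=> cf cg; apply: ccontD => //; exact: ccontN. Qed.
Lemma ccont_real (u : R -> R) : continuous u -> ccont (fun x => (u x)%:C).
Proof. by move=> cu; split=> //; exact: cont_cst. Qed.

Lemma eq_citg a b f g : (forall x, a <= x <= b -> f x = g x) -> citg a b f = citg a b g.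
Proof. by move=> fg; congr (_ +i* _); apply: eq_itg => x xab; rewrite fg. Qed.
Lemma citgD a b f g : ccont f -> ccont g ->
  citg a b (fun x => f x + g x) = citg a b f + citg a b g.
Proof.
move=> [f1 f2] [g1 g2]; apply: cplx_ext; rewrite /citg/=.
  by rewrite -itgD//; apply: eq_itg => x _; rewrite partE.
by rewrite -itgD//; apply: eq_itg => x _; rewrite partE.
Qed.
Lemma citgZ a b c f : ccont f -> citg a b (fun x => c * f x) = c * citg a b f.
Proof.
move=> [f1 f2]; apply: cplx_ext; rewrite /citg partE/=.
  rewrite -!itgZ// -itgB; [|by apply: cont_mul => //; exact: cont_cst..].
  by apply: eq_itg => x _; rewrite partE.
rewrite -!itgZ// -itgD; [|by apply: cont_mul => //; exact: cont_cst..].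
by apply: eq_itg => x _; rewrite partE.
Qed.
Lemma citgB a b f g : ccont f -> ccont g ->
  citg a b (fun x => f x - g x) = citg a b f - citg a b g.
Proof.
move=> cf cg; rewrite -mulN1r -citgZ// -citgD//; last exact: ccontZ.
by apply: eq_citg => x _; rewrite mulN1r.
Qed.
Lemma citg_chasles a b e f : ccont f -> a <= b -> b <= e ->
  citg a e f = citg a b f + citg b e f.
Proof.
move=> [f1 f2] ab be; apply: cplx_ext; rewrite /citg partE/=; exact: itg_chasles.
Qed.
Lemma cN_citg a b f M : ccont f -> a <= b -> (forall x, a <= x <= b -> cN (f x) <= M) ->
  cN (citg a b f) <= 2 * M * (b - a).
Proof.
move=> [f1 f2] ab fM; rewrite /cN/= -mulrA [leRHS]mulr_natl mulr2n; apply: lerD.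
  by apply: itg_bound => // x xab; apply: le_trans (fM x xab); exact: Re_le_cN.
by apply: itg_bound => // x xab; apply: le_trans (fM x xab); exact: Im_le_cN.
Qed.

Lemma cder_eq f x d d' : d = d' -> cder f x d -> cder f x d'. Proof. by move=> ->. Qed.
Lemma eq_cder f g x d : f =1 g -> cder f x d -> cder g x d.
Proof. by move=> /funext ->. Qed.
Lemma cder_cst c x : cder (fun=> c) x 0.
Proof. by split; exact: is_derive_cst. Qed.
Lemma cderD f g x d d' : cder f x d -> cder g x d' -> cder (fun y => f y + g y) x (d + d').
Proof.
move=> [f1 f2] [g1 g2]; split; rewrite partE; under eq_fun do rewrite partE.
  exact: is_deriveD f1 g1.
exact: is_deriveD f2 g2.
Qed.
Lemma cderM f g x d d' : cder f x d -> cder g x d' ->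
  cder (fun y => f y * g y) x (d * g x + f x * d').
Proof.
move=> [f1 f2] [g1 g2]; split; under eq_fun do rewrite partE.
  apply: (is_derive_eq (is_deriveB (is_deriveM f1 g1) (is_deriveM f2 g2))).
  by rewrite !partE /GRing.scale/=; ring.
apply: (is_derive_eq (is_deriveD (is_deriveM f1 g2) (is_deriveM f2 g1))).
by rewrite !partE /GRing.scale/=; ring.
Qed.
Lemma cderZ c f x d : cder f x d -> cder (fun y => c * f y) x (c * d).
Proof.
by move=> fd; apply: cder_eq (cderM (cder_cst c x) fd); rewrite mul0r add0r.
Qed.
Lemma cder_real (u : R -> R) x e : is_derive x (1:R) u e -> cder (fun y => (u y)%:C) x e%:C.
Proof. by move=> du; split=> //; exact: is_derive_cst. Qed.
Lemma citg_FTC a b f F : a <= b -> ccont f -> ccont F ->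
  (forall x, a < x < b -> cder F x (f x)) -> citg a b f = F b - F a.
Proof.
move=> ab [f1 f2] [F1 F2] dF; apply: cplx_ext; rewrite /citg !partE/=.
  by apply: (itg_FTC (F := fun x => Re (F x))) => // x xab; have [] := dF x xab.
by apply: (itg_FTC (F := fun x => Im (F x))) => // x xab; have [] := dF x xab.
Qed.
Lemma cder_ccont f (f' : R -> R[i]) : (forall x, cder f x (f' x)) -> ccont f.
Proof.
move=> df; split=> x; apply: differentiable_continuous; apply/derivable1_diffP.
  by have [[]] := df x.
by have [_ []] := df x.
Qed.

(** Here [f x] is, up to sign, the integral of [f'] between [0] and [x]. *)
Lemma cN_mean f (f' : R -> R[i]) L M x : (forall y, cder f y (f' y)) -> ccont f' ->
  f 0 = 0 -> (forall y, `|y| <= L -> cN (f' y) <= M) -> `|x| <= L ->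
  cN (f x) <= 2 * M * L.
Proof.
move=> df cf' f0 fM xL; have cf := cder_ccont df.
have L0 : 0 <= L by apply: le_trans xL.
have M0 : 0 <= M by apply: le_trans (cN_ge0 _) (fM 0 _); rewrite normr0.
have [x0|x0] := leP 0 x.
  have -> : f x = citg 0 x f' by rewrite (citg_FTC x0 cf' cf) ?f0 ?subr0.
  apply: le_trans (cN_citg (M := M) cf' x0 _) _.
    by move=> y /andP[y0 yx]; apply: fM; rewrite ger0_norm//; rewrite ger0_norm// in xL; lra.
  by rewrite subr0 ler_wpM2l ?mulr_ge0// (le_trans (ler_norm x)).
have -> : f x = - citg x 0 f' by rewrite (citg_FTC (ltW x0) cf' cf) ?f0 ?sub0r ?opprK.
rewrite cNN; apply: le_trans (cN_citg (M := M) cf' (ltW x0) _) _.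
  by move=> y /andP[yx y0]; apply: fM; rewrite ler0_norm//; rewrite ltr0_norm// in xL; lra.
by rewrite sub0r ler_wpM2l ?mulr_ge0//; rewrite ltr0_norm// in xL.
Qed.

Lemma cexpD z w : cexp (z + w) = cexp z * cexp w.
Proof.
by apply: cplx_ext; rewrite /cexp !partE/= ?partE/= expRD cosD sinD; ring.
Qed.
Lemma cexp0 : cexp (0 : R[i]) = 1.
Proof. by apply: cplx_ext; rewrite /cexp !partE/= expR0 cos0 sin0; ring. Qed.
Lemma Re_expi z x : Re (expi z x) = expR (- Im z * x) * cos (Re z * x).
Proof.
rewrite /expi /cexp /= mul0r subr0.
by congr (expR _ * cos _); rewrite !partE/=; ring.
Qed.
Lemma Im_expi z x : Im (expi z x) = expR (- Im z * x) * sin (Re z * x).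
Proof.
rewrite /expi /cexp /= mul0r addr0.
by congr (expR _ * sin _); rewrite !partE/=; ring.
Qed.
Lemma expiDl z w x : expi (z + w) x = expi z x * expi w x.
Proof. by rewrite /expi -cexpD mulrDr mulrDl. Qed.
Lemma expiDr z x y : expi z (x + y) = expi z x * expi z y.
Proof. by rewrite /expi -cexpD -mulrDr -rmorphD. Qed.
Lemma expi0 z : expi z 0 = 1.
Proof. by rewrite /expi rmorph0 mulr0 cexp0. Qed.
Lemma expiN z x : expi (- z) x = expi z (- x).
Proof. by rewrite /expi rmorphN/= mulrN mulNr mulrN. Qed.
Lemma conj_expi z x : (expi z^* x)^* = expi (- z) x.
Proof.
apply: cplx_ext; rewrite ?Re_conjc ?Im_conjc ?Re_expi ?Im_expi ?Re_conjc ?Im_conjc ?Re_opp ?Im_opp.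
  by rewrite [- Re z * x]mulNr cosN.
by rewrite [- Re z * x]mulNr sinN mulrN.
Qed.
Lemma cN_expi z x : cN (expi z x) <= 2 * expR (- Im z * x).
Proof.
rewrite /cN Re_expi Im_expi !normrM gtr0_norm ?expR_gt0// -mulrDr mulrC.
rewrite ler_wpM2r ?expR_ge0//; apply: lerD; rewrite ler_norml ?cos_geN1 ?cos_le1//.
by rewrite sin_geN1 sin_le1.
Qed.
Lemma cder_expi z x : cder (expi z) x ('i * z * expi z x).
Proof.
have lin k : is_derive x (1:R) (fun y => k * y) k.
  by have := is_deriveZ k (is_derive_id x (1:R)); rewrite /GRing.scale/= mulr1.
have e1 := is_derive1_comp (is_derive_expR (- Im z * x)) (lin (- Im z)).
have e2 := is_derive1_comp (is_derive_cos (Re z * x)) (lin (Re z)).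
have e3 := is_derive1_comp (is_derive_sin (Re z * x)) (lin (Re z)).
split; under eq_fun do rewrite ?Re_expi ?Im_expi.
  apply: (is_derive_eq (is_deriveM e1 e2)).
  by rewrite Re_mul Re_expi Im_expi !partE /GRing.scale/=; ring.
apply: (is_derive_eq (is_deriveM e1 e3)).
by rewrite Im_mul Re_expi Im_expi !partE /GRing.scale/=; ring.
Qed.
Lemma ccont_expi z : ccont (expi z).
Proof. by apply: cder_ccont => x; exact: cder_expi. Qed.

(** Two applications of [cN_mean], first to [expi h y - 1]. *)
Lemma expi_taylor L : 0 <= L -> exists2 C, 0 < C & forall h x, cN h <= 1 -> `|x| <= L ->
  cN (expi h x - 1 - 'i * h * x%:C) <= C * cN h ^+ 2.
Proof.
move=> L0; exists (8 * expR L * L ^+ 2 + 1) => [|h x h1 xL].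
  by rewrite ltr_wpDl// !mulr_ge0 ?expR_ge0 ?sqr_ge0.
have cih : cN ('i * h) <= cN h.
  by apply: le_trans (cNM _ _) _; rewrite cN_i mul1r.
have B1 y : `|y| <= L -> cN (expi h y - 1) <= 2 * (cN h * (2 * expR L)) * L.
  apply: (@cN_mean (fun y => expi h y - 1) (fun y => 'i * h * expi h y)).
  - by move=> w; apply: cder_eq (cderD (cder_expi h w) (cder_cst (-1) w)); rewrite addr0.
  - by apply: ccontZ; exact: ccont_expi.
  - by rewrite expi0 subrr.
  - move=> w wL; apply: le_trans (cNM _ _) _; apply: ler_pM; rewrite ?cN_ge0//.
    apply: le_trans (cN_expi _ _) _; rewrite ler_pM2l// ler_expR.
    apply: le_trans (ler_norm _) _; rewrite normrM normrN -[leRHS]mul1r.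
    by apply: ler_pM => //; apply: le_trans (Im_le_cN h) h1.
have B2 : cN (expi h x - 1 - 'i * h * x%:C) <=
    2 * (cN h * (2 * (cN h * (2 * expR L)) * L)) * L.
  apply: (@cN_mean (fun y => expi h y - 1 - 'i * h * y%:C)
                   (fun y => 'i * h * (expi h y - 1))) xL.
  - move=> w; have d1 := cderD (cder_expi h w) (cder_cst (-1) w).
    have d2 := cderZ ('i * h) (cder_real (is_derive_id w (1:R))).
    have d3 := cderD d1 (cderZ (-1) d2).
    have := eq_cder (g := fun y => expi h y - 1 - 'i * h * y%:C) _ d3.
    move=> /(_ _)/cder_eq; apply; last by move=> y; rewrite mulN1r.
    by rewrite addr0 mulN1r mulrBr mulr1.
  - by apply: ccontZ; apply: ccontB; [exact: ccont_expi|exact: ccont_cst].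
  - by rewrite expi0 subrr rmorph0 mulr0 subr0.
  - move=> w wL; apply: le_trans (cNM _ _) _; apply: ler_pM; rewrite ?cN_ge0//.
    exact: B1.
apply: le_trans B2 _; rewrite [leRHS]mulrDl.
rewrite (_ : 2 * _ * L = 8 * expR L * L ^+ 2 * cN h ^+ 2); last by ring.
by rewrite lerDl mul1r sqr_ge0.
Qed.

(** A quadratic remainder is enough for complex differentiability. *)
Lemma derivable_quad (F : R[i] -> R[i]) z d C : 0 < C ->
  (forall h, cN h <= 1 -> cN (F (z + h) - F z - d * h) <= C * cN h ^+ 2) ->
  derivable (F : R[i]^o -> R[i]^o) z 1.
Proof.
move=> C0 H; apply: (@cderivable_of F z d) => e e0.
exists (Num.min 1 (e / C)) => [|h]; first by rewrite lt_min ltr01 divr_gt0.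
rewrite lt_min => /andP[/ltW h1]; rewrite ltr_pdivlMr// => he.
apply: le_trans (H h h1) _; rewrite expr2 mulrA ler_wpM2r ?cN_ge0//.
by rewrite mulrC ltW.
Qed.

Lemma derivable_expi x z : derivable ((fun w => expi w x) : R[i]^o -> R[i]^o) z 1.
Proof.
have [C C0 H] := expi_taylor (normr_ge0 x).
have D0 : 0 < cN (expi z x) * C + 1 by rewrite ltr_wpDl// mulr_ge0 ?cN_ge0// ltW.
apply: (@derivable_quad _ z (expi z x * ('i * x%:C)) _ D0) => h h1.
rewrite (_ : _ - _ = expi z x * (expi h x - 1 - 'i * h * x%:C)); last first.
  by rewrite expiDl; ring.
apply: le_trans (cNM _ _) _; rewrite [leRHS]mulrDl mul1r -[_ * C * _]mulrA.
apply: ler_wpDr; first exact: sqr_ge0.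
by apply: ler_wpM2l; [exact: cN_ge0|exact: H].
Qed.

(** Differentiation under the integral sign, with the quadratic remainder of
    [expi_taylor] bounded uniformly on the interval. *)
Lemma derivable_citg (u : R -> R) a b z : continuous u -> a <= b ->
  derivable ((fun w => citg a b (fun x => (u x)%:C * expi w x)) : R[i]^o -> R[i]^o) z 1.
Proof.
move=> cu ab; pose L := `|a| + `|b|; have L0 : 0 <= L by rewrite addr_ge0.
have [C C0 H] := expi_taylor L0.
have [M M0 uM] := cont_bounded L cu.
pose B := M * (2 * expR (`|Im z| * L)).
have ce w : ccont (fun x => (u x)%:C * expi w x).
  by apply: ccontM; [exact: ccont_real|exact: ccont_expi].
have B0 : 0 <= B by rewrite !mulr_ge0 ?expR_ge0 ?ltW.
have D0 : 0 < 2 * (B * C) * (b - a) + 1.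
  by rewrite ltr_wpDl// !mulr_ge0 ?subr_ge0// ltW.
have cx : ccont (fun x => (u x)%:C * expi z x * ('i * x%:C)).
  apply: ccontM => //; apply: ccontZ; apply: ccont_real => y; exact: cvg_id.
apply: (@derivable_quad _ z (citg a b (fun x => (u x)%:C * expi z x * ('i * x%:C))) _ D0) => h h1.
rewrite [X in _ - X]mulrC -citgZ// -!citgB//; [|by apply: ccontB|by apply: ccontZ].
apply: le_trans (cN_citg (M := B * C * cN h ^+ 2) _ ab _) _.
- by apply: ccontB; [exact: ccontB|exact: ccontZ].
- move=> x xab; have xL := norm_le_between xab.
  rewrite (_ : _ - _ = (u x)%:C * expi z x * (expi h x - 1 - 'i * h * x%:C)); last first.
    by rewrite expiDl; ring.
  rewrite -[B * C * _]mulrA; apply: le_trans (cNM _ _) _; apply: ler_pM; rewrite ?cN_ge0//; last exact: H.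
  apply: le_trans (cNM _ _) _; apply: ler_pM; rewrite ?cN_ge0//; first by rewrite cN_real; exact: uM.
  apply: le_trans (cN_expi _ _) _; rewrite ler_pM2l// ler_expR.
  by apply: le_trans (ler_norm _) _; rewrite normrM normrN ler_wpM2l.
- rewrite [leRHS]mulrDl mul1r; apply: ler_wpDr; first exact: sqr_ge0.
  by rewrite le_eqVlt; apply/orP; left; apply/eqP; ring.
Qed.

End Cplx.

(** * Transforms over a half-line *)

Section HalfLine.
Variable R : realType.
Notation mu := (@lebesgue_measure R).
Implicit Types (a x y t T L M e X C D : R) (f : R -> R).
Notation Re := complex.Re.
Notation Im := complex.Im.

Lemma cvg_expN D : 0 < D -> expR (- D * x) @[x --> +oo] --> (0 : R).
Proof.
move=> D0.
have h : D * x @[x --> +oo] --> +oo by apply: gt0_cvgMry; [exact: D0|exact: cvg_id].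
have := cvg_comp _ _ h (@cvgr_expR R).
by apply: cvg_trans; apply: near_eq_cvg; apply: nearW => x /=; rewrite mulNr.
Qed.

Lemma is_derive_expN C D x : D != 0 ->
  is_derive x (1:R) (fun y => - (C / D) * expR (- D * y)) (C * expR (- D * x)).
Proof.
move=> D0.
have D0' := D0; have lin : is_derive x (1:R) (fun y => - D * y) (- D).
  by have := is_deriveZ (- D) (is_derive_id x (1:R)); rewrite /GRing.scale/= mulr1.
have d := is_deriveZ (- (C / D)) (is_derive1_comp (is_derive_expR (- D * x)) lin).
apply: (is_derive_eq d); rewrite /GRing.scale/=.
rewrite -[in RHS](divfK D0' C).
by move: (expR _) (C / D) => u v; ring.
Qed.

Lemma cont_expN C D : continuous (fun y => C * expR (- D * y)).
Proof.
apply: cont_mul; first exact: cont_cst.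
move=> x; apply: (continuous_comp (f := fun z => - D * z) (g := expR)); last exact: continuous_expR.
by apply: cvgM; [exact: cvg_cst|exact: cvg_id].
Qed.

Lemma integral_expN C D a : 0 <= C -> 0 < D ->
  (\int[mu]_(x in `[a, +oo[) (C * expR (- D * x))%:E = (C / D * expR (- D * a))%:E)%E.
Proof.
move=> C0 D0; have D0' : D != 0 by rewrite gt_eqF.
pose F y := - (C / D) * expR (- D * y).
have dF x : is_derive x (1:R) F (C * expR (- D * x)) by exact: is_derive_expN.
have cF : continuous F by exact: cont_expN.
rewrite (@ge0_continuous_FTC2y R _ F a 0).
- by rewrite /F -EFinB sub0r mulNr opprK.
- by move=> x _; rewrite mulr_ge0 ?expR_ge0.
- by apply: continuous_subspaceT; exact: cont_expN.
- rewrite -(mulr0 (- (C / D))); apply: cvgM; [exact: cvg_cst|exact: cvg_expN].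
- by move=> x _; have [] := dF x.
- by apply: cvg_at_right_filter; exact: cF.
- by move=> x _; rewrite derive1E; have [_ ->] := dF x.
Qed.

Section Tail.
Variables (f : R -> R) (C D a : R).
Hypothesis cf : continuous f.
Hypothesis C0 : 0 <= C.
Hypothesis D0 : 0 < D.
Hypothesis fC : forall x, a <= x -> `|f x| <= C * expR (- D * x).

Lemma tail_majorant b : mu.-integrable `[b, +oo[ (fun x => (C * expR (- D * x))%:E).
Proof.
apply/integrableP; split.
  apply/measurable_realfun.measurable_EFinP; apply: measurable_funTS.
  exact: measurable_realfun.continuous_measurable_fun (@cont_expN C D).
under eq_integral do rewrite abse_EFin ger0_norm ?mulr_ge0 ?expR_ge0//.
by rewrite integral_expN// ltry.
Qed.

Lemma tail_integrable b : a <= b -> mu.-integrable `[b, +oo[ (fun x => (f x)%:E).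
Proof.
move=> ab; apply: le_integrable (tail_majorant b) => //.
  apply/measurable_realfun.measurable_EFinP; apply: measurable_funTS.
  exact: measurable_realfun.continuous_measurable_fun.
move=> x /=; rewrite in_itv/= andbT => bx.
by rewrite lee_fin (le_trans (fC (le_trans ab bx)))// ler_norm.
Qed.

Lemma tail_integrable_oo b : a <= b -> mu.-integrable `]b, +oo[ (fun x => (f x)%:E).
Proof.
move=> ab; apply: integrableS (tail_integrable ab) => //.
by move=> x /=; rewrite !in_itv/= !andbT => /ltW.
Qed.

Lemma tail_bound X : a <= X ->
  `|\int[mu]_(x in `]a, +oo[) f x - itg a X f| <= C / D * expR (- D * X).
Proof.
move=> aX.
have ia := tail_integrable (lexx a).
have -> : \int[mu]_(x in `]a, +oo[) f x = \int[mu]_(x in `[a, +oo[) f x.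
  by rewrite Rintegral_itv_obnd_cbnd//; exact: tail_integrable_oo.
rewrite /itg Rintegral_itvB//.
have iX := tail_integrable_oo aX.
rewrite (le_trans (le_normr_Rintegral _ _))//.
apply: (@le_trans _ _ (\int[mu]_(x in `]X, +oo[) (C * expR (- D * x)))).
  apply: le_Rintegral => //.
  - exact: integrable_norm iX.
  - apply: integrableS (tail_majorant X) => //.
    by move=> x /=; rewrite !in_itv/= !andbT => /ltW.
  - by move=> x /=; rewrite in_itv/= andbT => Xx; apply: fC; rewrite (le_trans aX)// ltW.
rewrite Rintegral_itv_obnd_cbnd; last first.
  apply: integrableS (tail_majorant X) => //.
  by move=> x /=; rewrite !in_itv/= !andbT => /ltW.
by rewrite /Rintegral integral_expN.
Qed.

End Tail.
Lemma ctail (f : R -> R[i]) C D a : ccont f -> 0 <= C -> 0 < D ->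
  (forall x, a <= x -> cN (f x) <= C * expR (- D * x)) ->
  cintegrable `]a, +oo[ f /\
  forall X, a <= X -> cN (cintegral `]a, +oo[ f - citg a X f) <= 2 * (C / D) * expR (- D * X).
Proof.
move=> [f1 f2] C0 D0 fC.
have h1 x : a <= x -> `|Re (f x)| <= C * expR (- D * x).
  by move=> ax; apply: le_trans (Re_le_cN _) (fC x ax).
have h2 x : a <= x -> `|Im (f x)| <= C * expR (- D * x).
  by move=> ax; apply: le_trans (Im_le_cN _) (fC x ax).
split=> [|X aX].
  by split; [exact: (tail_integrable_oo f1 C0 D0 h1)|exact: (tail_integrable_oo f2 C0 D0 h2)].
rewrite /cN !partE /cintegral /citg/=.
have b1 := tail_bound f1 C0 D0 h1 aX; have b2 := tail_bound f2 C0 D0 h2 aX.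
by apply: le_trans (lerD b1 b2) _; rewrite -(mulrA 2) mulr_natl mulr2n.
Qed.

(** Decay like [expR (- D * X)], the form of all the error terms in the passage from
    [[- T, X]] to the half-line. *)
Definition small T D (u : R -> R[i]) :=
  exists B, forall X, T <= X -> cN (u X) <= B * expR (- D * X).

Lemma smallD T D u v : small T D u -> small T D v -> small T D (fun X => u X + v X).
Proof.
move=> [B uB] [B' vB]; exists (B + B') => X TX; apply: le_trans (cND _ _) _.
by rewrite mulrDl; apply: lerD; [exact: uB|exact: vB].
Qed.

Lemma smallZ T D c u : small T D u -> small T D (fun X => c * u X).
Proof.
move=> [B uB]; exists (cN c * B) => X TX; apply: le_trans (cNM _ _) _.
by rewrite -mulrA ler_wpM2l ?cN_ge0// uB.
Qed.

Lemma small_cst T D (d : R[i]) : 0 < D -> small T D (fun=> d) -> d = 0.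
Proof.
move=> D0 [B dB]; apply: cN_eq0; apply/eqP; rewrite eq_le cN_ge0 andbT.
apply/ler_addgt0Pr => e e0; rewrite add0r.
have h : B * expR (- D * X) @[X --> +oo] --> (0 : R).
  by rewrite -(mulr0 B); apply: cvgM; [exact: cvg_cst|exact: cvg_expN].
have /cvgrPdist_le/(_ _ e0) := h.
move=> [A [Ar HA]]; pose X := Num.max T (A + 1).
have AX : A < X by rewrite /X lt_max ltrDl ltr01 orbT.
have := HA X AX; rewrite sub0r normrN => hX.
have TX : T <= X by rewrite /X le_max lexx.
by apply: le_trans (dB X TX) _; apply: le_trans (ler_norm _) hX.
Qed.

Lemma itg_shift a b x f : a <= b -> continuous f ->
  itg a b (fun y => f (x + y)) = itg (x + a) (x + b) f.
Proof.
move=> ab cf; pose F u := itg (x + a - 1) u f.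
have dF u : x + a <= u -> is_derive u (1:R) F (f u).
  by move=> au; apply: itg_derive => //; lra.
have cF : continuous F by exact: itg_cont.
have cs : continuous (fun y => f (x + y)) by exact: cont_shift.
transitivity (F (x + b) - F (x + a)).
  apply: (@itg_FTC _ a b _ (fun y => F (x + y)) ab cs); first exact: cont_shift.
  move=> u /andP[au _]; under eq_fun do rewrite addrC.
  by apply: is_derive_shiftr; rewrite addrC; apply: dF; lra.
symmetry; apply: itg_FTC => //; first by rewrite lerD2l.
by move=> u /andP[au _]; apply: dF; exact: ltW.
Qed.

Lemma citg_shift a b x (f : R -> R[i]) : a <= b -> ccont f ->
  citg a b (fun y => f (x + y)) = citg (x + a) (x + b) f.
Proof.
move=> ab [f1 f2]; rewrite /citg.
by rewrite (itg_shift x ab f1) (itg_shift x ab f2).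
Qed.

Lemma Re_realM x (w : R[i]) : Re (x%:C * w) = x * Re w.
Proof. by rewrite Re_mul/= mul0r subr0. Qed.
Lemma Im_realM x (w : R[i]) : Im (x%:C * w) = x * Im w.
Proof. by rewrite Im_mul/= mul0r addr0. Qed.
Lemma Re_citg a b (f : R -> R[i]) : Re (citg a b f) = itg a b (fun x => Re (f x)).
Proof. by []. Qed.
Lemma Im_citg a b (f : R -> R[i]) : Im (citg a b f) = itg a b (fun x => Im (f x)).
Proof. by []. Qed.

Lemma ccont_shift (f : R -> R[i]) x : ccont f -> ccont (fun y => f (x + y)).
Proof.
by move=> [k1 k2]; split; [exact: (cont_shift k1 (x := x))|exact: (cont_shift k2 (x := x))].
Qed.

Lemma citg0 a b : citg a b (fun=> 0 : R[i]) = 0.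
Proof.
transitivity (0 * citg a b (fun=> 0 : R[i])); last by rewrite mul0r.
by rewrite -citgZ; [apply: eq_citg => x _; rewrite mul0r|exact: ccont_cst].
Qed.

Section Laplace.
Variable K : R -> R.
Hypothesis cK : continuous K.
Hypothesis K0 : forall x, x < 0 -> K x = 0.
Variables (c C1 : R).
Hypothesis c0 : 0 < c.
Hypothesis C10 : 0 <= C1.
Hypothesis KC : forall x, `|K x| <= C1 * expR (c * x).
Variable z : R[i].
Hypothesis cz : c < Im z.
Let D := Im z - c.
Let e := expi z.

Let D0 : 0 < D. Proof. by rewrite subr_gt0. Qed.

Lemma cN_e_exp C u x : 0 <= C -> `|u| <= C * expR (c * x) ->
  cN (u%:C * e x) <= 2 * C * expR (- D * x).
Proof.
move=> C0 uC; apply: le_trans (cNM _ _) _; rewrite cN_real.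
apply: le_trans (ler_pM _ (cN_ge0 _) uC (cN_expi _ _)) _ => //.
rewrite (_ : - D * x = c * x + - Im z * x); last by rewrite /D; ring.
by rewrite expRD le_eqVlt; apply/orP; left; apply/eqP; ring.
Qed.

Let Ke x := (K x)%:C * e x.

Lemma ccont_Ke : ccont Ke.
Proof. by apply: ccontM; [exact: ccont_real|exact: ccont_expi]. Qed.

Let FK := fourier (fun x => (K x)%:C) z.
Let M X := citg 0 X Ke.

Lemma FK_tail : exists2 B, 0 <= B & forall X, 0 <= X -> cN (M X - FK) <= B * expR (- D * X).
Proof.
have C0 : 0 <= 2 * C1 by rewrite mulr_ge0.
have [_ h] := ctail (a := 0) ccont_Ke C0 D0 (fun x _ => cN_e_exp C10 (KC x)).
exists (2 * (2 * C1 / D)) => [|X X0]; first by rewrite mulr_ge0// divr_ge0// ltW.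
rewrite -cNN opprB; have -> : FK = cintegral `]0, +oo[ Ke; last exact: h.
have E (u : R[i] -> R) : u 0 = 0 ->
    \int[mu]_x u ((K x)%:C * expi z x) = \int[mu]_(x in `]0, +oo[) u (Ke x).
  move=> u0; rewrite [RHS]Rintegral_mkcond; apply: eq_Rintegral => x _.
  rewrite patchE; case: ifPn => // /negP; rewrite inE/= in_itv/= andbT => /negP.
  by rewrite -leNgt => x0; rewrite (Kle0 cK K0)// rmorph0 mul0r.
by rewrite /FK /fourier /cintegral !E.
Qed.

Lemma K_growth x t : x <= t -> `|K x| <= C1 * expR (c * t).
Proof.
move=> xt; apply: le_trans (KC x) _; rewrite ler_wpM2l// ler_expR.
by rewrite ler_wpM2l// ltW.
Qed.

Let K1 u := itg 0 u K.

Lemma K1_growth u : `|K1 u| <= C1 / c * expR (c * u).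
Proof.
have [u0|u0] := ltP u 0; first by rewrite /K1 itg_lt// normr0 mulr_ge0 ?expR_ge0 ?divr_ge0 ?(ltW c0).
apply: le_trans (itg_norm _ _ cK) _.
have c1 : continuous (fun x => C1 * expR (c * x)).
  by have := @cont_expN C1 (- c); rewrite opprK.
apply: le_trans (le_itg (cont_norm cK) c1 (fun x _ => KC x)) _.
pose F x := C1 / c * expR (c * x).
have cF : continuous F by have := @cont_expN (C1 / c) (- c); rewrite opprK.
have dF x : 0 < x < u -> is_derive x (1:R) F (C1 * expR (c * x)).
  move=> _; have c0' : - c != 0 by rewrite oppr_eq0 gt_eqF.
  have := is_derive_expN C1 x c0'.
  by rewrite opprK invrN mulrN opprK.
have -> := itg_FTC u0 c1 cF dF.
by rewrite lerBlDr lerDl mulr_ge0 ?expR_ge0 ?divr_ge0 ?(ltW c0).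
Qed.

Variables (g t T : R) (p : R -> R).
Hypothesis T0 : 0 < T.
Hypothesis tT : - T <= t <= T.
Hypothesis cp : continuous p.
Hypothesis p1 : forall x, x <= - t -> p x = 1.
Hypothesis p_eq : forall T' x, - T' <= t -> x <= T' ->
  p x + g * itg (- T') t (fun y => K (x + y) * p y) = 1.

Let q x := itg (- T) t (fun y => K (x + y) * p y).

Lemma cont_Kp x : continuous (fun y => K (x + y) * p y).
Proof. by apply: cont_mul => //; exact: cont_shift. Qed.

(** Here [p] is one of the solutions. The part of the integral before [- T], where
    [p = 1], is the primitive [K1] of [K] at [x - T]. *)
Lemma p_split x : p x = 1 - g * K1 (x - T) - g * q x.
Proof.
have /andP[nTt tT'] := tT.
have [xT|Tx] := leP x T.
  have -> : K1 (x - T) = 0.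
    rewrite /K1; move: xT; rewrite le_eqVlt => /predU1P[->|xT]; first by rewrite subrr itg_aa.
    by rewrite itg_lt// subr_lt0.
  by rewrite mulr0 subr0 -(p_eq nTt xT) addrK.
have nxt : - x <= t by lra.
rewrite -(p_eq nxt (lexx x)) (@itg_chasles _ (- x) (- T) t); [|exact: cont_Kp|lra|lra].
have -> : itg (- x) (- T) (fun y => K (x + y) * p y) = K1 (x - T).
  transitivity (itg (- x) (- T) (fun y => K (x + y))).
    by apply: eq_itg => y /andP[_ yT]; rewrite p1 ?mulr1//; lra.
  by rewrite itg_shift ?subrr//; lra.
by rewrite -/(q x); move: (K1 _) (q x) (p x) => A B C; ring.
Qed.

Lemma cont_q : continuous q.
Proof.
have s : scont (fun s => K (s`_1 + s`_0) * p s`_0).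
  apply: scontM; first by apply: scont_comp => //; apply: scontD; exact: scont_nth.
  by apply: scont_comp => //; exact: scont_nth.
exact: (scont_cont1 [::] (scont_itg_cst (- T) t s)).
Qed.

(** All terms of [p_split] inherit the exponential growth of [K]. *)
Lemma p_growth : exists2 C, 0 <= C & forall x, - T <= x -> `|p x| <= C * expR (c * x).
Proof.
have /andP[nTt tT'] := tT.
have [P P0 pP] := cont_bounded T cp.
have C1c : 0 <= C1 / c by rewrite divr_ge0// ltW.
have B0 : 0 <= C1 * expR (c * T) * P * (t + T).
  by rewrite !mulr_ge0 ?expR_ge0//; [exact: ltW|lra].
exists (expR (c * T) + `|g| * (C1 / c) + `|g| * (C1 * expR (c * T) * P * (t + T))) => [|x Tx].
  by apply: addr_ge0; [apply: addr_ge0; rewrite ?expR_ge0//|]; exact: mulr_ge0.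
rewrite p_split; apply: le_trans (ler_normB _ _) _; rewrite [leRHS]mulrDl; apply: lerD.
  apply: le_trans (ler_normB _ _) _; rewrite [leRHS]mulrDl; apply: lerD.
    rewrite normr1 -expRD -expR0 ler_expR -mulrDr mulr_ge0//; first exact: ltW.
    by lra.
  rewrite normrM -mulrA ler_wpM2l//; apply: le_trans (K1_growth _) _.
  by rewrite ler_wpM2l// ler_expR ler_wpM2l ?(ltW c0)//; lra.
rewrite normrM -[leRHS]mulrA ler_wpM2l//.
apply: le_trans (itg_bound (M := C1 * expR (c * (x + T)) * P) (@cont_Kp x) nTt _) _.
  move=> y /andP[y1 y2]; rewrite normrM; apply: ler_pM => //.
    by apply: K_growth; lra.
  by apply: pP; rewrite ler_norml; apply/andP; split; lra.
rewrite [c * (x + T)]mulrDr expRD opprK le_eqVlt; apply/orP; left; apply/eqP.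
by move: (expR _) (expR _) => u v; ring.
Qed.

Let pe x := (p x)%:C * e x.

Lemma ccont_pe : ccont pe.
Proof. by apply: ccontM; [exact: ccont_real|exact: ccont_expi]. Qed.

Lemma pe_tail : cintegrable `]t, +oo[ pe /\
  small T D (fun X => cintegral `]t, +oo[ pe - citg t X pe).
Proof.
have /andP[nTt tT'] := tT.
have [C C0 pC] := p_growth.
have C20 : 0 <= 2 * C by rewrite mulr_ge0.
have [h1 h2] := ctail (a := t) ccont_pe C20 D0
  (fun x tx => cN_e_exp C0 (pC x (le_trans nTt tx))).
by split=> //; eexists => X TX; apply: h2; exact: le_trans TX.
Qed.

Lemma small_e : small T D e.
Proof.
exists 2 => X TX; have X0 : 0 <= X by rewrite (le_trans _ TX)// ltW.
apply: le_trans (cN_expi _ _) _; rewrite ler_pM2l// ler_expR ler_wpM2r// /D.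
by rewrite lerN2 gerDl oppr_le0 ltW.
Qed.

Lemma small_K1e : small T D (fun X => (K1 (X - T))%:C * e X).
Proof.
exists (2 * (C1 / c)) => X TX; apply: cN_e_exp; first by rewrite divr_ge0// ltW.
apply: le_trans (K1_growth _) _; rewrite ler_wpM2l ?divr_ge0 ?(ltW c0)// ler_expR.
by rewrite ler_wpM2l ?(ltW c0)// gerBl ltW.
Qed.

Lemma small_M : small T D (fun X => M (X - T) - FK).
Proof.
have [B B0 h] := FK_tail; exists (B * expR (D * T)) => X TX.
apply: le_trans (h _ _) _; first by rewrite subr_ge0.
by rewrite -mulrA -expRD (_ : D * T + _ = - D * (X - T)); last by ring.
Qed.

Let em x := expi (- z) x.

Lemma ccont_M y : ccont (fun X => M (X + y)).
Proof.
have [k1 k2] := ccont_Ke.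
split=> X; apply: (continuous_comp (f := fun X => X + y) (g := fun u => itg 0 u _)).
- by apply: cvgD; [exact: cvg_id|exact: cvg_cst].
- exact: itg_cont.
- by apply: cvgD; [exact: cvg_id|exact: cvg_cst].
- exact: itg_cont.
Qed.

Lemma ccont_pem : ccont (fun y => (p y)%:C * em y).
Proof. by apply: ccontM; [exact: ccont_real|exact: ccont_expi]. Qed.

Lemma ccont_err X : ccont (fun y => (p y)%:C * em y * (M (X + y) - FK)).
Proof.
apply: ccontM; first exact: ccont_pem.
apply: ccontB; last exact: ccont_cst.
by apply: eq_ccont (ccont_M X) => y; rewrite addrC.
Qed.

Lemma small_err :
  small T D (fun X => citg (- T) t (fun y => (p y)%:C * em y * (M (X + y) - FK))).
Proof.
have /andP[nTt tT'] := tT.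
have [B B0 h] := FK_tail; have [P P0 pP] := cont_bounded T cp.
pose B1 := P * (2 * expR (`|Im z| * T)) * (B * expR (D * T)).
exists (2 * B1 * (t + T)) => X TX.
have := cN_citg (M := B1 * expR (- D * X)) (ccont_err X) nTt.
rewrite opprK => /(_ _)/le_trans; apply.
- move=> y /andP[y1 y2]; have yT : `|y| <= T by rewrite ler_norml; apply/andP; split; lra.
  apply: le_trans (cNM _ _) _; rewrite -[B1 * _]mulrA; apply: ler_pM; rewrite ?cN_ge0//.
    apply: le_trans (cNM _ _) _; apply: ler_pM; rewrite ?cN_ge0//.
      by rewrite cN_real; exact: pP.
    apply: le_trans (cN_expi _ _) _; rewrite ler_pM2l// ler_expR.
    apply: le_trans (ler_norm _) _; rewrite normrM normrN Im_opp normrN.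
    by rewrite ler_wpM2l.
  apply: le_trans (h _ _) _; first by lra.
  rewrite -mulrA -expRD ler_wpM2l// ler_expR (_ : D * T + _ = - D * (X - T)); last by ring.
  by rewrite !mulNr lerN2 ler_wpM2l ?(ltW D0)//; lra.
- by rewrite le_eqVlt; apply/orP; left; apply/eqP; ring.
Qed.

Lemma iz_citg_e a b : a <= b -> 'i * z * citg a b e = e b - e a.
Proof.
move=> ab; rewrite -citgZ//; last exact: ccont_expi.
apply: citg_FTC => //; [by apply: ccontZ; exact: ccont_expi|exact: ccont_expi|].
by move=> x _; exact: cder_expi.
Qed.

Lemma cont_K1 : continuous (fun x => K1 (x - T)).
Proof.
move=> x; apply: (continuous_comp (f := fun x => x - T) (g := K1)); last exact: itg_cont.
by apply: cvgB; [exact: cvg_id|exact: cvg_cst].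
Qed.

(** Integration by parts from [T] on; before [T] the primitive is [0]. *)
Lemma iz_citg_K1 X : T <= X ->
  'i * z * citg (- T) X (fun x => (K1 (x - T))%:C * e x) =
  (K1 (X - T))%:C * e X - e T * M (X - T).
Proof.
move=> TX.
have c1 : ccont (fun x => (K1 (x - T))%:C * e x).
  by apply: ccontM; [exact: ccont_real cont_K1|exact: ccont_expi].
have cKT : continuous (fun x => K (x - T)).
  have := cont_shift cK (x := - T); under eq_fun do rewrite addrC.
  by [].
have c2 : ccont (fun x => (K (x - T))%:C * e x).
  by apply: ccontM; [exact: ccont_real|exact: ccont_expi].
have c3 : ccont (fun x => 'i * z * ((K1 (x - T))%:C * e x)) by exact: ccontZ.
have z0 : citg (- T) T (fun x => (K1 (x - T))%:C * e x) = 0.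
  rewrite (@eq_citg _ _ _ _ (fun=> 0)).
    exact: citg0.
  move=> x /andP[_]; rewrite le_eqVlt => /predU1P[->|xT].
    by rewrite /K1 subrr itg_aa mul0r.
  by rewrite /K1 itg_lt ?subr_lt0// mul0r.
have TT : - T <= T by have T0' := T0; lra.
rewrite (citg_chasles c1 TT TX).
rewrite z0 add0r -citgZ//.
have -> : e T * M (X - T) = citg T X (fun x => (K (x - T))%:C * e x).
  have -> : citg T X (fun x => (K (x - T))%:C * e x) = citg T X (fun x => e T * Ke (- T + x)).
    apply: eq_citg => x _; rewrite /Ke [- T + x]addrC [RHS]mulrCA; congr (_ * _).
    by rewrite /e -expiDr; congr (expi z _); ring.
  rewrite citgZ; last first.
    by exact: ccont_shift ccont_Ke.
  rewrite (@citg_shift T X (- T) Ke TX ccont_Ke) /M.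
  by rewrite addNr [X - T]addrC.
have F : citg T X (fun x => (K (x - T))%:C * e x + 'i * z * ((K1 (x - T))%:C * e x)) =
    (K1 (X - T))%:C * e X - (K1 (T - T))%:C * e T.
  apply: (@citg_FTC _ _ _ _ (fun x => (K1 (x - T))%:C * e x)) => //; first exact: ccontD.
  move=> x /andP[Tx _].
  have d1 : is_derive x (1:R) (fun x => K1 (x - T)) (K (x - T)).
    by apply: is_derive_shiftr; apply: itg_derive => //; rewrite subr_gt0.
  apply: cder_eq (cderM (cder_real d1) (cder_expi z x)).
  by rewrite /e; congr (_ + _); rewrite mulrCA.
have K10 : K1 0 = 0 by rewrite /K1 itg_aa.
rewrite citgD// in F; move: F; rewrite (subrr T) K10 mul0r subr0 => <-.
by rewrite [X in _ = X - _]addrC addrK.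
Qed.

(** Exchange of the integrals, then translation of the inner one by [y]. *)
Lemma citg_q X : T <= X ->
  citg (- T) X (fun x => (q x)%:C * e x) =
  citg (- T) t (fun y => (p y)%:C * em y * M (X + y)).
Proof.
move=> TX; have /andP[nTt tT'] := tT; have TX' : - T <= X by lra.
have [e1 e2] := ccont_expi z.
have swap (u : R -> R) : continuous u ->
  itg (- T) X (fun x => q x * u x) =
  itg (- T) t (fun y => p y * itg (- T) X (fun x => K (x + y) * u x)).
  move=> cu; have s : scont (fun s => K (s`_0 + s`_1) * p s`_1 * u s`_0).
    apply: scontM; last by apply: scont_comp => //; exact: scont_nth.
    apply: scontM; first by apply: scont_comp => //; apply: scontD; exact: scont_nth.
    by apply: scont_comp => //; exact: scont_nth.
  transitivity (itg (- T) X (fun x => itg (- T) t (fun y => K (x + y) * p y * u x))).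
    apply: eq_itg => x _; rewrite mulrC -itgZ; last exact: cont_Kp.
    by apply: eq_itg => y _; rewrite mulrC.
  rewrite (itg_swap (- T) X (- T) t [::] s); apply: eq_itg => y _ /=.
  rewrite -itgZ; last first.
    apply: cont_mul => //; have := cont_shift cK (x := y); under eq_fun do rewrite addrC.
    by [].
  by apply: eq_itg => x _; move: (K _) (p y) (u x) => k1 k2 k3; ring.
have A : citg (- T) X (fun x => (q x)%:C * e x) =
    citg (- T) t (fun y => (p y)%:C * citg (- T) X (fun x => (K (x + y))%:C * e x)).
  apply: cplx_ext; rewrite ?Re_citg ?Im_citg.
    transitivity (itg (- T) X (fun x => q x * Re (e x))).
      by apply: eq_itg => x _; rewrite Re_realM.
    rewrite swap//; apply: eq_itg => y _; rewrite Re_realM Re_citg; congr (_ * _).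
    by apply: eq_itg => x _; rewrite [RHS]Re_realM.
  transitivity (itg (- T) X (fun x => q x * Im (e x))).
    by apply: eq_itg => x _; rewrite Im_realM.
  rewrite swap//; apply: eq_itg => y _; rewrite Im_realM Im_citg; congr (_ * _).
  by apply: eq_itg => x _; rewrite [RHS]Im_realM.
rewrite A; apply: eq_citg => y /andP[y1 y2]; rewrite -mulrA; congr (_ * _).
have -> : citg (- T) X (fun x => (K (x + y))%:C * e x) = citg (- T) X (fun x => em y * Ke (y + x)).
  apply: eq_citg => x _; rewrite /Ke [y + x]addrC [RHS]mulrCA; congr (_ * _).
  by rewrite /em expiN /e -expiDr; congr (expi z _); ring.
rewrite citgZ; last by exact: ccont_shift ccont_Ke.
congr (_ * _); rewrite (@citg_shift (- T) X y Ke TX' ccont_Ke).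
rewrite (@citg_chasles _ (y - T) 0 (y + X) _ ccont_Ke); [|lra|lra].
rewrite (@eq_citg _ _ _ Ke (fun=> 0)).
  by rewrite citg0 add0r /M addrC.
by move=> x /andP[_ x0]; rewrite /Ke (Kle0 cK K0)// mul0r.
Qed.

(** The difference of the two sides, which does not depend on [X], is a combination of
    the error terms above and hence decays as [X] grows. *)
Lemma half_line_transform : cintegrable `]t, +oo[ pe /\
  'i * z * cintegral `]t, +oo[ pe =
  - e (- T) - 'i * z * citg (- T) t pe +
  g%:C * FK * (e T - 'i * z * citg (- T) t (fun y => (p y)%:C * em y)).
Proof.
have /andP[nTt tT'] := tT; have [ipe spe] := pe_tail; split=> //.
apply/eqP; rewrite -subr_eq0; apply/eqP; apply: (@small_cst T D) => //.
pose u X := 'i * z * (cintegral `]t, +oo[ pe - citg t X pe) + e X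
  + (- g%:C) * ((K1 (X - T))%:C * e X) + g%:C * e T * (M (X - T) - FK)
  + (- (g%:C * 'i * z)) * citg (- T) t (fun y => (p y)%:C * em y * (M (X + y) - FK)).
have [B hB] : small T D u.
  apply: smallD; last by apply: smallZ; exact: small_err.
  apply: smallD; last by apply: smallZ; exact: small_M.
  apply: smallD; last by apply: smallZ; exact: small_K1e.
  by apply: smallD; [exact: smallZ|exact: small_e].
exists B => X TX; rewrite (_ : _ - _ = u X); first exact: hB.
have TX' : - T <= X by lra.
have E1 : citg (- T) X pe = citg (- T) X e
    - g%:C * citg (- T) X (fun x => (K1 (x - T))%:C * e x)
    - g%:C * citg (- T) X (fun x => (q x)%:C * e x).
  have c1 : ccont (fun x => (K1 (x - T))%:C * e x).
    by apply: ccontM; [exact: ccont_real cont_K1|exact: ccont_expi].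
  have c2 : ccont (fun x => (q x)%:C * e x).
    by apply: ccontM; [exact: ccont_real cont_q|exact: ccont_expi].
  have ce := ccont_expi z; have cg1 := ccontZ g%:C c1; have cg2 := ccontZ g%:C c2.
  rewrite -(citgZ (- T) X g%:C c1) -(citgZ (- T) X g%:C c2).
  rewrite -(citgB (- T) X ce cg1) -(citgB (- T) X (ccontB ce cg1) cg2).
  apply: eq_citg => x _; rewrite /pe p_split !rmorphB !rmorphM/= rmorph1.
  by rewrite -/(e x); move: (e x) => ?; ring.
have E2 : citg (- T) X pe = citg (- T) t pe + citg t X pe.
  by apply: citg_chasles ccont_pe _ _ => //; lra.
have E3 : citg (- T) t (fun y => (p y)%:C * em y * (M (X + y) - FK)) =
    citg (- T) X (fun x => (q x)%:C * e x) -
    FK * citg (- T) t (fun y => (p y)%:C * em y).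
  rewrite citg_q// -citgZ; last exact: ccont_pem.
  rewrite -citgB; last 2 first.
  - apply: ccontM; first exact: ccont_pem.
    by apply: eq_ccont (ccont_M X) => y; rewrite addrC.
  - by apply: ccontZ; exact: ccont_pem.
  by apply: eq_citg => y _; rewrite mulrBr [FK * _]mulrC.
have E4 := iz_citg_e TX'; have E5 := iz_citg_K1 TX.
rewrite /u E3.
have E6 : citg t X pe = citg (- T) X e
    - g%:C * citg (- T) X (fun x => (K1 (x - T))%:C * e x)
    - g%:C * citg (- T) X (fun x => (q x)%:C * e x) - citg (- T) t pe.
  have key (u1 u2 u3 : R[i]) : u1 = u2 + u3 -> u3 = u1 - u2.
    by move=> ->; rewrite addrC addKr.
  exact: key (etrans (esym E1) E2).
rewrite E6.
have E4' : e X = e (- T) + 'i * z * citg (- T) X e by rewrite E4 addrC subrK.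
have E5' : (K1 (X - T))%:C * e X = e T * M (X - T) +
    'i * z * citg (- T) X (fun x => (K1 (x - T))%:C * e x) by rewrite E5 [RHS]addrC subrK.
rewrite E5' E4'.
have key (i w L G1 Ce Ck Cq G2 eT emT MM h F : R[i]) :
  i * w * L - (- emT - i * w * G1 + h * F * (eT - i * w * G2)) =
  i * w * (L - (Ce - h * Ck - h * Cq - G1)) + (emT + i * w * Ce) +
  - h * (eT * MM + i * w * Ck) + h * eT * (MM - F) + - (h * i * w) * (Cq - F * G2).
  by ring.
exact: key.
Qed.

End Laplace.

End HalfLine.

(** * Transfer of derivatives and values *)

Section Assembly.
Variable R : realType.
Implicit Types (z w d : R[i]) (t x y a b T g e : R).
Notation Re := complex.Re.
Notation Im := complex.Im.

Lemma is_derive_near (u v : R -> R) t (d r : R) : 0 < r -> (forall s, `|s - t| < r -> u s = v s) ->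
  is_derive t (1:R) u d -> is_derive t (1:R) v d.
Proof.
move=> r0 uv /is_deriveE D; apply/is_deriveE => e e0; have [q q0 qD] := D e e0.
exists (Num.min q r) => [|s]; first by rewrite lt_min q0.
rewrite lt_min => /andP[sq sr]; rewrite -!uv ?subrr ?normr0//; exact: qD.
Qed.

Lemma cder_near (u v : R -> R[i]) t d r : 0 < r -> (forall s, `|s - t| < r -> u s = v s) ->
  cder u t d -> cder v t d.
Proof.
by move=> r0 uv [d1 d2]; split; [apply: is_derive_near d1|apply: is_derive_near d2];
  first [exact: r0|move=> s st; rewrite uv].
Qed.

Lemma cderive_cder (u : R -> R[i]) t d : cder u t d -> cderive u t = d.
Proof.
move=> [[_ d1] [_ d2]]; rewrite /cderive !derive1E; apply: cplx_ext => /=.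
  by rewrite d1.
by rewrite d2.
Qed.

Lemma cont_near (u v : R -> R) t r : 0 < r -> (forall s, `|s - t| < r -> u s = v s) ->
  {for t, continuous u} -> {for t, continuous v}.
Proof.
move=> r0 uv cu; have E : u t = v t by rewrite uv// subrr normr0.
rewrite /prop_for /continuous_at -E; apply: cvg_trans cu; apply: near_eq_cvg.
by apply/nbhs_ballP; exists r => // s /=; rewrite /ball/= distrC => /uv.
Qed.

Lemma cont_diff_of (u k : R -> R[i]) (h : R -> R) t d r : 0 < r ->
  (forall s, `|s - t| < r -> cder u s ((h s)%:C * k s)) ->
  {for t, continuous h} -> cder k t d -> cont_diff_at u t.
Proof.
move=> r0 du ch [dk1 dk2].
have [D1 D2] : cder u t ((h t)%:C * k t) by apply: du; rewrite subrr normr0.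
have c1 : {for t, continuous (fun s => Re (k s))}.
  by apply: differentiable_continuous; apply/derivable1_diffP; case: dk1.
have c2 : {for t, continuous (fun s => Im (k s))}.
  by apply: differentiable_continuous; apply/derivable1_diffP; case: dk2.
split; first by case: D1.
split; first by case: D2.
split.
  apply: (@cont_near (fun s => h s * Re (k s)) _ t r) => //; last exact: cvgM.
  by move=> s st; have [[_ h1] _] := du s st; rewrite derive1E h1 Re_realM.
apply: (@cont_near (fun s => h s * Im (k s)) _ t r) => //; last exact: cvgM.
by move=> s st; have [_ [_ h1]] := du s st; rewrite derive1E h1 Im_realM.
Qed.

(** The product of [E] with the quotient is [E (- w)] for [w] near [z]; both factors
    have limits at [z], and [- z] is also a point of continuity of [E]. *)
Lemma quotient_mul (E : R[i] -> R[i]) c (Z : set R[i]) z v : condK1 E c Z ->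
  c < Im z -> mero_quotient (sharp E) E z v -> E z * v = E (- z).
Proof.
move=> [c0 [_ [_ [ZI [_ [Zopp [EZ EE]]]]]]] cz [Enz Ev].
have nZ w : c < Im w -> ~ Z w.
  by move=> cw /ZI/andP[_]; rewrite leNgt cw.
have nZN w : c < Im w -> ~ Z (- w).
  by move=> cw /Zopp; rewrite opprK; exact: nZ.
have cE w : ~ Z w -> (E : R[i]^o -> R[i]^o) x @[x --> (w : R[i]^o)] --> (E w : R[i]^o).
  by move=> nZw; apply: differentiable_continuous; apply/derivable1_diffP; exact: EZ.
have l1 : (fun w : R[i]^o => (E w * (sharp E w / E w) : R[i]^o)) @ (z : R[i]^o)^'
    --> (E z * v : R[i]^o).
  have a1 : (E : R[i]^o -> R[i]^o) x @[x --> (z : R[i]^o)^'] --> (E z : R[i]^o).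
    by apply: cvg_within_filter; apply: cE; exact: nZ.
  exact: (cvgM a1 Ev).
have l2 : (fun w : R[i]^o => (E (- w) : R[i]^o)) @ (z : R[i]^o)^' --> (E (- z) : R[i]^o).
  apply: cvg_within_filter.
  apply: (@cvg_comp _ _ _ (fun w : R[i]^o => - w) (E : R[i]^o -> R[i]^o) _ (nbhs (- z : R[i]^o))).
    by apply: cvgN; exact: cvg_id.
  by apply: cE; exact: nZN.
have l3 : (fun w : R[i]^o => (E (- w) : R[i]^o)) @ (z : R[i]^o)^' --> (E z * v : R[i]^o).
  apply: cvg_trans l1; apply: near_eq_cvg.
  have r0 : 0 < ((Im z - c) / 2)%:C :> R[i] by rewrite ltcR divr_gt0// subr_gt0.
  have nI : \forall w \near (z : R[i]^o)^', c < Im w.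
    apply: cvg_within; apply/nbhs_ballP; exists ((Im z - c) / 2)%:C => // w.
    rewrite -ball_normE/= => zw.
    have h1 : `|Im (z - w)| < Im z - c.
      rewrite -ltcR; apply: le_lt_trans (_ : (cN (z - w))%:C < _).
        by rewrite lecR; exact: Im_le_cN.
      apply: le_lt_trans (cN_le_norm (z - w)) _.
      rewrite (_ : (Im z - c)%:C = 2 * ((Im z - c) / 2)%:C); first by rewrite ltr_pM2l.
      by rewrite -[2](rmorph_nat (real_complex R)) -rmorphM/= mulrC divfK// pnatr_eq0.
    by move: h1; rewrite Im_add Im_opp ltr_norml => /andP[_]; lra.
  near=> w.
  have Ew0 : E w != 0 by near: w.
  have cw : c < Im w by near: w.
  by rewrite (EE w (nZ w cw)) mulrC divfK.
exact: cvg_unique l3 l2.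
Unshelve. all: by end_near. Qed.

End Assembly.

(** * The entire functions behind A and B *)

Section Canonical.
Variable R : realType.
Implicit Types (z w d : R[i]) (t x y a b T g e : R).
Notation Re := complex.Re.
Notation Im := complex.Im.

Variable K : R -> R.
Hypothesis cK : continuous K.
Hypothesis K0 : forall x, x < 0 -> K x = 0.
Variable tau : \bar R.
Variable phi : R -> R -> R -> R.
Hypothesis phi_cont : forall g t, `|g| = 1 -> (t%:E < tau)%E -> continuous (phi g t).
Hypothesis phi_eq : forall g t T x, `|g| = 1 -> (t%:E < tau)%E -> - T <= t -> x <= T ->
  phi g t x + g * itg (- T) t (fun y => K (x + y) * phi g t y) = 1.
Hypothesis inj : forall g t T, `|g| = 1 -> (t%:E < tau)%E -> - T <= t -> t <= T ->
  inj_at K (- T) g t.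

Definition JT T g t z := expi z (- T) / 2 +
  'i * z / 2 * citg (- T) t (fun x => (phi g t x)%:C * expi z x).
(** In [JT] the parameter [T] is any number with [|t| <= T]; in a neighbourhood of a given
    time a fixed [T] serves, whereas [J] has to choose one for every [t]. *)
Definition J g t z := JT (`|t| + 1) g t z.

Lemma ccont_phi_expi g t z : `|g| = 1 -> (t%:E < tau)%E ->
  ccont (fun x => (phi g t x)%:C * expi z x).
Proof.
move=> g1 ttau; apply: ccontM; last exact: ccont_expi.
by apply: ccont_real; exact: phi_cont.
Qed.

(** Between [- T'] and [- T] the solution is [1], and there the integral of [expi z] is
    explicit. *)
Lemma JT_indep g t T T' z : `|g| = 1 -> (t%:E < tau)%E -> `|t| <= T -> T <= T' ->
  JT T' g t z = JT T g t z.
Proof.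
move=> g1 ttau; rewrite ler_norml => /andP[nTt tT] TT'.
rewrite /JT (@citg_chasles _ (- T') (- T) t _ (ccont_phi_expi z g1 ttau)) ?lerN2//.
rewrite (@eq_citg _ (- T') (- T) _ (expi z)); last first.
  by move=> x /andP[_ xT]; rewrite (phi_le cK K0 phi_eq g1 ttau) ?mul1r//; lra.
have nTT : - T' <= - T by rewrite lerN2.
have := iz_citg_e z nTT; move: (citg (- T') (- T) (expi z)) (citg (- T) t _) => u v h.
have -> : 'i * z / 2 * (u + v) = ('i * z * u) / 2 + 'i * z / 2 * v by ring.
by rewrite h; move: (expi _ _) (expi _ _) => p q; ring.
Qed.

Lemma JE g t T z : `|g| = 1 -> (t%:E < tau)%E -> `|t| <= T -> J g t z = JT T g t z.
Proof.
move=> g1 ttau tT; have t1 : `|t| <= `|t| + 1 by rewrite lerDl.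
have [h|h] := leP (`|t| + 1) T; first by rewrite (JT_indep _ _ _ t1 h).
by rewrite /J (JT_indep _ _ _ tT (ltW h)).
Qed.

(** Both [J (- g)] and the [t]-derivative of [J g] are multiples of the same bracket [W]
    of [phi_int_derive], with factors [phi (- g) t t] and [phi g t t], which are
    inverse to each other. *)
Lemma J_cder g t0 z : `|g| = 1 -> (t0%:E < tau)%E ->
  cder (fun t => J g t z) t0 ((phi g t0 t0 ^+ 2)%:C * ('i * z * J (- g) t0 z)).
Proof.
move=> g1 ttau; pose T := `|t0| + 1.
have Ng1 : `|- g| = 1 by rewrite normrN.
have tT : `|t0| < T by rewrite ltrDl.
have [nTt tT'] : - T < t0 /\ t0 < T by move: tT; rewrite ltr_norml => /andP.
have [r [cr H1 H2]] := phi_int_derive cK K0 phi_cont phi_eq inj ttau tT.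
have [e1 e2] := ccont_expi z.
have [de1 de2] := ccontZ ('i * z) (ccont_expi z).
have [cr1 cr2] : ccont (fun x => (r g x)%:C * expi z x).
  by apply: ccontM; [apply: ccont_real; exact: cr|exact: ccont_expi].
pose I := citg (- T) t0 (fun x => (r g x)%:C * expi z x).
pose W := expi z t0 - g%:C * I.
have ReI : itg (- T) t0 (fun x => r g x * Re (expi z x)) = Re I.
  by rewrite /I Re_citg; apply: eq_itg => x _; rewrite [RHS]Re_realM.
have ImI : itg (- T) t0 (fun x => r g x * Im (expi z x)) = Im I.
  by rewrite /I Im_citg; apply: eq_itg => x _; rewrite [RHS]Im_realM.
have ReW : Re (expi z t0) - g * Re I = Re W by rewrite /W Re_add Re_opp (Re_realM g I).
have ImW : Im (expi z t0) - g * Im I = Im W by rewrite /W Im_add Im_opp (Im_realM g I).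
have D1 : cder (fun t => citg (- T) t (fun x => (phi g t x)%:C * expi z x)) t0
    ((phi g t0 t0)%:C * W).
  split.
    have := H1 g _ g1 e1; rewrite ReI ReW Re_realM.
    rewrite (_ : (fun t => itg _ t _) =
      fun t => Re (citg (- T) t (fun x => (phi g t x)%:C * expi z x)))//.
    apply/funext => t; rewrite Re_citg; apply: eq_itg => x _; by rewrite [RHS]Re_realM.
  have := H1 g _ g1 e2; rewrite ImI ImW Im_realM.
  rewrite (_ : (fun t => itg _ t _) =
    fun t => Im (citg (- T) t (fun x => (phi g t x)%:C * expi z x)))//.
  apply/funext => t; rewrite Im_citg; apply: eq_itg => x _; by rewrite [RHS]Im_realM.
have D2 : 'i * z * citg (- T) t0 (fun x => (phi (- g) t0 x)%:C * expi z x) =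
    (phi (- g) t0 t0)%:C * W - expi z (- T).
  rewrite -citgZ; last exact: ccont_phi_expi.
  apply: cplx_ext; rewrite ?Re_citg ?Im_citg ?Re_add ?Im_add ?Re_opp ?Im_opp.
    have dR x : is_derive x (1:R) (fun x => Re (expi z x)) (Re ('i * z * expi z x)).
      by have [] := cder_expi z x.
    have := H2 g _ _ g1 e1 de1 dR; rewrite ReI ReW (Re_realM _ W) => <-.
    by apply: eq_itg => x _; rewrite mulrCA [LHS]Re_realM.
  have dI x : is_derive x (1:R) (fun x => Im (expi z x)) (Im ('i * z * expi z x)).
    by have [] := cder_expi z x.
  have := H2 g _ _ g1 e2 de2 dI; rewrite ImI ImW (Im_realM _ W) => <-.
  by apply: eq_itg => x _; rewrite mulrCA [LHS]Im_realM.
have E : J (- g) t0 z = (phi (- g) t0 t0)%:C * W / 2.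
  rewrite (JE _ Ng1 ttau (ltW tT)) /JT.
  have key (C u v w : R[i]) : w * C = u - v -> v / 2 + w / 2 * C = u / 2.
    by move=> h; rewrite [w / 2 * C]mulrAC h; ring.
  exact: key D2.
have PP := phi_diagN cK K0 phi_cont phi_eq inj g1 ttau.
have [n n0 ntau] := tau_near ttau.
apply: (@cder_near _ (fun t => JT T g t z) _ _ _ (Num.min 1 n)); first by rewrite lt_min ltr01.
  move=> s; rewrite lt_min => /andP[s1 /ntau stau]; rewrite (JE (T := T))//.
  by have := ler_normD (s - t0) t0; rewrite subrK /T; lra.
have D3 := cderD (cder_cst (expi z (- T) / 2) t0) (cderZ ('i * z / 2) D1).
apply: cder_eq D3; rewrite E add0r.
move: PP => /(congr1 (fun u : R => u%:C)); rewrite rmorphM rmorphXn/= rmorph1.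
clearbody W; move: (phi g t0 t0)%:C (phi (- g) t0 t0)%:C => P Q PQ.
have -> : P ^+ 2 * ('i * z * (Q * W / 2)) = (P * Q) * ('i * z / 2 * (P * W)) by ring.
by rewrite PQ mul1r.
Qed.

Lemma citg_conj a b (f : R -> R[i]) : ccont f -> (citg a b f)^*%C = citg a b (fun x => (f x)^*%C).
Proof.
move=> [f1 f2]; apply: cplx_ext; rewrite ?Re_conjc ?Im_conjc ?Re_citg ?Im_citg.
  by apply: eq_itg => x _; rewrite Re_conjc.
by rewrite -itgN//; apply: eq_itg => x _; rewrite Im_conjc.
Qed.

Lemma conjcD z w : (z + w)^*%C = z^*%C + w^*%C.
Proof. by case: z w => [a b] [c d]; apply: cplx_ext => //=; rewrite opprD. Qed.
Lemma conjcM z w : (z * w)^*%C = z^*%C * w^*%C.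
Proof. by case: z w => [a b] [c d]; apply: cplx_ext => /=; ring. Qed.

Lemma J_conj g t z : `|g| = 1 -> (t%:E < tau)%E -> (J g t z^*%C)^*%C = J g t (- z).
Proof.
move=> g1 ttau; rewrite /J /JT.
have key (a b v : R[i]) : (a / 2 + 'i * b / 2 * v)^*%C = a^*%C / 2 - 'i * b^*%C / 2 * v^*%C :> R[i].
  have c2 : (2^-1 : R[i])^*%C = 2^-1 by rewrite fmorphV rmorph_nat.
  have ci : ('i : R[i])^*%C = - 'i by apply: cplx_ext; rewrite /= ?oppr0.
  by rewrite conjcD !conjcM c2 ci; ring.
have cx : (z^*%C)^*%C = z by case: z => p q; rewrite /= opprK.
rewrite key conj_expi citg_conj; last exact: ccont_phi_expi.
rewrite cx mulrN !mulNr; congr (_ - _ * _); apply: eq_citg => x _.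
rewrite [LHS]conjcM conj_expi; congr (_ * _).
by apply: cplx_ext; rewrite /= ?oppr0.
Qed.

Lemma J_derivable g t z : `|g| = 1 -> (t%:E < tau)%E ->
  derivable (J g t : R[i]^o -> R[i]^o) z 1.
Proof.
move=> g1 ttau; rewrite /J /JT.
have := ler_norm (- t); rewrite normrN => tt.
have d1 : derivable ((fun w => expi w (- (`|t| + 1))) : R[i]^o -> R[i]^o) z 1 by exact: derivable_expi.
have d2 : derivable ((fun w => citg (- (`|t| + 1)) t (fun x => (phi g t x)%:C * expi w x)) :
    R[i]^o -> R[i]^o) z 1.
  by apply: derivable_citg; [exact: phi_cont|lra].
have d3 : derivable ((fun w => 'i * w / 2) : R[i]^o -> R[i]^o) z 1.
  apply: (@derivable_quad R _ z ('i / 2) 1) => // h h1.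
  rewrite (_ : _ - _ = 0); last by ring.
  by rewrite cN0 mul1r sqr_ge0.
have d4 : derivable ((fun w => expi w (- (`|t| + 1)) / 2) : R[i]^o -> R[i]^o) z 1.
  have dc : derivable ((fun=> 2^-1) : R[i]^o -> R[i]^o) z 1 by exact: derivable_cst.
  exact: (derivableM d1 dc).
exact: (derivableD d4 (derivableM d3 d2)).
Qed.

Lemma J0 g z : `|g| = 1 -> (0 < tau)%E -> J g 0 z = 2^-1.
Proof.
move=> g1 tau0; rewrite /J /JT normr0 add0r.
rewrite (@eq_citg _ _ _ _ (expi z)); last first.
  by move=> x /andP[_ x0]; rewrite (phi_le cK K0 phi_eq g1 tau0) ?mul1r ?oppr0.
have n1 : - 1 <= 0 :> R by rewrite lerN10.
have -> : 'i * z / 2 * citg (- 1) 0 (expi z) = 'i * z * citg (- 1) 0 (expi z) / 2 by exact: mulrAC.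
by rewrite (iz_citg_e z n1) expi0; move: (expi _ _) => u; ring.
Qed.

Section Half.
Variables (c C1 : R).
Hypothesis c0 : 0 < c.
Hypothesis C10 : 0 <= C1.
Hypothesis KC : forall x, `|K x| <= C1 * expR (c * x).

(** The transform over the half-line splits into the contributions of [z] and of
    [- z]. *)
Lemma J_half_line g t z : `|g| = 1 -> (t%:E < tau)%E -> c < Im z ->
  cintegrable `]t, +oo[ (fun x => (phi g t x)%:C * expi z x) /\
  - ('i * z / 2) * cintegral `]t, +oo[ (fun x => (phi g t x)%:C * expi z x) =
  J g t z - g%:C * fourier (fun x => (K x)%:C) z * J g t (- z).
Proof.
move=> g1 ttau cz; pose T := `|t| + 1.
have T0 : 0 < T by rewrite ltr_wpDl.
have tT : `|t| <= T by rewrite lerDl.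
have tT' : - T <= t <= T by rewrite -ler_norml.
have [h1 h2] := half_line_transform cK K0 c0 C10 KC cz T0 tT' (phi_cont g1 ttau)
  (fun x => phi_le cK K0 phi_eq g1 ttau) (fun T' x => phi_eq g1 ttau).
split=> //.
rewrite (JE z g1 ttau tT) (JE (- z) g1 ttau tT) /JT expiN opprK.
rewrite (_ : - ('i * z / 2) * _ = - (2^-1 * ('i * z * cintegral `]t, +oo[ (fun x => (phi g t x)%:C * expi z x)))).
  rewrite h2.
  move: (expi z _) (expi z _) (citg _ _ _) (citg _ _ _) (fourier _ _) (g%:C) => a1 a2 a3 a4 a5 a6; ring.
by move: (cintegral _ _) => u; ring.
Qed.
End Half.

End Canonical.

(** * Reality and regularity of the given solutions *)

Section Solutions.
Variable R : realType.
Notation mu := (@lebesgue_measure R).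
Implicit Types (z w d : R[i]) (t x y a b T g e : R).
Notation Re := complex.Re.
Notation Im := complex.Im.
Variable K : R -> R.
Hypothesis cK : continuous K.
Hypothesis K0 : forall x, x < 0 -> K x = 0.

Lemma solves_one_parts g t (f : R -> R[i]) : solves_one K g t f ->
  (forall x, mu.-integrable `]-oo, t[ (fun y => (K (x + y) * Re (f y))%:E) /\
    Re (f x) + g * \int[mu]_(y in `]-oo, t[) (K (x + y) * Re (f y)) = 1) /\
  (forall x, mu.-integrable `]-oo, t[ (fun y => (K (x + y) * Im (f y))%:E) /\
    Im (f x) + g * \int[mu]_(y in `]-oo, t[) (K (x + y) * Im (f y)) = 0).
Proof.
move=> H; split=> x; have [[i1 i2] E] := H x; split.
- by apply: eq_integrable i1 => // y _; rewrite Re_realM.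
- have := congr1 (@complex.Re R) E; rewrite Re_add Re_realM/= => <-.
  by congr (_ + _ * _); apply: eq_Rintegral => y _; rewrite [RHS]Re_realM.
- by apply: eq_integrable i2 => // y _; rewrite Im_realM.
- have := congr1 (@complex.Im R) E; rewrite Im_add Im_realM/= => <-.
  by congr (_ + _ * _); apply: eq_Rintegral => y _; rewrite [RHS]Im_realM.
Qed.

Variable tau : \bar R.
Hypothesis inj : forall g t T, `|g| = 1 -> (t%:E < tau)%E -> - T <= t -> t <= T ->
  inj_at K (- T) g t.

(** The equation at a point involves the interval [[- T, t]] for [T] large, and
    injectivity holds for each of them. *)
Lemma homogeneous_zero g t (u : R -> R) : `|g| = 1 -> (t%:E < tau)%E -> continuous u ->
  (forall T x, - T <= t -> x <= T -> u x + g * itg (- T) t (fun y => K (x + y) * u y) = 0) ->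
  forall x, u x = 0.
Proof.
move=> g1 ttau cu H x; pose T := `|t| + `|x| + 1.
have tT : `|t| < T by rewrite /T; have := normr_ge0 x; lra.
have xT : - T <= x <= T.
  by rewrite -ler_norml /T; have := normr_ge0 t; lra.
have [U [UT tU Utau]] := local_bound ttau tT.
have [ntT tT'] : - T < t /\ t < T by move: tT; rewrite ltr_norml => /andP.
have inj' g' s : `|g'| = 1 -> - T < s -> s < U -> inj_at K (- T) g' s.
  by move=> g'1 Ts sU; apply: inj => //; [exact: Utau|exact: ltW|lra].
apply: (inj_sub cK UT inj' (f2 := fun=> 0) g1 ntT tU cu) => //.
  exact: cont_cst.
move=> y /andP[_ yT]; rewrite (H T y (ltW ntT) yT) add0r.
rewrite (@eq_itg _ _ _ _ (fun=> 0)) ?(itg_cst _ (ltW ntT)) ?mul0r ?mulr0//.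
by move=> w _; rewrite mulr0.
Qed.

(** The imaginary part solves the homogeneous equation. *)
Lemma solves_one_real g t (f : R -> R[i]) : `|g| = 1 -> (t%:E < tau)%E -> solves_one K g t f ->
  [/\ f = (fun x => (Re (f x))%:C), continuous (fun x => Re (f x)) &
   forall T x, - T <= t -> x <= T ->
     Re (f x) + g * itg (- T) t (fun y => K (x + y) * Re (f y)) = 1].
Proof.
move=> g1 ttau /solves_one_parts[HR HI].
have [cR _ eR] := solves_real cK K0 g1 HR.
have [cI _ eI] := solves_real cK K0 g1 HI.
split=> //; apply/funext => x; apply: cplx_ext => //=.
exact: (homogeneous_zero g1 ttau cI eI).
Qed.

End Solutions.

(** * The theorem *)

Section Bound.
Variable R : realType.

Lemma norm1_cases (g : R) : `|g| = 1 -> g = 1 \/ g = -1.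
Proof. by case: (ger0P g) => _ h; [left|right]; rewrite -?h ?opprK. Qed.

(** On the bounded set where the assumed bound may fail, [K] is bounded. *)
Lemma growth_bound (E : R[i] -> R[i]) c (K : R -> R) : 0 < c -> condK2 E c K -> condK3 K ->
  exists2 C, 0 <= C & forall x, `|K x| <= C * expR (c * x).
Proof.
move=> c0 [cK [[C [X KX]] _]] K0; have [M M0 KM] := cont_bounded `|X| cK.
exists (`|C| + M) => [|x]; first by rewrite addr_ge0// ltW.
have e0 : 0 <= expR (c * x) by exact: expR_ge0.
have [x0|x0] := ltP x 0; first by rewrite K0// normr0 mulr_ge0// addr_ge0// ltW.
rewrite mulrDl; have [Xx|xX] := leP X x.
  apply: ler_wpDr; first by rewrite mulr_ge0// ltW.
  have := KX x; rewrite ger0_norm// => /(_ Xx)/le_trans; apply.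
  by rewrite ler_wpM2r// ler_norm.
apply: ler_wpDl; first by rewrite mulr_ge0.
apply: le_trans (KM x _) _.
  by rewrite ger0_norm// (le_trans (ltW xX))// ler_norm.
rewrite -[leLHS]mulr1 ler_wpM2l ?(ltW M0)// -expR0 ler_expR.
by rewrite mulr_ge0// ltW.
Qed.

End Bound.
Theorem theorem1p1 (R : realType) (E : R[i] -> R[i]) (c : R) (Z : set R[i])
    (K : R -> R) (Lam : set R) (tau : \bar R) (Phi Psi : R -> R -> R[i])
    (hK1 : condK1 E c Z) (hK2 : condK2 E c K) (hK3 : condK3 K)
    (hK4 : condK4 K Lam) (hK5 : condK5 K tau)
    (hPhi : forall t : R, (t%:E < tau)%E -> solves_one K 1 t (Phi t))
    (hPsi : forall t : R, (t%:E < tau)%E -> solves_one K (- 1) t (Psi t)) :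
  exists A B : R -> R[i] -> R[i],
    (* (1) *)
    (forall t : R, (t%:E < tau)%E ->
       (forall z : R[i], c < complex.Im z ->
          [/\ cintegrable `]t, +oo[ (fun x => Psi t x * expi z x),
              cintegrable `]t, +oo[ (fun x => Phi t x * expi z x),
              A t z = AB_integral E (Psi t) t z &
              - 'i * B t z = AB_integral E (Phi t) t z]) /\
       analytic_off Z (A t) /\ analytic_off Z (B t) /\
       (forall z : R[i], ~ Z z ->
          [/\ A t (- z) = A t z, B t (- z) = - B t z,
              A t z = (A t (z^*))^* & B t z = (B t (z^*))^*])) /\
    (* (2) *)
    (forall z : R[i], ~ Z z -> forall t : R, (t%:E < tau)%E ->
       cont_diff_at (fun s => A s z) t /\ cont_diff_at (fun s => B s z) t) /\
    (* (3) *)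
    (forall z : R[i], ~ Z z -> forall t : R, (t%:E < tau)%E ->
       - cv2 (cderive (fun s => A s z) t) (cderive (fun s => B s z) t) =
       z *: (mx2 0 (- 1) 1 0 *m map_mx (real_complex R) (hamiltonian K t)
             *m cv2 (A t z) (B t z))) /\
    (* (4) *)
    (forall z : R[i], ~ Z z ->
       [/\ A_of E z = A 0 z, B_of E z = B 0 z & E z = A 0 z - 'i * B 0 z]).

Proof.
have [c0 [_ [Z0 [ZI [Zconj [Zopp [EZ EE]]]]]]] := hK1.
have [cK [_ KQ]] := hK2; have [tau0 nev] := hK5.
have [C1 C10 KC] := growth_bound c0 hK2 hK3.
have inj g t T : `|g| = 1 -> (t%:E < tau)%E -> - T <= t -> t <= T -> inj_at K (- T) g t.
  move=> g1 ttau Tt tT; apply: (inj_at_K5 cK hK3 g1 Tt tT) => t0.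
  have [n1 n2] := nev t t0 ttau.
  by have [->|->] := norm1_cases g1; rewrite ?opprK ?rmorphN rmorph1.
(* one family for both equations, indexed by the sign of the kernel *)
pose f (g t : R) : R -> R[i] := if g == 1 then Phi t else Psi t.
have fS g t : `|g| = 1 -> (t%:E < tau)%E -> solves_one K g t (f g t).
  move=> g1 ttau; rewrite /f; have [->|->] := norm1_cases g1; first by rewrite eqxx; exact: hPhi.
  by case: eqP => [e1|_]; [exfalso; have := oppr_lt0 (1 : R); rewrite ltr01; lra|exact: hPsi].
pose phi g t x := complex.Re (f g t x).
have phi_cont g t : `|g| = 1 -> (t%:E < tau)%E -> continuous (phi g t).
  by move=> g1 ttau; have [_] := solves_one_real cK hK3 inj g1 ttau (fS g t g1 ttau).
have phi_eq g t T x : `|g| = 1 -> (t%:E < tau)%E -> - T <= t -> x <= T ->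
    phi g t x + g * itg (- T) t (fun y => K (x + y) * phi g t y) = 1.
  by move=> g1 ttau; have [_ _] := solves_one_real cK hK3 inj g1 ttau (fS g t g1 ttau); exact.
have g1 : `|1 : R| = 1 by rewrite normr1.
have Ng1 : `|-1 : R| = 1 by rewrite normrN.
have PhiE t : (t%:E < tau)%E -> Phi t = fun x => (phi 1 t x)%:C.
  move=> ttau; have [+ _ _] := solves_one_real cK hK3 inj g1 ttau (fS 1 t g1 ttau).
  by rewrite /phi /f eqxx.
have PsiE t : (t%:E < tau)%E -> Psi t = fun x => (phi (-1) t x)%:C.
  move=> ttau; have [+ _ _] := solves_one_real cK hK3 inj Ng1 ttau (fS (-1) t Ng1 ttau).
  rewrite /phi /f; case: eqP => // e1.
  by exfalso; have := ltr01 (R := R); rewrite -[X in _ < X]e1; lra.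
pose Ja := J phi (-1); pose Jb := J phi 1.
pose A t z := E z * Ja t z + E (- z) * Ja t (- z).
pose B t z := 'i * (E z * Jb t z - E (- z) * Jb t (- z)).
exists A, B.
have nZN z : ~ Z z -> ~ Z (- z) by move=> nz /Zopp; rewrite opprK.
have ii : 'i * 'i = -1 :> R[i] by apply: cplx_ext => /=; ring.
have dJ g t z := J_cder cK hK3 phi_cont phi_eq inj (g := g) (t0 := t) z.
have dA t z : (t%:E < tau)%E ->
    cder (fun s => A s z) t ((phi (-1) t t ^+ 2)%:C * (z * B t z)).
  move=> ttau; have d1 := dJ _ t z Ng1 ttau; have d2 := dJ _ t (- z) Ng1 ttau.
  rewrite opprK in d1 d2.
  apply: cder_eq (cderD (cderZ (E z) d1) (cderZ (E (- z)) d2)).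
  by rewrite /B /Jb; move: (J _ _ _ _) (J _ _ _ _) (_%:C) => u v w; ring.
have dB t z : (t%:E < tau)%E ->
    cder (fun s => B s z) t ((phi 1 t t ^+ 2)%:C * (- z * A t z)).
  move=> ttau; have d1 := dJ _ t z g1 ttau; have d2 := dJ _ t (- z) g1 ttau.
  have d3 := cderZ ('i%R : R[i]) (cderD (cderZ (E z) d1) (cderZ (-1) (cderZ (E (- z)) d2))).
  have d4 := eq_cder (g := fun s => B s z) _ d3.
  apply: cder_eq (d4 _); last by move=> s; rewrite /B mulN1r.
  rewrite /A /Ja; move: (J _ _ _ _) (J _ _ _ _) (_%:C) => u v w.
  move: (E z) (E (- z)) => p q.
  transitivity (('i * 'i) * (w * (z * (p * v + q * u)))); first by ring.
  by rewrite ii; ring.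
have cP g t : `|g| = 1 -> (t%:E < tau)%E -> {for t, continuous (fun s => phi g s s ^+ 2)}.
  move=> gg ttau.
  have h : {for t, continuous (fun s => phi g s s)}.
    apply/cvgrPdist_lt => e e0.
    have [d d0 hd] := phi_diag_cont cK hK3 phi_cont phi_eq inj gg ttau e0.
    apply/nbhs_ballP; exists d => // s /=; rewrite /ball/= distrC => /hd.
    by rewrite distrC.
  exact: cvgM.
have hg t : (t%:E < tau)%E ->
    phi (-1) t t ^+ 2 = gamma_fun K t /\ phi 1 t t ^+ 2 = (gamma_fun K t)^-1.
  by move=> ttau; exact: (phi_diag_gamma cK hK3 phi_cont phi_eq inj ttau).
split; [move=> t ttau; split; [|split; [|split]]|split; [|split]].
- move=> z cz.
  have [i1 h1] := J_half_line cK hK3 phi_cont phi_eq c0 C10 KC Ng1 ttau cz.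
  have [i2 h2] := J_half_line cK hK3 phi_cont phi_eq c0 C10 KC g1 ttau cz.
  have EF := quotient_mul hK1 cz (KQ z cz).
  have kk (p q u v : R[i]) : p * u = v -> p * q * u = q * v by move=> <-; ring.
  rewrite /AB_integral (PsiE t ttau) (PhiE t ttau); split=> //.
  + rewrite (kk _ (E z) _ _ h1) /A /Ja -EF rmorphN rmorph1.
    by move: (J _ _ _ _) (J _ _ _ _) (fourier _ _) => u v w; ring.
  + rewrite (kk _ (E z) _ _ h2) /B /Jb -EF rmorph1 mulrA mulNr ii opprK mul1r.
    by move: (J _ _ _ _) (J _ _ _ _) (fourier _ _) => u v w; ring.
- move=> z nz; have dE := EZ z nz; have dEN := @derivable_reflect R E z (EZ _ (nZN z nz)).
  have j1 := J_derivable phi_cont (z := z) Ng1 ttau.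
  have j2 := @derivable_reflect R (J phi (-1) t) z (J_derivable phi_cont (z := - z) Ng1 ttau).
  exact: (derivableD (derivableM dE j1) (derivableM dEN j2)).
- move=> z nz; have dE := EZ z nz; have dEN := @derivable_reflect R E z (EZ _ (nZN z nz)).
  have j1 := J_derivable phi_cont (z := z) g1 ttau.
  have j2 := @derivable_reflect R (J phi 1 t) z (J_derivable phi_cont (z := - z) g1 ttau).
  have di : derivable ((fun=> 'i%R) : R[i]^o -> R[i]^o) z 1 by exact: derivable_cst.
  exact: (derivableM di (derivableB (derivableM dE j1) (derivableM dEN j2))).
- move=> z nz; have nzN := nZN z nz.
  have Ez : (E (z^*%C))^*%C = E (- z) by exact: EE.
  have EzN : (E (- (z^*%C)))^*%C = E z.
    have := EE _ nzN; rewrite /sharp opprK => <-.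
    by congr ((E _)^*%C); case: (z) => p q.
  have JN (g : R) : `|g| = 1 -> (J phi g t (- (z^*%C)))^*%C = J phi g t z.
    move=> gg; have := J_conj phi_cont (- z) gg ttau; rewrite opprK => <-.
    by congr ((J _ _ _ _)^*%C); case: (z) => p q.
  have Jz (g : R) : `|g| = 1 -> (J phi g t (z^*%C))^*%C = J phi g t (- z).
    by move=> gg; exact: (J_conj phi_cont z gg ttau).
  have conjB (p q u v : R[i]) :
      ('i * (p * u - q * v))^*%C = 'i * (q^*%C * v^*%C - p^*%C * u^*%C).
    by move: p q u v => [? ?] [? ?] [? ?] [? ?]; apply: cplx_ext => /=; ring.
  split.
  + by rewrite /A opprK addrC.
  + by rewrite /B opprK; ring.
  + by rewrite /A conjcD !conjcM Ez EzN /Ja JN// Jz// addrC.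
  + by rewrite /B conjB Ez EzN /Jb JN// Jz//.
- move=> z nz t ttau; have [n n0 ntau] := tau_near ttau; split.
  + apply: (cont_diff_of n0 _ (cP (-1) t Ng1 ttau) (cderZ z (dB t z ttau))).
    by move=> s /ntau stau; exact: dA.
  + apply: (cont_diff_of n0 _ (cP 1 t g1 ttau) (cderZ (- z) (dA t z ttau))).
    by move=> s /ntau stau; exact: dB.
- move=> z nz t ttau.
  rewrite (cderive_cder (dA t z ttau)) (cderive_cder (dB t z ttau)).
  have [-> ->] := hg t ttau; rewrite /hamiltonian.
  move: (A t z) (B t z) (gamma_fun K t)^-1 (gamma_fun K t) => u v p q.
  apply/matrixP => i j; rewrite !mxE !big_ord_recl !big_ord0 !mxE !big_ord_recl !big_ord0 !mxE.
  case: i => [[|[|i]] hi] //=; rewrite ?(rmorph0, mul0r, mulr0, addr0, add0r, mul1r, mulN1r, mulr1).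
    by ring.
  by move: ((q^-1)%:C) => w; ring.
- move=> z nz; have t0tau : (0%:E < tau)%E by [].
  have AE : A 0 z = (E z + E (- z)) / 2.
    rewrite /A /Ja !(J0 cK hK3 phi_eq _ Ng1 tau0); by rewrite mulrDl.
  have BE : B 0 z = 'i / 2 * (E z - E (- z)).
    rewrite /B /Jb !(J0 cK hK3 phi_eq _ g1 tau0); ring.
  rewrite AE BE /A_of /B_of EE//; split=> //.
  by rewrite !mulrA ii; field.
Qed.
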